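(* Let $\Omega$ be a convex polygon with corners $w_1,\dots,w_m$, and let $f$ be an analytic function in $\Omega$ that is analytic on the interior of each side segment and can be analytically continued to a disk near each $w_k$ with a slit along the exterior bisector there. Assume $f$ satisfies $f(z)-f(w_k)=O(|z-w_k|^\delta)$ as $z\to w_k$ for each $k$, for some $\delta>0$. Then there exist degree $n$ rational functions $\{r_n\}$, $1\le n<\infty$, such that $$\|f-r_n\|_\Omega=O(e^{-C\sqrt n})$$ as $n\to\infty$ for some $C>0$. Moreover, each $r_n$ can be taken to have finite poles only at points exponentially clustered along the exterior bisectors at the corners, with arbitrary clustering parameter $\sigma>0$ (the constant $C$ may depend on $\sigma$), so long as the number $n_k=n_k(n)$ of poles near each $w_k$ grows at least in proportion to $n$ as $n\to\infty$.
   Context: $\Omega\subset\mathbb{C}$ is the open region bounded by the polygon, with all internal angles $<\pi$. The exterior bisector at $w_k$ is the ray from $w_k$ pointing out of $\Omega$ opposite to the bisector of the interior angle; let $d_k$ ($|d_k|=1$) be its direction. The continuation hypothesis means that for each $k$, $f$ extends analytically to $\{|z-w_k|<s_k\}\setminus\{w_k+t d_k:\ t\ge 0\}$ for some $s_k>0$; $f(w_k)$ denotes the limiting value of $f$ at $w_k$, and the condition $f(z)-f(w_k)=O(|z-w_k|^\delta)$ concerns $z\to w_k$ within this slit disk. ''Analytic on the interior of each side segment'' means that $f$ extends analytically to a neighborhood of each point in the relative interior of each side. The degree of a rational function is the maximum of the degrees of its numerator and denominator, and ''degree $n$'' means degree at most $n$. $\|\cdot\|_\Omega$ is the supremum norm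 over $\Omega$. ''Exponentially clustered along the exterior bisectors with clustering parameter $\sigma$'' means that, after translating, rotating and scaling (by a factor independent of $n$) so that $w_k$ goes to $0$ and the exterior bisector goes to the negative real axis, the $n_k$ pole locations associated with $w_k$ are $-e^{-\sigma j/\sqrt{n_k}}$, $0\le j\le n_k-1$; that is, they are the points $w_k+R_k d_k e^{-\sigma j/\sqrt{n_k}}$ for some scale $R_k>0$ independent of $n$. Here $n_1+\dots+n_m\le n$, and growing at least in proportion to $n$ means $\liminf_{n\to\infty} n_k(n)/n>0$ for each $k$. *)

(* Defs.v *)
From Stdlib Require Export Reals List.
From Coquelicot Require Export Coquelicot.
Open Scope R_scope.

(* [Re u * Im v - Im u * Re v]; positive iff [v] points strictly to the left of [u]. *)
Definition cross (u v : C) : R := Im (Cmult (Cconj u) v).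

Definition unit_dir (u : C) : C := Cdiv u (RtoC (Cmod u)).

(* The corners are [w 0, ..., w (m - 1)]; values of [w] beyond [m] are unused. *)
Definition next (m k : nat) : nat := ((k + 1) mod m)%nat.
Definition prev (m k : nat) : nat := ((k + (m - 1)) mod m)%nat.

Definition side (m : nat) (w : nat -> C) (k : nat) : C := Cminus (w (next m k)) (w k).

(* The corners are listed counterclockwise. Requiring every other corner to lie
   strictly to the left of each oriented side makes every interior angle < PI and
   rules out self-intersecting closed chains such as the pentagram. *)
Definition convex_polygon (m : nat) (w : nat -> C) : Prop :=
  (3 <= m)%nat /\
  forall k j : nat, (k < m)%nat -> (j < m)%nat -> j <> k -> j <> next m k ->
    0 < cross (side m w k) (Cminus (w j) (w k)).

Definition polygon_region (m : nat) (w : nat -> C) (z : C) : Prop :=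
  forall k : nat, (k < m)%nat -> 0 < cross (side m w k) (Cminus z (w k)).

Definition open_side (m : nat) (w : nat -> C) (k : nat) (p : C) : Prop :=
  exists t : R, 0 < t < 1 /\ p = Cplus (w k) (Cmult (RtoC t) (side m w k)).

(* The sum of the unit vectors from [w k] towards its two neighbours spans the
   bisector of the interior angle. *)
Definition exterior_bisector (m : nat) (w : nat -> C) (k : nat) : C :=
  unit_dir (Copp (Cplus (unit_dir (Cminus (w (next m k)) (w k)))
                        (unit_dir (Cminus (w (prev m k)) (w k))))).

Definition disk (c : C) (s : R) (z : C) : Prop := Cmod (Cminus z c) < s.

Definition slit_disk (c : C) (s : R) (d z : C) : Prop :=
  disk c s z /\ forall t : R, 0 <= t -> z <> Cplus c (Cmult (RtoC t) d).

(* Complex differentiability; only used with open sets [U]. *)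
Definition analytic_on (U : C -> Prop) (f : C -> C) : Prop :=
  forall z : C, U z -> ex_derive (K := C_AbsRing) (V := C_NormedModule) f z.

Definition analytic_extension (Omega : C -> Prop) (f : C -> C)
    (U : C -> Prop) (F : C -> C) : Prop :=
  analytic_on U F /\ forall z : C, U z -> Omega z -> F z = f z.

Definition extends_near (Omega : C -> Prop) (f : C -> C) (p : C) : Prop :=
  exists (eps : R) (F : C -> C), 0 < eps /\ analytic_extension Omega f (disk p eps) F.

(* [L] plays the role of f(c): the function [f] itself carries no information at
   the boundary point [c], where its value is the limit from within [Omega]. *)
Definition corner_continuation (Omega : C -> Prop) (f : C -> C)
    (c d : C) (delta : R) : Prop :=
  exists (s : R) (F : C -> C) (L : C),
    0 < s /\
    analytic_extension Omega f (slit_disk c s d) F /\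
    filterlim f (within Omega (locally c)) (locally L) /\
    exists M eps : R, 0 < eps /\
      forall z : C, slit_disk c s d z -> disk c eps z ->
        Cmod (Cminus (F z) L) <= M * Rpower (Cmod (Cminus z c)) delta.

(* A polynomial is its list of coefficients, constant term first. *)
Definition poly_eval (p : list C) (z : C) : C :=
  fold_right (fun a v => Cplus a (Cmult z v)) (RtoC 0) p.

(* Quotients in lowest terms: by the fundamental theorem of algebra, having no
   common zero in C is the same as being coprime. *)
Record ratfun : Type := Ratfun {
  num : list C;
  den : list C;
  den_nonzero : exists z : C, poly_eval den z <> RtoC 0;
  num_den_coprime : forall z : C, poly_eval den z = RtoC 0 -> poly_eval num z <> RtoC 0
}.

Definition rat_eval (r : ratfun) (z : C) : C :=
  Cdiv (poly_eval (num r) z) (poly_eval (den r) z).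

(* A list of length [n + 1] represents a polynomial of degree at most [n]; its
   leading entries may vanish. *)
Definition degree_le (n : nat) (r : ratfun) : Prop :=
  (length (num r) <= n + 1)%nat /\ (length (den r) <= n + 1)%nat.

Definition is_pole (r : ratfun) (z : C) : Prop := poly_eval (den r) z = RtoC 0.

Definition is_simple_pole (r : ratfun) (z : C) : Prop :=
  is_pole r z /\
  exists l : C, l <> RtoC 0 /\
    is_derive (K := C_AbsRing) (V := C_NormedModule) (poly_eval (den r)) z l.

Definition sup_norm (Omega : C -> Prop) (g : C -> C) : Rbar :=
  Lub_Rbar (fun x : R => exists z : C, Omega z /\ x = Cmod (g z)).

(* A pole of [r] in the open set [Omega] makes this infinite when [f] is continuous
   on [Omega], whatever value [Cdiv] gives at the pole itself. *)
Definition sup_error (Omega : C -> Prop) (f : C -> C) (r : ratfun) : Rbar :=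
  sup_norm Omega (fun z => Cminus (f z) (rat_eval r z)).

Definition root_exponential (c : R) (e : nat -> Rbar) : Prop :=
  exists (M : R) (N : nat), forall n : nat, (N <= n)%nat ->
    Rbar_le (e n) (Finite (M * exp (- c * sqrt (INR n)))).

Definition clustered_point (c d : C) (scale sigma : R) (nk j : nat) : C :=
  Cplus c (Cmult (RtoC (scale * exp (- sigma * INR j / sqrt (INR nk)))) d).

Definition pole_counts (m : nat) (nk : nat -> nat -> nat) : Prop :=
  (forall n : nat, (1 <= n)%nat ->
     (list_sum (map (fun k => nk k n) (seq 0 m)) <= n)%nat) /\
  (forall k : nat, (k < m)%nat ->
     Rbar_lt (Finite 0) (LimInf_seq (fun n => INR (nk k n) / INR n))).

(* Main.v *)
Require Import Defs.
From Stdlib Require Import Reals Lra Lia Classical ClassicalEpsilon List.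
From Coquelicot Require Import Coquelicot.
Local Open Scope C_scope.
Local Open Scope R_scope.

(** The approximants come from a Cauchy integral of [f] over a contour that
    touches the closed polygon only at the corners.  At a corner [w_k], with
    exterior bisector direction [d_k], the contour has two straight legs, from
    [w_k] to [w_k + R d_k (1 + i)] and to [w_k + R d_k (1 - i)].  They make an
    angle of 45 degrees with the exterior bisector, hence stay inside the slit
    disk, where the continuation is holomorphic and tends to a limit at [w_k].
    The legs of consecutive corners are joined by a polyline running slightly
    outside the side, where local continuations of [f] across the side are
    used; by the identity theorem ([identity_zero]) these agree where they meet.

    The integral formula ([cauchy_formula]) rests on Goursat's lemma for
    triangles ([goursat_tri_int]): strips of quadrilaterals carry the contour
    into the polygon ([contour_total]), where the integral of the difference
    quotient of [f] at [z] vanishes.  The factor in front of [f z] is the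
    integral of [1/(y - z)] over the contour.  It is
    independent of [z], because its derivative telescopes around the contour
    ([winding_const]), and nonzero, because at the centre every piece of a
    deformed contour contributes a positive imaginary part
    ([winding_center_ne0]).

    Every piece of the contour other than the legs is separated from the polygon
    by a line, with a positive gap.  A disk centred far away on the side of the
    polygon then contains the polygon and stays away from the piece, so that a
    geometric series approximates the Cauchy transform of the piece by
    polynomials of degree [n] with error [O(q^n)], [q < 1]
    ([well_separated_geom_approx]).  On the legs of [w_k] the limit [L_k] of [f]
    is first subtracted; its integral over both legs equals the integral over
    the chord between their ends, which is again separated from the polygon
    ([representation]).  What is left on the legs is [O(rho^delta)] at distance
    [rho] from the corner.

    On a leg the Cauchy kernel is interpolated at reflected points.  For a pole
    [b] on the exterior bisector and its mirror image [a] at the corner,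
      [1/(y - z) = (a - b)/((z - b)(y - a))
                   + (z - a)/(z - b) . (y - b)/(y - a) . 1/(y - z)].
    Iterating over the clustered poles yields a rational function of [z] with
    these poles plus a remainder that carries the product of all the factors
    ([transform_pairs]).  A factor in [z] has modulus at most 1 on the polygon,
    since [z] is closer to [a] than to [b].  A factor in [y] has modulus at most
    1 on the leg, and at most 3/4 when the distance of the pole from the corner
    is comparable with that of [y].  The exponential spacing provides about
    [sqrt N . ln 2 / sigma] such poles for each [y] that is not closer to the
    corner than [exp (- c sqrt N)]; closer to the corner the bound
    [O(rho^delta)] is itself root-exponentially small ([damping_power]).  So the
    error is root-exponential ([corner_approx]).

    Only the outer half of the admissible poles of each corner is used.  The
    common denominator then has degree at most [n/2], which leaves room for a
    polynomial part of degree below [n/2], and the sum is a quotient of degree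
    at most [n].  Common zeros of numerator and denominator are cancelled one by
    one ([ratfun_make]), so the remaining poles are simple and clustered as
    prescribed.  The existence claim without prescribed poles is the case
    [sigma = 1] with [n/m] poles at each corner. *)

(** * Integrals along segments *)

(** Continuity is taken relative to a set because the continuations of [f] mean nothing across
    the slits: on a segment that starts at a corner only the values on the segment count. *)
Definition cont_on (S : C -> Prop) (g : C -> C) : Prop :=
  forall x, S x -> forall e, 0 < e -> exists d, 0 < d /\
    forall y, S y -> Cmod (y - x) < d -> Cmod (g y - g x) < e.

Definition seg (a b : C) (t : R) : C := (a + RtoC t * (b - a))%C.

Definition segset (a b : C) (x : C) : Prop := exists t, 0 <= t <= 1 /\ x = seg a b t.

Definition seg_int (g : C -> C) (a b : C) : C :=
  RInt (V := C_R_CompleteNormedModule) (fun t => ((b - a) * g (seg a b t))%C) 0 1.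

Lemma Cmod_le_sq (z : C) M : 0 <= M -> Re z * Re z + Im z * Im z <= M * M -> Cmod z <= M.
Proof.
  intros HM H. unfold Cmod. rewrite <- (sqrt_square M HM).
  apply sqrt_le_1_alt. simpl. unfold Re, Im in H. lra.
Qed.

Lemma Cmod_sq (z : C) : Cmod z * Cmod z = Re z * Re z + Im z * Im z.
Proof. generalize (Cmod2_alt z). simpl. lra. Qed.

Lemma im_le_Cmod (z : C) : Rabs (Im z) <= Cmod z.
Proof.
  apply Rle_trans with (2 := Rmax_Cmod z). apply Rmax_r.
Qed.

Lemma Cmod_self (x : C) : Cmod (x - x) = 0.
Proof. replace (x - x)%C with (RtoC 0) by ring. apply Cmod_0. Qed.

Lemma Cmod_minus_sym (x y : C) : Cmod (x - y) = Cmod (y - x).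
Proof. rewrite <- Cmod_opp. f_equal. ring. Qed.

Lemma Cmod_tri3 (x y z : C) : Cmod (x - z) <= Cmod (x - y) + Cmod (y - z).
Proof. replace (x - z)%C with ((x - y) + (y - z))%C by ring. apply Cmod_triangle. Qed.

Lemma Cmod_tri_lb (x y : C) : Cmod x - Cmod y <= Cmod (x - y).
Proof.
  generalize (Cmod_triangle (x - y) y). replace (x - y + y)%C with x by ring. lra.
Qed.

Lemma seg_0 a b : seg a b 0 = a.
Proof. unfold seg. ring. Qed.

Lemma seg_1 a b : seg a b 1 = b.
Proof. unfold seg. ring. Qed.

Lemma seg_rev a b t : seg b a t = seg a b (1 - t).
Proof. unfold seg. rewrite RtoC_minus. ring. Qed.

Lemma segset_l a b : segset a b a.
Proof. exists 0. split; [lra|]. now rewrite seg_0. Qed.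

Lemma segset_rev a b x : segset a b x -> segset b a x.
Proof.
  intros [t [Ht ->]]. exists (1 - t). split; [lra|]. now rewrite seg_rev.
Qed.

Lemma seg_diff a b s t : (seg a b s - seg a b t)%C = (RtoC (s - t) * (b - a))%C.
Proof. unfold seg. rewrite RtoC_minus. ring. Qed.

Lemma Cmod_seg_diff a b s t : Cmod (seg a b s - seg a b t) = Rabs (s - t) * Cmod (b - a).
Proof. rewrite seg_diff, Cmod_mult, Cmod_R. reflexivity. Qed.

Lemma cont_on_sub (S T : C -> Prop) g : (forall x, T x -> S x) -> cont_on S g -> cont_on T g.
Proof.
  intros H Hg x Tx e He. destruct (Hg x (H x Tx) e He) as [d [Hd H1]].
  exists d. split; [assumption|]. intros y Ty. apply H1. now apply H.
Qed.

Lemma cont_on_const (S : C -> Prop) c : cont_on S (fun _ => c).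
Proof.
  intros x _ e He. exists 1. split; [lra|]. intros y _ _.
  now rewrite Cmod_self.
Qed.

Lemma cont_on_id (S : C -> Prop) : cont_on S (fun x => x).
Proof. intros x _ e He. exists e. split; auto. Qed.

Lemma cont_on_filter (S : C -> Prop) (g : C -> C) : cont_on S g <-> forall x, S x ->
  filterlim (T := C) (U := C) g (within S (locally (T := AbsRing_UniformSpace C_AbsRing) x)) (locally (T := AbsRing_UniformSpace C_AbsRing) (g x)).
Proof.
  split.
  - intros H x Sx. apply (filterlim_locally (T := C) (U := AbsRing_UniformSpace C_AbsRing)). intros e. destruct (H x Sx e (cond_pos e)) as [d [Hd K]].
    exists (mkposreal d Hd). intros y Hy Sy. now apply K.
  - intros H x Sx e He. assert (K := proj1 (filterlim_locally (T := C) (U := AbsRing_UniformSpace C_AbsRing) _ _) (H x Sx)).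
    destruct (K (mkposreal e He)) as [d Hd]. exists d. split; [apply cond_pos|]. intros y Sy Hy. now apply Hd.
Qed.

Lemma cont_on_plus (S : C -> Prop) g h :
  cont_on S g -> cont_on S h -> cont_on S (fun x => (g x + h x)%C).
Proof.
  rewrite !cont_on_filter. intros Hg Hh x Sx.
  apply (filterlim_comp_2 _ _ _ (Hg x Sx) (Hh x Sx)). apply (filterlim_plus (V := AbsRing_NormedModule C_AbsRing)).
Qed.

Lemma cont_on_mult (S : C -> Prop) g h :
  cont_on S g -> cont_on S h -> cont_on S (fun x => (g x * h x)%C).
Proof.
  rewrite !cont_on_filter. intros Hg Hh x Sx.
  apply (filterlim_comp_2 _ _ _ (Hg x Sx) (Hh x Sx)). apply (filterlim_mult (K := C_AbsRing)).
Qed.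

Lemma Cinv_diff (x y : C) : x <> 0%C -> y <> 0%C -> (/ y - / x)%C = ((x - y) / (x * y))%C.
Proof. intros. field. split; assumption. Qed.

Lemma cont_on_inv (S : C -> Prop) g :
  cont_on S g -> (forall x, S x -> g x <> 0%C) -> cont_on S (fun x => (/ g x)%C).
Proof.
  intros Hg Hn x Sx e He.
  assert (Hx := proj1 (Cmod_gt_0 _) (Hn x Sx)).
  set (m := Cmod (g x)) in *.
  assert (He1 : 0 < Rmin (m / 2) (e * m * m / 2)).
  { apply Rmin_pos; [lra|]. assert (0 < e * m * m) by (repeat apply Rmult_lt_0_compat; lra). lra. }
  destruct (Hg x Sx _ He1) as [d [Hd H1]].
  exists d. split; [assumption|]. intros y Sy Hy.
  specialize (H1 y Sy Hy).
  assert (H2 := Rlt_le_trans _ _ _ H1 (Rmin_l _ _)).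
  assert (H3 := Rlt_le_trans _ _ _ H1 (Rmin_r _ _)).
  assert (Hy2 : m / 2 < Cmod (g y)).
  { generalize (Cmod_tri_lb (g x) (g y)). rewrite Cmod_minus_sym. fold m. lra. }
  rewrite Cinv_diff by auto.
  rewrite Cmod_div by (apply Cmult_neq_0; auto).
  rewrite Cmod_mult, Cmod_minus_sym. fold m.
  apply Rmult_lt_reg_r with (m * Cmod (g y)); [apply Rmult_lt_0_compat; lra|].
  unfold Rdiv. rewrite Rmult_assoc, Rinv_l by (apply Rgt_not_eq; apply Rmult_lt_0_compat; lra).
  rewrite Rmult_1_r. eapply Rlt_le_trans; [exact H3|].
  replace (e * m * m / 2) with (e * (m * (m/2))) by field.
  apply Rmult_le_compat_l; [lra|]. apply Rmult_le_compat_l; lra.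
Qed.

(** Precomposing with the retraction onto the unit interval turns an integrand that is
    continuous there into one that is continuous on the whole line, as existence theorems for
    Riemann integrals ask. *)
Definition clamp (t : R) : R := Rmax 0 (Rmin 1 t).

Lemma clamp_in t : 0 <= clamp t <= 1.
Proof. unfold clamp, Rmax, Rmin. repeat destruct Rle_dec; lra. Qed.

Lemma clamp_id t : 0 <= t <= 1 -> clamp t = t.
Proof. unfold clamp, Rmax, Rmin. repeat destruct Rle_dec; lra. Qed.

Lemma clamp_lip s t : Rabs (clamp s - clamp t) <= Rabs (s - t).
Proof.
  unfold clamp, Rmax, Rmin. repeat destruct Rle_dec; unfold Rabs; repeat destruct Rcase_abs; lra.
Qed.

Lemma continuous_C_eps (h : R -> C) (t : R) :
  (forall e, 0 < e -> exists d, 0 < d /\ forall s, Rabs (s - t) < d -> Cmod (h s - h t) < e) ->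
  continuous (U := C_R_NormedModule) h t.
Proof.
  intros H. apply filterlim_locally. intros e.
  destruct (H e (cond_pos e)) as [d [Hd H1]].
  exists (mkposreal d Hd). intros s Hs. specialize (H1 s Hs).
  split; simpl; unfold ball; simpl; unfold AbsRing_ball, abs, minus, plus, opp; simpl.
  - eapply Rle_lt_trans; [|exact H1]. apply (re_le_Cmod (h s - h t)).
  - eapply Rle_lt_trans; [|exact H1]. apply (im_le_Cmod (h s - h t)).
Qed.

Lemma ex_RInt_clamped (h : R -> C) (k : R -> C) :
  (forall t, continuous (U := C_R_NormedModule) k t) -> (forall t, 0 <= t <= 1 -> h t = k t) ->
  forall a b, 0 <= a <= 1 -> 0 <= b <= 1 -> ex_RInt (V := C_R_NormedModule) h a b.
Proof.
  intros Hk He a b Ha Hb.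
  apply ex_RInt_ext with k.
  - intros t. unfold Rmin, Rmax. destruct Rle_dec; intros; symmetry; apply He; lra.
  - apply (ex_RInt_continuous (V := C_R_CompleteNormedModule)). intros; apply Hk.
Qed.

Definition unit_interval (z : C) : Prop := exists t, 0 <= t <= 1 /\ z = RtoC t.

(** The unit interval is embedded in the plane so that the closure properties of [cont_on] apply
    to paths as well. *)
Definition path_cont (h : R -> C) : Prop := cont_on unit_interval (fun z => h (Re z)).

Lemma path_cont_iff h : path_cont h <->
  forall t, 0 <= t <= 1 -> forall e, 0 < e -> exists d, 0 < d /\
    forall s, 0 <= s <= 1 -> Rabs (s - t) < d -> Cmod (h s - h t) < e.
Proof.
  split.
  - intros Hh t Ht e He. destruct (Hh (RtoC t)) with (e := e) as [d [Hd H]]; [now exists t|assumption|].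
    exists d. split; [assumption|]. intros s Hs Hst. apply (H (RtoC s)); [now exists s|].
    now rewrite <- RtoC_minus, Cmod_R.
  - intros Hh x [t [Ht ->]] e He. destruct (Hh t Ht e He) as [d [Hd H]].
    exists d. split; [assumption|]. intros y [s [Hs ->]] Hst. apply H; [assumption|].
    now rewrite <- RtoC_minus, Cmod_R in Hst.
Qed.

Lemma path_cont_clamp h t : path_cont h -> continuous (U := C_R_NormedModule) (fun t => h (clamp t)) t.
Proof.
  intros Hh. apply continuous_C_eps. intros e He.
  destruct (proj1 (path_cont_iff h) Hh (clamp t) (clamp_in t) e He) as [d [Hd H]].
  exists d. split; [assumption|]. intros s Hs. apply H; [apply clamp_in|].
  eapply Rle_lt_trans; [apply clamp_lip|assumption].
Qed.

Lemma ex_RInt_path_cont h a b : path_cont h -> 0 <= a <= 1 -> 0 <= b <= 1 ->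
  ex_RInt (V := C_R_NormedModule) h a b.
Proof.
  intros Hh. apply ex_RInt_clamped with (fun t => h (clamp t)).
  - intros; now apply path_cont_clamp.
  - intros t Ht. now rewrite clamp_id.
Qed.

Lemma path_cont_seg S g a b : cont_on S g -> (forall t, 0 <= t <= 1 -> S (seg a b t)) ->
  path_cont (fun t => g (seg a b t)).
Proof.
  intros Hg HS. apply path_cont_iff. intros t Ht e He. destruct (Hg _ (HS t Ht) e He) as [d [Hd H]].
  assert (HB := Cmod_ge_0 (b - a)).
  exists (d / (Cmod (b - a) + 1)).
  split; [apply Rdiv_lt_0_compat; lra|].
  intros s Hs1 Hs. apply H; [now apply HS|].
  rewrite Cmod_seg_diff.
  apply Rle_lt_trans with (Rabs (s - t) * (Cmod (b - a) + 1)).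
  - apply Rmult_le_compat_l; [apply Rabs_pos|lra].
  - apply Rmult_lt_reg_r with (/ (Cmod (b-a) + 1)); [apply Rinv_0_lt_compat; lra|].
    rewrite Rmult_assoc, Rinv_r by lra. unfold Rdiv in Hs. lra.
Qed.

Lemma path_cont_const c : path_cont (fun _ => c).
Proof. apply cont_on_const. Qed.

Lemma path_cont_mult g h : path_cont g -> path_cont h -> path_cont (fun t => (g t * h t)%C).
Proof. apply cont_on_mult. Qed.

Lemma path_cont_plus g h : path_cont g -> path_cont h -> path_cont (fun t => (g t + h t)%C).
Proof. apply cont_on_plus. Qed.

Lemma path_cont_inv g : path_cont g -> (forall t, 0 <= t <= 1 -> g t <> 0%C) -> path_cont (fun t => (/ g t)%C).
Proof. intros Hg Hn. apply cont_on_inv; [exact Hg|]. intros x [t [Ht ->]]. now apply Hn. Qed.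

Lemma path_cont_segid a b : path_cont (seg a b).
Proof. apply (path_cont_seg (fun _ => True) (fun x => x)); [apply cont_on_id|auto]. Qed.

Definition path_int (h : R -> C) : C := RInt (V := C_R_CompleteNormedModule) h 0 1.

Lemma path_int_correct h : path_cont h -> is_RInt (V := C_R_NormedModule) h 0 1 (path_int h).
Proof.
  intros Hh. apply (RInt_correct (V := C_R_CompleteNormedModule)).
  apply ex_RInt_path_cont; [assumption|lra|lra].
Qed.

Lemma path_int_ext g h : (forall t, 0 < t < 1 -> g t = h t) -> path_int g = path_int h.
Proof.
  intros H. apply (RInt_ext (V := C_R_CompleteNormedModule)). intros t.
  rewrite Rmin_left, Rmax_right by lra. apply H.
Qed.

Lemma path_int_plus g h : path_cont g -> path_cont h -> path_int (fun t => (g t + h t)%C) = (path_int g + path_int h)%C.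
Proof.
  intros Hg Hh. apply (RInt_plus (V := C_R_CompleteNormedModule)); apply ex_RInt_path_cont; auto; lra.
Qed.

Lemma is_RInt_Cscal (h : R -> C) a b (l c : C) :
  is_RInt (V := C_R_NormedModule) h a b l ->
  is_RInt (V := C_R_NormedModule) (fun t => (c * h t)%C) a b (c * l)%C.
Proof.
  intros H.
  assert (H1 := is_RInt_fct_extend_fst (U := R_NormedModule) (V := R_NormedModule) _ _ _ _ H).
  assert (H2 := is_RInt_fct_extend_snd (U := R_NormedModule) (V := R_NormedModule) _ _ _ _ H).
  destruct c as [x y].
  apply (is_RInt_fct_extend_pair (U := R_NormedModule) (V := R_NormedModule)); simpl.
  - apply (is_RInt_minus (V := R_NormedModule)); apply (is_RInt_scal (V := R_NormedModule)); assumption.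
  - apply (is_RInt_plus (V := R_NormedModule)); apply (is_RInt_scal (V := R_NormedModule)); assumption.
Qed.

Lemma path_int_scal c h : path_cont h -> path_int (fun t => (c * h t)%C) = (c * path_int h)%C.
Proof.
  intros Hh. apply (is_RInt_unique (V := C_R_CompleteNormedModule)).
  apply is_RInt_Cscal. now apply path_int_correct.
Qed.

Lemma path_int_bound h M : path_cont h -> (forall t, 0 <= t <= 1 -> Cmod (h t) <= M) -> Cmod (path_int h) <= M.
Proof.
  intros Hh HM. rewrite Cmod_norm.
  replace M with ((1 - 0) * M) by ring.
  apply (norm_RInt_le_const (V := C_R_NormedModule) h 0 1); [lra| |now apply path_int_correct].
  intros t Ht. specialize (HM t Ht). now rewrite Cmod_norm in HM.
Qed.

Lemma seg_int_path_int g a b : cont_on (segset a b) g -> seg_int g a b = ((b - a) * path_int (fun t => g (seg a b t)))%C.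
Proof.
  intros Hg. unfold seg_int. apply path_int_scal. eapply path_cont_seg; [exact Hg|].
  intros t Ht. now exists t.
Qed.

Lemma path_cont_of_cont_on S g a b : cont_on S g -> (forall x, segset a b x -> S x) ->
  path_cont (fun t => g (seg a b t)).
Proof. intros Hg HS. apply (path_cont_seg S); [assumption|]. intros t Ht. apply HS. now exists t. Qed.

Lemma seg_int_bound g a b M : cont_on (segset a b) g -> (forall x, segset a b x -> Cmod (g x) <= M) ->
  Cmod (seg_int g a b) <= M * Cmod (b - a).
Proof.
  intros Hg HM. rewrite seg_int_path_int by assumption. rewrite Cmod_mult, Rmult_comm.
  apply Rmult_le_compat_r; [apply Cmod_ge_0|]. apply path_int_bound.
  - eapply path_cont_of_cont_on; [exact Hg|auto].
  - intros t Ht. apply HM. now exists t.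
Qed.

Lemma seg_int_ext g h a b : (forall x, segset a b x -> g x = h x) -> seg_int g a b = seg_int h a b.
Proof.
  intros H. apply path_int_ext. intros t Ht. rewrite H; [reflexivity|]. exists t. split; [lra|reflexivity].
Qed.

Lemma seg_int_plus g h a b : cont_on (segset a b) g -> cont_on (segset a b) h ->
  seg_int (fun x => (g x + h x)%C) a b = (seg_int g a b + seg_int h a b)%C.
Proof.
  intros Hg Hh. rewrite !seg_int_path_int; try assumption.
  - rewrite path_int_plus; [ring| |]; eapply path_cont_of_cont_on; eauto.
  - now apply cont_on_plus.
Qed.

Lemma seg_int_scal c g a b : cont_on (segset a b) g -> seg_int (fun x => (c * g x)%C) a b = (c * seg_int g a b)%C.
Proof.
  intros Hg. rewrite !seg_int_path_int; try assumption.
  - rewrite path_int_scal; [ring|]. eapply path_cont_of_cont_on; eauto.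
  - apply cont_on_mult; [apply cont_on_const|assumption].
Qed.

Lemma is_RInt_C_swapvar (h : R -> C) l :
  is_RInt (V := C_R_NormedModule) h 0 1 l ->
  is_RInt (V := C_R_NormedModule) (fun t => h (1 - t)) 0 1 l.
Proof.
  intros H.
  assert (H1 : is_RInt (V := C_R_NormedModule) h (-1 * 0 + 1) (-1 * 1 + 1) (opp l)).
  { replace (-1 * 0 + 1) with 1 by ring. replace (-1 * 1 + 1) with 0 by ring. now apply is_RInt_swap. }
  apply is_RInt_comp_lin in H1. apply (is_RInt_opp (V := C_R_NormedModule)) in H1.
  rewrite opp_opp in H1. revert H1. apply is_RInt_ext. intros t _.
  replace (-1 * t + 1) with (1 - t) by ring.
  destruct (h (1 - t)) as [x y]. apply injective_projections; simpl; unfold scal, opp, mult; simpl; unfold mult; simpl; ring.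
Qed.

Lemma seg_int_rev g a b : cont_on (segset a b) g -> seg_int g b a = (- seg_int g a b)%C.
Proof.
  intros Hg. unfold seg_int.
  assert (Hp : path_cont (fun t => g (seg a b t))) by (eapply path_cont_of_cont_on; eauto).
  apply (is_RInt_unique (V := C_R_CompleteNormedModule)).
  assert (H := path_int_correct _ (path_cont_mult _ _ (path_cont_const (b - a)%C) Hp)).
  apply is_RInt_C_swapvar in H. apply (is_RInt_Cscal _ _ _ _ (-(1))%C) in H.
  unfold path_int in H. replace (- RInt (V := C_R_CompleteNormedModule) (fun t => ((b - a) * g (seg a b t))%C) 0 1)%C with (-(1) * RInt (V := C_R_CompleteNormedModule) (fun t => ((b - a) * g (seg a b t))%C) 0 1)%C by ring.
  revert H. apply is_RInt_ext. intros t _. rewrite (seg_rev a b t).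
  match goal with |- ?a = ?b => change (@eq C a b) end. ring.
Qed.

Lemma seg_seg a b s t : seg a (seg a b s) t = seg a b (s * t).
Proof. unfold seg. rewrite RtoC_mult. ring. Qed.

Lemma seg_seg_r a b s t : seg (seg a b s) b t = seg a b (s + t * (1 - s)).
Proof. unfold seg. rewrite RtoC_plus, RtoC_mult, RtoC_minus. ring. Qed.

(** Additivity over the parameter interval, each half being rescaled linearly to the unit
    interval. *)
Lemma seg_int_split g a b s : 0 <= s <= 1 -> cont_on (segset a b) g ->
  seg_int g a b = (seg_int g a (seg a b s) + seg_int g (seg a b s) b)%C.
Proof.
  intros Hs Hg.
  assert (Hp : path_cont (fun t => ((b - a) * g (seg a b t))%C)).
  { apply path_cont_mult; [apply path_cont_const|]. eapply path_cont_of_cont_on; eauto. }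
  unfold seg_int at 1. rewrite <- (RInt_Chasles (V := C_R_CompleteNormedModule) _ 0 s 1);
    try (apply ex_RInt_path_cont; [assumption|lra|lra]).
  change plus with Cplus. f_equal.
  - unfold seg_int.
    assert (E := RInt_comp_lin (V := C_R_CompleteNormedModule) (fun t => ((b - a) * g (seg a b t))%C) s 0 0 1).
    rewrite !Rplus_0_r, Rmult_0_r, Rmult_1_r in E. rewrite <- E by (apply ex_RInt_path_cont; [assumption|lra|lra]).
    apply path_int_ext. intros t Ht. rewrite Rplus_0_r, seg_seg.
    replace (seg a b s - a)%C with (RtoC s * (b - a))%C by (unfold seg; ring).
    rewrite <- Cmult_assoc. apply scal_R_Cmult.
  - unfold seg_int.
    assert (E := RInt_comp_lin (V := C_R_CompleteNormedModule) (fun t => ((b - a) * g (seg a b t))%C) (1 - s) s 0 1).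
    replace ((1 - s) * 0 + s) with s in E by ring. replace ((1 - s) * 1 + s) with 1 in E by ring.
    rewrite <- E by (apply ex_RInt_path_cont; [assumption|lra|lra]).
    apply path_int_ext. intros t Ht. rewrite seg_seg_r.
    replace (b - seg a b s)%C with (RtoC (1 - s) * (b - a))%C by (unfold seg; rewrite RtoC_minus; ring).
    rewrite <- Cmult_assoc. replace (s + t * (1 - s)) with ((1 - s) * t + s) by ring. apply scal_R_Cmult.
Qed.

(** * Complex derivatives *)

Definition cderiv (g : C -> C) (x l : C) : Prop :=
  forall e, 0 < e -> exists d, 0 < d /\ forall y, Cmod (y - x) < d ->
    Cmod (g y - g x - l * (y - x)) <= e * Cmod (y - x).

Definition holo (U : C -> Prop) (g : C -> C) : Prop := forall x, U x -> exists l, cderiv g x l.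

Definition convex (V : C -> Prop) : Prop :=
  forall a b, V a -> V b -> forall t, 0 <= t <= 1 -> V (seg a b t).

Definition tri_int (g : C -> C) (a b c : C) : C := (seg_int g a b + seg_int g b c + seg_int g c a)%C.

(** The conclusion of Goursat's lemma is packaged as a property, since integrands with an
    exceptional point enjoy it as well. *)
Definition tri_closed (V : C -> Prop) (g : C -> C) : Prop :=
  cont_on V g /\ forall a b c, V a -> V b -> V c -> tri_int g a b c = 0%C.

Lemma cderiv_derive f z l : cderiv f z l <-> is_derive (K := C_AbsRing) (V := AbsRing_NormedModule C_AbsRing) f z l.
Proof.
  split.
  - intros H. split; [apply is_linear_scal_l|].
    intros x Hx. apply (is_filter_lim_locally_unique (V := AbsRing_NormedModule C_AbsRing)) in Hx. subst x.
    intros e. destruct (H e (cond_pos e)) as [d [Hd H1]].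
    exists (mkposreal d Hd). intros y Hy. specialize (H1 y Hy).
    change (Cmod (f y - f z - (y - z) * l) <= e * Cmod (y - z)).
    now rewrite (Cmult_comm (y - z)).
  - intros [_ H] e He. destruct (H z (fun P HP => HP) (mkposreal e He)) as [d Hd]. exists d. split; [apply cond_pos|].
    intros y Hy. specialize (Hd y Hy).
    change (Cmod (f y - f z - (y - z) * l) <= e * Cmod (y - z)) in Hd.
    now rewrite (Cmult_comm l).
Qed.

Lemma is_derive_C f z l : is_derive (K := C_AbsRing) (V := C_NormedModule) f z l <-> cderiv f z l.
Proof. rewrite cderiv_derive. split; intros [A B]; split; try apply is_linear_scal_l; exact B. Qed.

Lemma analytic_holo U f : analytic_on U f -> holo U f.
Proof. intros H x Ux. destruct (H x Ux) as [l Hl]. exists l. now apply is_derive_C. Qed.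

Lemma holo_sub (S T : C -> Prop) g : (forall x, T x -> S x) -> holo S g -> holo T g.
Proof. intros H Hg x Tx. apply Hg. now apply H. Qed.

Lemma cderiv_cont g x l : cderiv g x l -> forall e, 0 < e -> exists d, 0 < d /\
  forall y, Cmod (y - x) < d -> Cmod (g y - g x) < e.
Proof.
  intros H e He. destruct (H 1) as [d [Hd H1]]; [lra|].
  assert (HK := Cmod_ge_0 l).
  exists (Rmin d (e / (Cmod l + 2))). split.
  - apply Rmin_pos; [assumption|]. apply Rdiv_lt_0_compat; lra.
  - intros y Hy. specialize (H1 y (Rlt_le_trans _ _ _ Hy (Rmin_l _ _))).
    assert (Hy2 := Rlt_le_trans _ _ _ Hy (Rmin_r _ _)).
    replace (g y - g x)%C with ((g y - g x - l * (y - x)) + l * (y - x))%C by ring.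
    eapply Rle_lt_trans; [apply Cmod_triangle|]. rewrite Cmod_mult.
    apply Rmult_lt_compat_r with (r := Cmod l + 2) in Hy2; [|lra].
    replace (e / (Cmod l + 2) * (Cmod l + 2)) with e in Hy2 by (field; lra).
    generalize (Cmod_ge_0 (y - x)). nra.
Qed.

Lemma holo_cont V g : holo V g -> cont_on V g.
Proof.
  intros Hg x Vx e He. destruct (Hg x Vx) as [l Hl].
  destruct (cderiv_cont _ _ _ Hl e He) as [d [Hd H]].
  exists d. split; auto.
Qed.

Lemma cderiv_const c x : cderiv (fun _ => c) x 0%C.
Proof. rewrite cderiv_derive. apply (is_derive_const (K := C_AbsRing) (V := AbsRing_NormedModule C_AbsRing)). Qed.

Lemma cderiv_id x : cderiv (fun y => y) x 1%C.
Proof. rewrite cderiv_derive. apply (is_derive_id (K := C_AbsRing)). Qed.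

Lemma cderiv_opp f x l : cderiv f x l -> cderiv (fun y => (- f y)%C) x (- l)%C.
Proof. rewrite !cderiv_derive. apply (is_derive_opp (K := C_AbsRing) (V := AbsRing_NormedModule C_AbsRing)). Qed.

Lemma cderiv_plus f g x l k : cderiv f x l -> cderiv g x k -> cderiv (fun y => (f y + g y)%C) x (l + k)%C.
Proof. rewrite !cderiv_derive. apply (is_derive_plus (K := C_AbsRing) (V := AbsRing_NormedModule C_AbsRing)). Qed.

Lemma cderiv_mult f g x l k : cderiv f x l -> cderiv g x k ->
  cderiv (fun y => (f y * g y)%C) x (l * g x + f x * k)%C.
Proof.
  rewrite !cderiv_derive. intros Hf Hg. apply (is_derive_mult (K := C_AbsRing) f g x l k Hf Hg). exact Cmult_comm.
Qed.

Lemma cderiv_inv (x : C) : x <> 0%C -> cderiv Cinv x (- (/ (x * x)))%C.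
Proof.
  intros Hx e He. assert (Hm := proj1 (Cmod_gt_0 _) Hx). set (m := Cmod x) in *.
  exists (Rmin (m/2) (e * (m * m * m) / 2)). split.
  { apply Rmin_pos; [lra|]. assert (0 < e * (m*m*m)) by (repeat apply Rmult_lt_0_compat; lra). lra. }
  intros y Hy.
  assert (H1 := Rlt_le_trans _ _ _ Hy (Rmin_l _ _)).
  assert (H2 := Rlt_le_trans _ _ _ Hy (Rmin_r _ _)).
  assert (Hmy : m / 2 < Cmod y).
  { generalize (Cmod_tri_lb x y). rewrite Cmod_minus_sym. fold m. lra. }
  assert (Hy0 : y <> 0%C) by (apply Cmod_gt_0; lra).
  replace (/ y - / x - - / (x * x) * (y - x))%C with ((y - x) * (y - x) / (x * x * y))%C
    by (field; split; assumption).
  rewrite Cmod_div by (repeat apply Cmult_neq_0; assumption).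
  rewrite !Cmod_mult. fold m. set (r := Cmod (y - x)) in *.
  assert (Hr : 0 <= r) by apply Cmod_ge_0.
  assert (Hp : 0 < m * m * Cmod y) by (repeat apply Rmult_lt_0_compat; lra).
  apply Rmult_le_reg_r with (m * m * Cmod y); [assumption|].
  unfold Rdiv. rewrite Rmult_assoc, Rinv_l, Rmult_1_r by lra.
  replace (e * r * (m * m * Cmod y)) with (r * (e * (m * m * Cmod y))) by ring.
  apply Rmult_le_compat_l; [assumption|].
  assert (e * (m * m * (m/2)) <= e * (m * m * Cmod y)).
  { apply Rmult_le_compat_l; [lra|]. apply Rmult_le_compat_l; [nra|lra]. }
  lra.
Qed.

Lemma cderiv_local f g x l d : 0 < d -> (forall y, Cmod (y - x) < d -> f y = g y) ->
  cderiv f x l -> cderiv g x l.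
Proof.
  intros Hd He Hf e Hep. destruct (Hf e Hep) as [d1 [Hd1 H1]].
  exists (Rmin d d1). split; [now apply Rmin_pos|]. intros y Hy.
  rewrite <- !He.
  - apply H1. apply (Rlt_le_trans _ _ _ Hy (Rmin_r _ _)).
  - now rewrite Cmod_self.
  - apply (Rlt_le_trans _ _ _ Hy (Rmin_l _ _)).
Qed.

Lemma cderiv_shift f z x l : cderiv f (x - z)%C l -> cderiv (fun y => f (y - z)%C) x l.
Proof.
  intros H e He. destruct (H e He) as [d [Hd H1]]. exists d. split; [assumption|].
  intros y Hy. specialize (H1 (y - z)%C).
  replace (y - z - (x - z))%C with (y - x)%C in H1 by ring. now apply H1.
Qed.

(** Along the segment [G] has derivative [(b - a) g], so its real and imaginary parts fall under
    the real fundamental theorem. *)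
Lemma seg_int_FTC G g a b : cont_on (segset a b) g ->
  (forall x, segset a b x -> cderiv G x (g x)) -> seg_int g a b = (G b - G a)%C.
Proof.
  intros Hg HG.
  set (k := fun t => ((b - a) * g (seg a b (clamp t)))%C).
  assert (Hk : forall t, continuous (U := C_R_NormedModule) k t).
  { intros t. apply (path_cont_clamp (fun t => ((b - a) * g (seg a b t))%C)).
    apply path_cont_mult; [apply path_cont_const|]. eapply path_cont_of_cont_on; eauto. }
  assert (HD : forall t, 0 <= t <= 1 -> forall e, 0 < e -> exists d, 0 < d /\ forall h, h <> 0 -> Rabs h < d ->
     Cmod (RtoC (/ h) * (G (seg a b (t + h)) - G (seg a b t)) - k t) < e).
  { intros t Ht e He.
    assert (HB := Cmod_ge_0 (b - a)).
    destruct (HG (seg a b t)) with (e := e / (Cmod (b - a) + 1)) as [d [Hd H]].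
    { now exists t. } { apply Rdiv_lt_0_compat; lra. }
    exists (d / (Cmod (b - a) + 1)). split; [apply Rdiv_lt_0_compat; lra|].
    intros h Hh Hhd. specialize (H (seg a b (t + h))).
    rewrite Cmod_seg_diff in H. replace (t + h - t) with h in H by ring.
    assert (HR : 0 < Rabs h) by now apply Rabs_pos_lt.
    assert (H0 : Rabs h * Cmod (b - a) < d).
    { apply Rmult_lt_compat_r with (r := Cmod (b - a) + 1) in Hhd; [|lra].
      replace (d / (Cmod (b - a) + 1) * (Cmod (b - a) + 1)) with d in Hhd by (field; lra). nra. }
    specialize (H H0). unfold k. rewrite clamp_id by assumption.
    rewrite seg_diff in H. replace (t + h - t) with h in H by ring.
    replace (RtoC (/ h) * (G (seg a b (t + h)) - G (seg a b t)) - (b - a) * g (seg a b t))%C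
      with (RtoC (/ h) * (G (seg a b (t + h)) - G (seg a b t) - g (seg a b t) * (RtoC h * (b - a))))%C.
    2:{ rewrite RtoC_inv by assumption. field. intro E. apply RtoC_inj in E. lra. }
    rewrite Cmod_mult, Cmod_R, Rabs_inv.
    apply Rmult_lt_reg_l with (Rabs h); [assumption|].
    rewrite <- Rmult_assoc, Rinv_r, Rmult_1_l by lra.
    eapply Rle_lt_trans; [exact H|].
    replace (e / (Cmod (b - a) + 1) * (Rabs h * Cmod (b - a))) with (Rabs h * (e * (Cmod (b - a) / (Cmod (b - a) + 1)))) by (field; lra).
    apply Rmult_lt_compat_l; [assumption|].
    assert (Cmod (b - a) / (Cmod (b - a) + 1) < 1).
    { apply Rmult_lt_reg_r with (Cmod (b - a) + 1); [lra|]. field_simplify; lra. }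
    nra. }
  assert (E : is_RInt (V := C_R_NormedModule) k 0 1 (G b - G a)%C).
  { rewrite <- (seg_0 a b) at 1. rewrite <- (seg_1 a b) at 1.
    apply (is_RInt_fct_extend_pair (U := R_NormedModule) (V := R_NormedModule)).
    - apply (is_RInt_derive (V := R_CompleteNormedModule) (fun t => Re (G (seg a b t))) (fun t => Re (k t))).
      + intros t. rewrite Rmin_left, Rmax_right by lra. intros Ht.
        apply is_derive_Reals. intros e He. destruct (HD t Ht e He) as [d [Hd H]].
        exists (mkposreal d Hd). intros h Hh Hhd. specialize (H h Hh Hhd).
        eapply Rle_lt_trans; [|exact H]. eapply Rle_trans; [|apply re_le_Cmod].
        apply Req_le. f_equal. simpl. unfold Re, Rdiv. ring.
      + intros t _. apply (continuous_comp (V := C_R_NormedModule) k (fun z : C => Re z)); [apply Hk|].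
        apply continuous_fst.
    - apply (is_RInt_derive (V := R_CompleteNormedModule) (fun t => Im (G (seg a b t))) (fun t => Im (k t))).
      + intros t. rewrite Rmin_left, Rmax_right by lra. intros Ht.
        apply is_derive_Reals. intros e He. destruct (HD t Ht e He) as [d [Hd H]].
        exists (mkposreal d Hd). intros h Hh Hhd. specialize (H h Hh Hhd).
        eapply Rle_lt_trans; [|exact H]. eapply Rle_trans; [|apply im_le_Cmod].
        apply Req_le. f_equal. simpl. unfold Im, Rdiv. ring.
      + intros t _. apply (continuous_comp (V := C_R_NormedModule) k (fun z : C => Im z)); [apply Hk|].
        apply continuous_snd. }
  apply (is_RInt_unique (V := C_R_CompleteNormedModule)).
  revert E. apply is_RInt_ext. intros t. rewrite Rmin_left, Rmax_right by lra. intros Ht.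
  unfold k. rewrite clamp_id by lra. reflexivity.
Qed.

(** * Goursat's lemma *)

Lemma convex_segset V a b x : convex V -> V a -> V b -> segset a b x -> V x.
Proof. intros HV Ha Hb [t [Ht ->]]. now apply HV. Qed.

Lemma cont_on_seg V g a b : convex V -> cont_on V g -> V a -> V b -> cont_on (segset a b) g.
Proof. intros HV Hg Ha Hb. eapply cont_on_sub; [|exact Hg]. intros x. now apply convex_segset. Qed.

Lemma tri_int_bound g a b c M : cont_on (segset a b) g -> cont_on (segset b c) g -> cont_on (segset c a) g ->
  (forall x, segset a b x \/ segset b c x \/ segset c a x -> Cmod (g x) <= M) ->
  Cmod (tri_int g a b c) <= M * (Cmod (b - a) + Cmod (c - b) + Cmod (a - c)).
Proof.
  intros H1 H2 H3 HM. unfold tri_int.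
  eapply Rle_trans; [apply Cmod_triangle|].
  eapply Rle_trans; [apply Rplus_le_compat_r; apply Cmod_triangle|].
  assert (K1 := seg_int_bound g a b M H1 (fun x Hx => HM x (or_introl Hx))).
  assert (K2 := seg_int_bound g b c M H2 (fun x Hx => HM x (or_intror (or_introl Hx)))).
  assert (K3 := seg_int_bound g c a M H3 (fun x Hx => HM x (or_intror (or_intror Hx)))).
  lra.
Qed.

(** An affine function has a quadratic primitive, and the increments of a primitive along the
    edges of a triangle cancel. *)
Lemma tri_int_affine u l a b c : tri_int (fun x => (u + l * x)%C) a b c = 0%C.
Proof.
  assert (H : forall a b, seg_int (fun x => (u + l * x)%C) a b = ((u * b + l * b * b / 2) - (u * a + l * a * a / 2))%C).
  { intros a0 b0. apply (seg_int_FTC (fun x => (u * x + l * x * x / 2)%C)).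
    - apply cont_on_plus; [apply cont_on_const|]. apply cont_on_mult; [apply cont_on_const|apply cont_on_id].
    - intros x _. replace (u + l * x)%C with ((0 * x + u * 1) + (((0 * x + l * 1) * x + (l * x) * 1) * / 2 + l * x * x * 0))%C.
      + apply cderiv_plus.
        * apply (cderiv_mult (fun _ => u) (fun x => x)); [apply cderiv_const|apply cderiv_id].
        * apply (cderiv_mult (fun x => (l * x * x)%C) (fun _ => (/ 2)%C)); [|apply cderiv_const].
          apply (cderiv_mult (fun x => (l * x)%C) (fun x => x)); [|apply cderiv_id].
          apply (cderiv_mult (fun _ => l) (fun x => x)); [apply cderiv_const|apply cderiv_id].
      + field. }
  unfold tri_int. rewrite !H. ring.
Qed.

Lemma tri_int_plus g h a b c :
  cont_on (segset a b) g -> cont_on (segset b c) g -> cont_on (segset c a) g ->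
  cont_on (segset a b) h -> cont_on (segset b c) h -> cont_on (segset c a) h ->
  tri_int (fun x => (g x + h x)%C) a b c = (tri_int g a b c + tri_int h a b c)%C.
Proof. intros. unfold tri_int. rewrite !seg_int_plus by assumption. ring. Qed.

Lemma tri_int_ext g h a b c : (forall x, g x = h x) -> tri_int g a b c = tri_int h a b c.
Proof. intros H. unfold tri_int. now rewrite !(seg_int_ext g h) by auto. Qed.

Lemma nested_limit (u : nat -> R) : (forall n, Rabs (u (S n) - u n) <= (1/2)^(S n)) ->
  exists l, forall n, u n - (1/2)^n <= l <= u n + (1/2)^n.
Proof.
  intros Hu.
  assert (Hs : forall n, u n - (1/2)^n <= u (S n) - (1/2)^(S n) /\ u (S n) + (1/2)^(S n) <= u n + (1/2)^n).
  { intros n. specialize (Hu n). apply Rabs_le_between in Hu. simpl in *. lra. }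
  assert (Ha : forall n k, u n - (1/2)^n <= u (k + n)%nat - (1/2)^(k+n)).
  { intros n. induction k as [|k IH]; [simpl; lra|]. destruct (Hs (k + n)%nat). simpl Nat.add. lra. }
  assert (Hb : forall n k, u (k + n)%nat + (1/2)^(k+n) <= u n + (1/2)^n).
  { intros n. induction k as [|k IH]; [simpl; lra|]. destruct (Hs (k + n)%nat). simpl Nat.add. lra. }
  assert (Hab : forall n k, u n - (1/2)^n <= u k + (1/2)^k).
  { intros n k. specialize (Ha n k). specialize (Hb k n).
    rewrite (Nat.add_comm n k) in Hb.
    assert (0 < (1/2)^(k+n)) by (apply pow_lt; lra). lra. }
  destruct (completeness (fun x => exists n, x = u n - (1/2)^n)) as [l [H1 H2]].
  - exists (u 0%nat + (1/2)^0). intros x [n ->]. apply Hab.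
  - exists (u 0%nat - (1/2)^0). now exists 0%nat.
  - exists l. intros n. split.
    + apply H1. now exists n.
    + apply H2. intros x [k ->]. apply Hab.
Qed.

Section Goursat.
Variables (V : C -> Prop) (g : C -> C) (a b c : C).
Hypotheses (HV : convex V) (Hg : holo V g) (Va : V a) (Vb : V b) (Vc : V c).

(** Barycentric coordinates with respect to [a b c], in terms of which homothetic subtriangles
    of degenerate triangles make sense as well. *)
Definition bary (x y : R) : C := (a + RtoC x * (b - a) + RtoC y * (c - a))%C.

(** The triple [(x, y, l)] stands for the image of [a b c] under a homothety of ratio [l].
    Ratios of both signs are admitted because the middle one of the four subtriangles is turned
    by half a turn. *)
Definition sub_int (s : R * R * R) : C :=
  let '(x, y, l) := s in tri_int g (bary x y) (bary (x + l) y) (bary x (y + l)).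

Definition valid (s : R * R * R) : Prop :=
  let '(x, y, l) := s in 0 <= x /\ 0 <= y /\ x + y <= 1 /\ 0 <= x + l /\ 0 <= y + l /\ x + y + l <= 1.

Lemma V_bary x y : 0 <= x -> 0 <= y -> x + y <= 1 -> V (bary x y).
Proof.
  intros Hx Hy Hxy. destruct (Req_dec (x + y) 0) as [E|E].
  - assert (x = 0) by lra. assert (y = 0) by lra. subst.
    unfold bary. replace (a + 0 * (b - a) + 0 * (c - a))%C with a by ring. assumption.
  - replace (bary x y) with (seg a (seg b c (y / (x + y))) (x + y)).
    + apply HV; [assumption| |lra]. apply HV; try assumption.
      split; [apply Rdiv_le_0_compat; lra|]. apply Rmult_le_reg_r with (x + y); [lra|]. field_simplify; lra.
    + unfold bary, seg. rewrite RtoC_div by assumption. rewrite RtoC_plus. field.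
      rewrite <- RtoC_plus. intros K. apply RtoC_inj in K. lra.
Qed.

Definition child (i : nat) (s : R * R * R) : R * R * R :=
  let '(x, y, l) := s in
  match i with
  | 0%nat => (x, y, l/2) | 1%nat => (x + l/2, y, l/2) | 2%nat => (x, y + l/2, l/2)
  | _ => (x + l/2, y + l/2, - (l/2)) end.

Lemma child_valid i s : valid s -> valid (child i s).
Proof. destruct s as [[x y] l]. destruct i as [|[|[|i]]]; simpl; lra. Qed.

(** The inner edges of the subdivision are traversed twice, in opposite directions. *)
Lemma sub_int_split s : valid s ->
  sub_int s = (sub_int (child 0 s) + sub_int (child 1 s) + sub_int (child 2 s) + sub_int (child 3 s))%C.
Proof.
  destruct s as [[x y] l]. simpl. intros H.
  assert (Hc := holo_cont _ _ Hg).
  replace (x + l/2 + l/2) with (x + l) by field. replace (y + l/2 + l/2) with (y + l) by field.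
  replace (x + l/2 + - (l/2)) with x by ring. replace (y + l/2 + - (l/2)) with y by ring.
  unfold tri_int.
  assert (V0 : V (bary x y)) by (apply V_bary; lra).
  assert (V1 : V (bary (x + l) y)) by (apply V_bary; lra).
  assert (V2 : V (bary x (y + l))) by (apply V_bary; lra).
  assert (V3 : V (bary (x + l/2) y)) by (apply V_bary; lra).
  assert (V4 : V (bary x (y + l/2))) by (apply V_bary; lra).
  assert (V5 : V (bary (x + l/2) (y + l/2))) by (apply V_bary; lra).
  assert (S3 : seg (bary x y) (bary (x + l) y) (1/2) = bary (x + l/2) y).
  { unfold seg, bary. rewrite !RtoC_plus, !RtoC_div by lra. field. }
  assert (S4 : seg (bary x (y + l)) (bary x y) (1/2) = bary x (y + l/2)).
  { unfold seg, bary. rewrite !RtoC_plus, !RtoC_div by lra. field. }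
  assert (S5 : seg (bary (x + l) y) (bary x (y + l)) (1/2) = bary (x + l/2) (y + l/2)).
  { unfold seg, bary. rewrite !RtoC_plus, !RtoC_div by lra. field. }
  assert (D : forall p q, V p -> V q -> cont_on (segset p q) g) by (intros; now apply (cont_on_seg V)).
  rewrite (seg_int_split g (bary x y) (bary (x + l) y) (1/2)), S3 by (try lra; auto).
  rewrite (seg_int_split g (bary x (y + l)) (bary x y) (1/2)), S4 by (try lra; auto).
  rewrite (seg_int_split g (bary (x + l) y) (bary x (y + l)) (1/2)), S5 by (try lra; auto).
  rewrite (seg_int_rev g (bary (x + l/2) y) (bary x (y + l/2))) by auto.
  rewrite (seg_int_rev g (bary (x + l/2) y) (bary (x + l/2) (y + l/2))) by auto.
  rewrite (seg_int_rev g (bary (x + l/2) (y + l/2)) (bary x (y + l/2))) by auto.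
  ring.
Qed.

(** By the triangle inequality one of the four children carries at least a quarter of the
    integral, necessarily the last one if the first three fail. *)
Definition next_sub (s : R * R * R) : R * R * R :=
  if Rle_dec (Cmod (sub_int s) / 4) (Cmod (sub_int (child 0 s))) then child 0 s else
  if Rle_dec (Cmod (sub_int s) / 4) (Cmod (sub_int (child 1 s))) then child 1 s else
  if Rle_dec (Cmod (sub_int s) / 4) (Cmod (sub_int (child 2 s))) then child 2 s else child 3 s.

Lemma next_sub_spec s : valid s -> exists i, next_sub s = child i s /\ Cmod (sub_int s) / 4 <= Cmod (sub_int (next_sub s)).
Proof.
  intros Hs. assert (H := sub_int_split s Hs).
  assert (HT : Cmod (sub_int s) <= Cmod (sub_int (child 0 s)) + Cmod (sub_int (child 1 s)) + Cmod (sub_int (child 2 s)) + Cmod (sub_int (child 3 s))).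
  { rewrite H at 1. eapply Rle_trans; [apply Cmod_triangle|]. apply Rplus_le_compat_r.
    eapply Rle_trans; [apply Cmod_triangle|]. apply Rplus_le_compat_r. apply Cmod_triangle. }
  unfold next_sub. repeat destruct Rle_dec; [exists 0%nat|exists 1%nat|exists 2%nat|exists 3%nat]; split; auto; lra.
Qed.

Fixpoint nest (n : nat) : R * R * R :=
  match n with 0%nat => (0, 0, 1) | S n => next_sub (nest n) end.

Definition nest_x n := fst (fst (nest n)).
Definition nest_y n := snd (fst (nest n)).
Definition nest_l n := snd (nest n).

Lemma nest_valid n : valid (nest n).
Proof.
  induction n as [|n IH]; [simpl; lra|]. simpl.
  destruct (next_sub_spec _ IH) as [i [-> _]]. now apply child_valid.
Qed.

Lemma nest_int n : Cmod (tri_int g a b c) * (1/4)^n <= Cmod (sub_int (nest n)).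
Proof.
  induction n as [|n IH].
  - simpl. unfold bary. rewrite !Rplus_0_l.
    replace (a + 0 * (b - a) + 0 * (c - a))%C with a by ring.
    replace (a + 1 * (b - a) + 0 * (c - a))%C with b by ring.
    replace (a + 0 * (b - a) + 1 * (c - a))%C with c by ring. lra.
  - simpl. destruct (next_sub_spec _ (nest_valid n)) as [i [_ H]]. lra.
Qed.

Lemma nest_step n : Rabs (nest_l n) = (1/2)^n /\ Rabs (nest_x (S n) - nest_x n) <= (1/2)^(S n) /\ Rabs (nest_y (S n) - nest_y n) <= (1/2)^(S n).
Proof.
  assert (Hl : Rabs (nest_l n) = (1/2)^n).
  { induction n as [|n IH].
    - unfold nest_l. simpl. apply Rabs_R1.
    - unfold nest_l in *. simpl. destruct (next_sub_spec _ (nest_valid n)) as [i [-> _]].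
      destruct (nest n) as [[x y] l]. simpl in *.
      assert (H2 : Rabs (l / 2) = 1/2 * (1/2)^n).
      { unfold Rdiv. rewrite Rabs_mult, IH, (Rabs_right (/ 2)); lra. }
      destruct i as [|[|[|i]]]; simpl; rewrite ?Rabs_Ropp; assumption. }
  split; [assumption|]. unfold nest_x, nest_y, nest_l in *. simpl.
  destruct (next_sub_spec _ (nest_valid n)) as [i [-> _]].
  destruct (nest n) as [[x y] l]. simpl in *.
  assert (H2 : Rabs (l / 2) = 1/2 * (1/2)^n).
  { unfold Rdiv. rewrite Rabs_mult, Hl, (Rabs_right (/ 2)); lra. }
  assert (0 < (1/2)^n) by (apply pow_lt; lra).
  destruct i as [|[|[|i]]]; simpl; split;
  try (replace (x - x) with 0 by ring; rewrite Rabs_R0; lra);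
  try (replace (y - y) with 0 by ring; rewrite Rabs_R0; lra);
  try (replace (x + l/2 - x) with (l/2) by ring; lra);
  try (replace (y + l/2 - y) with (l/2) by ring; lra).
Qed.

Lemma bary_diff x y x' y' : Cmod (bary x y - bary x' y') <= Rabs (x - x') * Cmod (b - a) + Rabs (y - y') * Cmod (c - a).
Proof.
  replace (bary x y - bary x' y')%C with (RtoC (x - x') * (b - a) + RtoC (y - y') * (c - a))%C
    by (unfold bary; rewrite !RtoC_minus; ring).
  eapply Rle_trans; [apply Cmod_triangle|]. rewrite !Cmod_mult, !Cmod_R. lra.
Qed.

Lemma disk_seg p r x y t : Cmod (x - p) <= r -> Cmod (y - p) <= r -> 0 <= t <= 1 -> Cmod (seg x y t - p) <= r.
Proof.
  intros Hx Hy Ht. replace (seg x y t - p)%C with (RtoC (1 - t) * (x - p) + RtoC t * (y - p))%C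
    by (unfold seg; rewrite RtoC_minus; ring).
  eapply Rle_trans; [apply Cmod_triangle|]. rewrite !Cmod_mult, !Cmod_R, !Rabs_right by lra. nra.
Qed.

(** The nested subtriangles shrink to a point [p].  With [h = 2^-n] their perimeter is [O(h)],
    while near [p] the function differs from its affine part, whose integral vanishes, by
    [o(h)].  The integral over the [n]th triangle is thus [o(h^2)], but it is at least [h^2 =
    4^-n] times the original one. *)
Lemma goursat_tri_int : tri_int g a b c = 0%C.
Proof.
  destruct (nested_limit nest_x (fun n => proj1 (proj2 (nest_step n)))) as [x Hx].
  destruct (nested_limit nest_y (fun n => proj2 (proj2 (nest_step n)))) as [y Hy].
  assert (Hpow : forall e, 0 < e -> exists n, (1/2)^n < e).
  { intros e He. destruct (pow_lt_1_zero (1/2)) with (y := e) as [N HN]; [rewrite Rabs_right; lra|assumption|].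
    exists N. specialize (HN N (le_n N)). rewrite Rabs_right in HN; [assumption|].
    apply Rle_ge, pow_le; lra. }
  assert (Hsim : 0 <= x /\ 0 <= y /\ x + y <= 1).
  { assert (Hv : forall n, 0 <= nest_x n /\ 0 <= nest_y n /\ nest_x n + nest_y n <= 1).
    { intros n. generalize (nest_valid n). unfold nest_x, nest_y. destruct (nest n) as [[u v] l]. simpl. lra. }
    repeat split; apply Rnot_lt_le; intros K.
    - destruct (Hpow (- x)) as [n Hn]; [lra|]. specialize (Hx n). specialize (Hv n). lra.
    - destruct (Hpow (- y)) as [n Hn]; [lra|]. specialize (Hy n). specialize (Hv n). lra.
    - destruct (Hpow ((x + y - 1) / 2)) as [n Hn]; [lra|]. specialize (Hy n). specialize (Hx n). specialize (Hv n). lra. }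
  set (p := bary x y). assert (Vp : V p) by (apply V_bary; tauto).
  destruct (Hg p Vp) as [l Hl].
  set (K := Cmod (b - a) + Cmod (c - a)).
  assert (HK : 0 <= K) by (unfold K; generalize (Cmod_ge_0 (b - a)) (Cmod_ge_0 (c - a)); lra).
  assert (Main : forall e, 0 < e -> Cmod (tri_int g a b c) <= e * (8 * K * K)).
  { intros e He. destruct (Hl e He) as [d [Hd H]].
    destruct (Hpow (d / (2 * K + 1))) as [n Hn]; [apply Rdiv_lt_0_compat; lra|].
    set (h := (1/2)^n) in *. assert (Hh : 0 < h) by (apply pow_lt; lra).
    apply Rmult_lt_compat_r with (r := 2 * K + 1) in Hn; [|lra].
    replace (d / (2*K+1) * (2*K+1)) with d in Hn by (field; lra).
    assert (HT := nest_int n). assert (Hval := nest_valid n). specialize (Hx n). specialize (Hy n).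
    destruct (nest_step n) as [Hln _]. fold h in Hx, Hy, Hln.
    unfold nest_x, nest_y, nest_l in *. destruct (nest n) as [[u v] w]. simpl in *.
    assert (H4 : (1/4)^n = h * h).
    { unfold h. rewrite <- Rpow_mult_distr. f_equal. lra. }
    rewrite H4 in HT.
    assert (Dab := Cmod_ge_0 (b - a)). assert (Dac := Cmod_ge_0 (c - a)).
    assert (B0 : Rabs (u - x) <= h) by (apply Rabs_le; lra).
    assert (B1 : Rabs (v - y) <= h) by (apply Rabs_le; lra).
    assert (B2 : Rabs (u + w - x) <= 2 * h).
    { replace (u + w - x) with ((u - x) + w) by ring. eapply Rle_trans; [apply Rabs_triang|]. lra. }
    assert (B3 : Rabs (v + w - y) <= 2 * h).
    { replace (v + w - y) with ((v - y) + w) by ring. eapply Rle_trans; [apply Rabs_triang|]. lra. }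
    set (r := 2 * h * K).
    assert (Q : forall s t, Rabs (s - x) <= 2 * h -> Rabs (t - y) <= 2 * h -> Cmod (bary s t - p) <= r).
    { intros s t H1 H2. eapply Rle_trans; [apply bary_diff|]. unfold r, K. nra. }
    assert (Q0 := Q u v ltac:(lra) ltac:(lra)).
    assert (Q1 := Q (u + w) v ltac:(lra) ltac:(lra)).
    assert (Q2 := Q u (v + w) ltac:(lra) ltac:(lra)).
    assert (V0 : V (bary u v)) by (apply V_bary; lra).
    assert (V1 : V (bary (u + w) v)) by (apply V_bary; lra).
    assert (V2 : V (bary u (v + w))) by (apply V_bary; lra).
    set (A0 := bary u v) in *. set (A1 := bary (u + w) v) in *. set (A2 := bary u (v + w)) in *.
    assert (Hc := holo_cont _ _ Hg).
    assert (D : forall p q, V p -> V q -> cont_on (segset p q) g) by (intros; now apply (cont_on_seg V)).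
    (* The affine part of g at p is removed; the remainder is at most e r on the subtriangle. *)
    set (aff := fun z => ((g p - l * p) + l * z)%C).
    set (rem := fun z => (g z + (-(1)) * aff z)%C).
    assert (Caff : forall S, cont_on S aff).
    { intros S. apply cont_on_plus; [apply cont_on_const|]. apply cont_on_mult; [apply cont_on_const|apply cont_on_id]. }
    assert (Crem : forall p q, V p -> V q -> cont_on (segset p q) rem).
    { intros. apply cont_on_plus; [auto|]. apply cont_on_mult; [apply cont_on_const|apply Caff]. }
    assert (E : tri_int g A0 A1 A2 = tri_int rem A0 A1 A2).
    { rewrite (tri_int_ext g (fun z => (aff z + rem z)%C)) by (intros z; unfold rem; ring).
      rewrite tri_int_plus by auto. unfold aff at 1. rewrite tri_int_affine. ring. }
    rewrite E in HT.
    assert (Brem : forall z, Cmod (z - p) <= r -> Cmod (rem z) <= e * r).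
    { intros z Hz. replace (rem z) with (g z - g p - l * (z - p))%C by (unfold rem, aff; ring).
      eapply Rle_trans; [apply H|].
      - unfold r in Hz. nra.
      - apply Rmult_le_compat_l; lra. }
    assert (Hfin : Cmod (tri_int rem A0 A1 A2) <= e * r * (Cmod (A1 - A0) + Cmod (A2 - A1) + Cmod (A0 - A2))).
    { apply tri_int_bound; auto. intros z [[t [Ht ->]]|[[t [Ht ->]]|[t [Ht ->]]]]; apply Brem; now apply disk_seg. }
    assert (P1 : Cmod (A1 - A0) <= h * K).
    { eapply Rle_trans; [apply bary_diff|]. replace (u + w - u) with w by ring. replace (v - v) with 0 by ring.
      rewrite Hln, Rabs_R0. unfold K. nra. }
    assert (P2 : Cmod (A2 - A1) <= h * K).
    { eapply Rle_trans; [apply bary_diff|]. replace (u - (u + w)) with (- w) by ring. replace (v + w - v) with w by ring.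
      rewrite Rabs_Ropp, Hln. unfold K. nra. }
    assert (P3 : Cmod (A0 - A2) <= h * K).
    { eapply Rle_trans; [apply bary_diff|]. replace (u - u) with 0 by ring. replace (v - (v + w)) with (- w) by ring.
      rewrite Rabs_Ropp, Hln, Rabs_R0. unfold K. nra. }
    assert (He2 : 0 <= e * r) by (unfold r; apply Rmult_le_pos; [lra|nra]).
    assert (F : Cmod (tri_int g a b c) * (h * h) <= e * r * (3 * (h * K))).
    { eapply Rle_trans; [exact HT|]. eapply Rle_trans; [exact Hfin|]. apply Rmult_le_compat_l; lra. }
    unfold r in F. apply Rmult_le_reg_r with (h * h); [nra|].
    eapply Rle_trans; [exact F|].
    replace (e * (2 * h * K) * (3 * (h * K))) with (6 * (e * K * K * (h * h))) by ring.
    replace (e * (8 * K * K) * (h * h)) with (8 * (e * K * K * (h * h))) by ring.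
    assert (0 <= e * K * K * (h * h)) by (repeat apply Rmult_le_pos; lra). lra. }
  apply Cmod_eq_0. apply Rle_antisym; [|apply Cmod_ge_0].
  apply Rnot_lt_le. intros L.
  assert (HKK : 0 <= 8 * K * K) by nra.
  specialize (Main (Cmod (tri_int g a b c) / (2 * (8 * K * K + 1)))).
  assert (L2 : 0 < Cmod (tri_int g a b c) / (2 * (8 * K * K + 1))) by (apply Rdiv_lt_0_compat; lra).
  specialize (Main L2).
  apply Rmult_le_compat_r with (r := 2 * (8 * K * K + 1)) in Main; [|lra].
  replace (Cmod (tri_int g a b c) / (2 * (8 * K * K + 1)) * (8 * K * K) * (2 * (8 * K * K + 1)))
    with (Cmod (tri_int g a b c) * (8 * K * K)) in Main by (field; nra).
  nra.
Qed.
End Goursat.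

Theorem goursat V g : convex V -> holo V g -> tri_closed V g.
Proof.
  intros HV Hg. split; [now apply holo_cont|]. intros a b c Va Vb Vc. now apply (goursat_tri_int V).
Qed.

(** * Triangles with an exceptional point *)

Definition openC (U : C -> Prop) : Prop :=
  forall x, U x -> exists d, 0 < d /\ forall y, Cmod (y - x) < d -> U y.

Lemma seg_int_refl g a : seg_int g a a = 0%C.
Proof.
  change (path_int (fun t => ((a - a) * g (seg a a t))%C) = 0%C).
  rewrite (path_int_ext _ (fun _ => (0 * 1)%C)) by (intros t _; ring).
  rewrite (path_int_scal 0%C (fun _ => 1%C)) by apply path_cont_const. ring.
Qed.

Lemma seg_sym_pt a b s : seg b a (1 - s) = seg a b s.
Proof. rewrite seg_rev. f_equal. ring. Qed.

(** Cutting the corner at [p] off a triangle changes the integral by integrals over two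
    triangles inside [V], that is, by nothing, and the cut-off tip has arbitrarily small
    perimeter while [g] is bounded near [p].  This serves both for removable points and for the
    corners of the polygon, where the continuation is continuous only. *)
Lemma tri_apex (V : C -> Prop) g p a b : convex V -> tri_closed V g -> cont_on (fun x => V x \/ x = p) g ->
  (forall x s, V x -> 0 < s <= 1 -> V (seg p x s)) -> V a -> V b -> tri_int g p a b = 0%C.
Proof.
  intros HV [_ Ht] Hc Hs Va Vb.
  set (U := fun x => V x \/ x = p) in *.
  assert (Cv : forall u v, V u -> V v -> cont_on (segset u v) g).
  { intros u v Vu Vv. eapply cont_on_sub; [|exact Hc]. intros x Hx. left. now apply (convex_segset V u v x). }
  assert (Cp : forall u, V u -> cont_on (segset p u) g).
  { intros u Vu. eapply cont_on_sub; [|exact Hc]. intros x [t [Ht' ->]].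
    destruct (Req_dec t 0) as [->|E]; [right; apply seg_0|left; apply Hs; [assumption|lra]]. }
  assert (Cp' : forall u, V u -> cont_on (segset u p) g).
  { intros u Vu. eapply cont_on_sub; [|exact (Cp u Vu)]. intros x. apply segset_rev. }
  assert (E : forall s, 0 < s <= 1 -> tri_int g p a b = tri_int g p (seg p a s) (seg p b s)).
  { intros s Hs1. assert (Vas := Hs a s Va Hs1). assert (Vbs := Hs b s Vb Hs1).
    assert (T1 := Ht _ _ _ Vas Va Vb). assert (T2 := Ht _ _ _ Vas Vb Vbs).
    unfold tri_int in *.
    rewrite (seg_int_split g p a s) by (try lra; auto).
    rewrite (seg_int_split g b p (1 - s)) by (try lra; auto). rewrite seg_sym_pt.
    rewrite (seg_int_rev g (seg p a s) b) in T1 by auto.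
    rewrite (seg_int_rev g (seg p a s) (seg p b s)) in T2 by auto.
    set (X := seg_int g (seg p a s) a) in *. set (Y := seg_int g a b) in *. set (Z := seg_int g b (seg p b s)) in *.
    set (W := seg_int g (seg p a s) (seg p b s)) in *. set (Q := seg_int g (seg p a s) b) in *.
    replace (seg_int g p (seg p a s) + X + Y + (Z + seg_int g (seg p b s) p))%C with
      (seg_int g p (seg p a s) + (X + Y + - Q) + (Q + Z + - W) + W + seg_int g (seg p b s) p)%C by ring.
    rewrite T1, T2. ring. }
  apply Cmod_eq_0. apply Rle_antisym; [|apply Cmod_ge_0]. apply Rnot_lt_le. intros L.
  destruct (Hc p (or_intror eq_refl) 1) as [d [Hd Hb]]; [lra|].
  set (M := Cmod (g p) + 1). assert (HM : 0 < M) by (unfold M; generalize (Cmod_ge_0 (g p)); lra).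
  set (K := Cmod (a - p) + Cmod (b - p) + 1).
  assert (HA := Cmod_ge_0 (a - p)). assert (HB := Cmod_ge_0 (b - p)).
  assert (HK : 0 < K) by (unfold K; lra).
  set (s := Rmin 1 (Rmin (d / (2 * K)) (Cmod (tri_int g p a b) / (2 * (4 * M * K))))).
  assert (HMK : 0 < 4 * M * K) by (repeat apply Rmult_lt_0_compat; lra).
  assert (Hs0 : 0 < s).
  { unfold s. repeat apply Rmin_pos; try lra; apply Rdiv_lt_0_compat; lra. }
  assert (Hs1 : s <= 1) by apply Rmin_l.
  assert (Hs2 : s <= d / (2 * K)) by (eapply Rle_trans; [apply Rmin_r|apply Rmin_l]).
  assert (Hs3 : s <= Cmod (tri_int g p a b) / (2 * (4 * M * K))) by (eapply Rle_trans; [apply Rmin_r|apply Rmin_r]).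
  apply Rmult_le_compat_r with (r := 2 * K) in Hs2; [|lra].
  replace (d / (2*K) * (2*K)) with d in Hs2 by (field; lra).
  apply Rmult_le_compat_r with (r := 2 * (4 * M * K)) in Hs3; [|lra].
  replace (Cmod (tri_int g p a b) / (2 * (4 * M * K)) * (2 * (4 * M * K))) with (Cmod (tri_int g p a b)) in Hs3 by (field; lra).
  assert (Vas := Hs a s Va (conj Hs0 Hs1)). assert (Vbs := Hs b s Vb (conj Hs0 Hs1)).
  assert (Da : forall u, Cmod (seg p u s - p) = s * Cmod (u - p)).
  { intros u. replace p with (seg p u 0) at 2 by apply seg_0. rewrite Cmod_seg_diff.
    rewrite Rabs_right by lra. f_equal. ring. }
  assert (Bound : forall x, U x -> Cmod (x - p) <= s * K -> Cmod (g x) <= M).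
  { intros x Ux Hx. assert (Cmod (g x - g p) < 1) by (apply Hb; [assumption|nra]).
    unfold M. generalize (Cmod_tri_lb (g x) (g p)). lra. }
  assert (F : Cmod (tri_int g p (seg p a s) (seg p b s)) <= M * (3 * (s * K))).
  { eapply Rle_trans; [apply tri_int_bound with (M := M); auto|].
    - assert (Pp : Cmod (p - p) <= s * K) by (rewrite Cmod_self; nra).
      assert (Pa : Cmod (seg p a s - p) <= s * K) by (rewrite Da; apply Rmult_le_compat_l; unfold K; lra).
      assert (Pb : Cmod (seg p b s - p) <= s * K) by (rewrite Da; apply Rmult_le_compat_l; unfold K; lra).
      intros x [[t [Ht' ->]]|[[t [Ht' ->]]|[t [Ht' ->]]]]; apply Bound; try (now apply disk_seg).
      + destruct (Req_dec t 0) as [->|E0]; [right; apply seg_0|left; apply Hs; [assumption|lra]].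
      + left. now apply HV.
      + rewrite seg_rev. destruct (Req_dec (1 - t) 0) as [->|E0]; [right; apply seg_0|left; apply Hs; [assumption|lra]].
    - apply Rmult_le_compat_l; [lra|].
      rewrite Da. rewrite (Cmod_minus_sym p), Da.
      assert (Cmod (seg p b s - seg p a s) <= s * Cmod (b - p) + s * Cmod (a - p)).
      { eapply Rle_trans; [apply (Cmod_tri3 _ p)|]. rewrite (Cmod_minus_sym p), !Da. lra. }
      unfold K. nra. }
  rewrite <- (E s) in F by lra. nra.
Qed.

Lemma cross_seg u x y t : cross u (seg x y t) = (1 - t) * cross u x + t * cross u y.
Proof. unfold cross, seg. simpl. ring. Qed.

Lemma seg_minus x y z t : (seg x y t - z)%C = seg (x - z) (y - z) t.
Proof. unfold seg. ring. Qed.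

Definition punct (V : C -> Prop) (z x : C) : Prop := V x /\ x <> z.

Lemma tri_split_mid g a b t : 0 <= t <= 1 -> cont_on (segset a b) g ->
  (seg_int g a (seg a b t) + seg_int g (seg a b t) b + seg_int g b a)%C = 0%C.
Proof. intros Ht Hg. rewrite (seg_int_rev g a b), (seg_int_split g a b t) by assumption. ring. Qed.

Lemma cross_quot (u v : C) : u <> 0%C -> cross (v - u) u = 0 -> Im (v / u)%C = 0.
Proof.
  intros Hu E. assert (N2 := Cmod_sq u). assert (Pz := proj1 (Cmod_gt_0 _) Hu).
  unfold cross in E. destruct u as [u1 u2], v as [v1 v2]. simpl in *.
  assert (H : 0 < u1 * (u1 * 1) + u2 * (u2 * 1)) by nra.
  replace (v1 * (- u2 / (u1 * (u1 * 1) + u2 * (u2 * 1))) + v2 * (u1 / (u1 * (u1 * 1) + u2 * (u2 * 1))))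
   with ((v2 * u1 - v1 * u2) / (u1 * (u1 * 1) + u2 * (u2 * 1))) by (field; lra).
  replace (v2 * u1 - v1 * u2) with 0 by lra. unfold Rdiv. ring.
Qed.

(** A triangle with vertex [z] either is degenerate or has its other two vertices in an open
    half-plane with [z] on its boundary, where [tri_apex] applies.  A general triangle is the
    signed sum of the three triangles that [z] spans with its edges. *)
Theorem goursat_punctured V g z : convex V -> V z -> cont_on V g -> holo (punct V z) g -> tri_closed V g.
Proof.
  intros HV Vz Hc Hh.
  assert (Cv : forall u v, V u -> V v -> cont_on (segset u v) g) by (intros; now apply (cont_on_seg V)).
  assert (Z : forall p q, V p -> V q -> tri_int g z p q = 0%C).
  { intros p q Vp Vq. set (k := cross (q - p) (p - z)).
    destruct (Req_dec k 0) as [E|E].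
    - destruct (classic (p = z)) as [->|Npz].
      + unfold tri_int. rewrite seg_int_refl, (seg_int_rev g z q) by auto. ring.
      + set (lam := Re ((q - z) / (p - z))%C).
        assert (Npz' : (p - z)%C <> 0%C).
        { intros K. apply Npz. replace p with (p - z + z)%C by ring. rewrite K. ring. }
        assert (Hq : q = seg z p lam).
        { assert (I0 : Im ((q - z) / (p - z))%C = 0).
          { apply cross_quot; [assumption|]. replace (q - z - (p - z))%C with (q - p)%C by ring. exact E. }
          assert (Q : ((q - z) / (p - z))%C = RtoC lam).
          { unfold lam. rewrite (surjective_pairing ((q - z) / (p - z))%C) at 1. unfold Re, RtoC. f_equal. exact I0. }
          unfold seg. rewrite <- Q. field. assumption. }
        assert (Hc3 : 0 <= lam <= 1 \/ 1 < lam \/ lam < 0) by lra.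
        unfold tri_int. destruct Hc3 as [H|[H|H]].
        * assert (T1 := tri_split_mid g z p lam H (Cv _ _ Vz Vp)). rewrite <- Hq in T1.
          rewrite (seg_int_rev g z p) in T1 by auto. rewrite (seg_int_rev g z q), (seg_int_rev g q p) by auto.
          replace (seg_int g z p + - seg_int g q p + - seg_int g z q)%C with (- (seg_int g z q + seg_int g q p + - seg_int g z p))%C by ring.
          rewrite T1. ring.
        * assert (Hp : p = seg z q (/ lam)).
          { rewrite Hq. unfold seg. rewrite RtoC_inv by lra. field. intros K; apply RtoC_inj in K; lra. }
          rewrite Hp at 1 2. apply tri_split_mid; [|auto].
          split; [left; apply Rinv_0_lt_compat; lra|]. rewrite <- Rinv_1. apply Rinv_le_contravar; lra.
        * assert (Hz : z = seg p q (/ (1 - lam))).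
          { rewrite Hq. unfold seg. rewrite RtoC_inv by lra. rewrite RtoC_minus. field.
            intros K. assert (K2 : RtoC (1 - lam) = RtoC 0) by (rewrite RtoC_minus; exact K). apply RtoC_inj in K2; lra. }
          assert (T1 := tri_split_mid g p q (/ (1 - lam))). rewrite <- Hz in T1.
          assert (R1 : 0 <= / (1 - lam) <= 1).
          { split; [left; apply Rinv_0_lt_compat; lra|]. rewrite <- Rinv_1. apply Rinv_le_contravar; lra. }
          specialize (T1 R1 (Cv _ _ Vp Vq)). rewrite (seg_int_rev g p q) in T1 by auto.
          rewrite (seg_int_rev g p z), (seg_int_rev g z q) by auto.
          replace (- seg_int g p z + seg_int g p q + - seg_int g z q)%C with (- (seg_int g p z + seg_int g z q + - seg_int g p q))%C by ring.
          rewrite T1. ring.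
    (* The boundary of the half-plane is the parallel to p q through z. *)
    - set (V' := fun x => V x /\ 0 < k * cross (q - p) (x - z)).
      assert (S' : forall x s, V' x -> 0 < s <= 1 -> V' (seg z x s)).
      { intros x s [Vx Hx] Hs1. split; [apply HV; auto; lra|].
        rewrite seg_minus, cross_seg. replace (z - z)%C with (RtoC 0) by ring.
        replace (cross (q - p) 0) with 0 by (unfold cross; simpl; ring). nra. }
      assert (NZ : forall x, V' x -> x <> z).
      { intros x [_ Hx] ->. replace (z - z)%C with (RtoC 0) in Hx by ring.
        replace (cross (q - p) 0) with 0 in Hx by (unfold cross; simpl; ring). lra. }
      assert (CV' : convex V').
      { intros x y [Vx Hx] [Vy Hy] t Ht. split; [now apply HV|].
        rewrite seg_minus, cross_seg.
        assert (0 <= (1 - t) * (k * cross (q - p) (x - z))) by (apply Rmult_le_pos; lra).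
        assert (0 <= t * (k * cross (q - p) (y - z))) by (apply Rmult_le_pos; lra).
        destruct (Req_dec t 0) as [->|]; nra. }
      apply (tri_apex V').
      + assumption.
      + apply goursat; [assumption|]. eapply holo_sub; [|exact Hh]. intros x Hx. split; [apply Hx|now apply NZ].
      + eapply cont_on_sub; [|exact Hc]. intros x [[H _]| ->]; assumption.
      + assumption.
      + split; [assumption|]. fold k. nra.
      + split; [assumption|]. replace (cross (q - p) (q - z)) with k; [nra|].
        unfold k, cross; simpl; ring. }
  split; [assumption|]. intros a b c Va Vb Vc.
  assert (Z1 := Z a b Va Vb). assert (Z2 := Z b c Vb Vc). assert (Z3 := Z c a Vc Va).
  unfold tri_int in *. rewrite (seg_int_rev g z b) in Z1 by auto. rewrite (seg_int_rev g z c) in Z2 by auto.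
  rewrite (seg_int_rev g z a) in Z3 by auto.
  replace (seg_int g a b + seg_int g b c + seg_int g c a)%C with
   ((seg_int g z a + seg_int g a b + - seg_int g z b) + (seg_int g z b + seg_int g b c + - seg_int g z c) + (seg_int g z c + seg_int g c a + - seg_int g z a))%C by ring.
  rewrite Z1, Z2, Z3. ring.
Qed.

(** The value [l] at [z] is meant to be the derivative, which makes the quotient continuous
    there; [c] stands for [F z]. *)
Definition dquot (F : C -> C) (z c l x : C) : C :=
  if excluded_middle_informative (x = z) then l else ((F x - c) / (x - z))%C.

Lemma dquot_ne F z c l x : x <> z -> dquot F z c l x = ((F x - c) / (x - z))%C.
Proof. intros H. unfold dquot. now destruct excluded_middle_informative. Qed.

Lemma Cminus_ne (x z : C) : x <> z -> (x - z)%C <> 0%C.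
Proof. intros H K. apply H. replace x with (x - z + z)%C by ring. rewrite K. ring. Qed.

Lemma cderiv_quot F z c x k : x <> z -> cderiv F x k ->
  exists m, cderiv (fun y => ((F y - c) / (y - z))%C) x m.
Proof.
  intros Hx HF. eexists.
  apply (cderiv_mult (fun y => (F y - c)%C) (fun y => (/ (y - z))%C)).
  - apply (cderiv_plus F (fun _ => (- c)%C)); [exact HF|apply cderiv_const].
  - apply (cderiv_shift Cinv). apply cderiv_inv. now apply Cminus_ne.
Qed.

Lemma dquot_holo V F z c l : holo (punct V z) F -> holo (punct V z) (dquot F z c l).
Proof.
  intros HF x [Vx Hx]. destruct (HF x (conj Vx Hx)) as [k Hk].
  destruct (cderiv_quot F z c x k Hx Hk) as [m Hm]. exists m.
  assert (Hd := proj1 (Cmod_gt_0 _) (Cminus_ne _ _ Hx)).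
  apply (cderiv_local (fun y => ((F y - c) / (y - z))%C) _ _ _ (Cmod (x - z))); [assumption| |assumption].
  intros y Hy. symmetry. apply dquot_ne. intros ->. rewrite Cmod_minus_sym in Hy. lra.
Qed.

(** The implication covers in one statement domains that contain [z], where [z] is a removable
    point, and domains that do not. *)
Lemma dquot_tri_closed V F z c l : convex V -> holo V F -> (V z -> c = F z /\ cderiv F z l) -> tri_closed V (dquot F z c l).
Proof.
  intros HV HF Hz.
  assert (Hh : holo (punct V z) (dquot F z c l)).
  { apply dquot_holo. eapply holo_sub; [|exact HF]. now intros x [Vx _]. }
  destruct (classic (V z)) as [Vz|NVz].
  - destruct (Hz Vz) as [-> Hl].
    apply (goursat_punctured V _ z); try assumption.
    intros x Vx e He. destruct (classic (x = z)) as [->|Nxz].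
    + destruct (Hl (e/2)) as [d [Hd H]]; [lra|]. exists d. split; [assumption|].
      intros y Vy Hy. unfold dquot at 2. destruct (excluded_middle_informative (z = z)) as [_|K]; [|now elim K].
      unfold dquot. destruct (excluded_middle_informative (y = z)) as [->|Nyz].
      * now rewrite Cmod_self.
      * assert (Hn := Cminus_ne _ _ Nyz).
        replace ((F y - F z) / (y - z) - l)%C with ((F y - F z - l * (y - z)) / (y - z))%C by (field; assumption).
        rewrite Cmod_div by assumption. specialize (H y Hy).
        assert (Hp := proj1 (Cmod_gt_0 _) Hn).
        apply Rmult_lt_reg_r with (Cmod (y - z)); [assumption|].
        unfold Rdiv. rewrite Rmult_assoc, Rinv_l, Rmult_1_r by lra. nra.
    + destruct (Hh x (conj Vx Nxz)) as [m Hm].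
      destruct (cderiv_cont _ _ _ Hm e He) as [d [Hd H]]. exists d. split; [assumption|]. intros; now apply H.
  - apply goursat; [assumption|]. eapply holo_sub; [|exact Hh].
    intros x Vx. split; [assumption|]. intros ->. contradiction.
Qed.

(** * Cauchy's estimate on a square and the identity theorem *)

Lemma path_cont_bounded h : path_cont h -> exists M, 0 <= M /\ forall t, 0 <= t <= 1 -> Cmod (h t) <= M.
Proof.
  intros Hh.
  destruct (continuity_ab_maj (fun t => Cmod (h (clamp t))) 0 1) as [t0 [H1 _]]; [lra| |].
  - intros t Ht. intros e He.
    destruct (proj1 (path_cont_iff h) Hh (clamp t) (clamp_in t) e He) as [d [Hd H]].
    exists d. split; [assumption|]. intros s [_ Hs]. simpl in *. unfold R_dist in *.
    assert (K : Cmod (h (clamp s) - h (clamp t)) < e).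
    { apply H; [apply clamp_in|]. eapply Rle_lt_trans; [apply clamp_lip|assumption]. }
    assert (K1 := Cmod_tri_lb (h (clamp s)) (h (clamp t))).
    assert (K2 := Cmod_tri_lb (h (clamp t)) (h (clamp s))). rewrite Cmod_minus_sym in K2.
    apply Rabs_def1; lra.
  - exists (Cmod (h (clamp t0))). split; [apply Cmod_ge_0|]. intros t Ht. rewrite <- (clamp_id t Ht) at 1. now apply H1.
Qed.

Lemma cont_on_bounded g a b : cont_on (segset a b) g ->
  exists M, 0 <= M /\ forall x, segset a b x -> Cmod (g x) <= M.
Proof.
  intros Hg. destruct (path_cont_bounded (fun t => g (seg a b t))) as [M [HM H]].
  - eapply path_cont_of_cont_on; eauto.
  - exists M. split; [assumption|]. intros x [t [Ht ->]]. now apply H.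
Qed.

Lemma path_int_Im_ge h m : path_cont h -> (forall t, 0 <= t <= 1 -> m <= Im (h t)) -> m <= Im (path_int h).
Proof.
  intros Hh Hm.
  assert (H := is_RInt_fct_extend_snd (U := R_NormedModule) (V := R_NormedModule) _ _ _ _ (path_int_correct h Hh)).
  assert (Hc := is_RInt_const (V := R_NormedModule) 0 1 m).
  assert (L := is_RInt_le (fun _ => m) (fun t => Im (h t)) 0 1 _ _ Rle_0_1 Hc H).
  change (((forall t, 0 < t < 1 -> m <= Im (h t)) -> (1 - 0) * m <= Im (path_int h))) in L.
  rewrite Rminus_0_r, Rmult_1_l in L. apply L. intros t Ht. apply Hm; lra.
Qed.

Lemma cross_seg_const a b x t : cross (seg a b t - x) (b - a) = cross (a - x) (b - a).
Proof. unfold cross, seg. simpl. ring. Qed.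

Lemma cross_pos_ne u v : 0 < cross u v -> u <> 0%C.
Proof. intros H ->. unfold cross in H. simpl in H. lra. Qed.

Lemma Im_div_cross (u v : C) : u <> 0%C -> Im (v / u)%C = cross u v / (Cmod u * Cmod u).
Proof.
  intros Hu. rewrite Cmod_sq. assert (N2 := Cmod_sq u). assert (Pz := proj1 (Cmod_gt_0 _) Hu).
  destruct u as [u1 u2], v as [v1 v2]. unfold cross. simpl in *. field. nra.
Qed.

Lemma cont_on_kernel a b x : (forall y, segset a b y -> y <> x) -> cont_on (segset a b) (fun y => (/ (y - x))%C).
Proof.
  intros H. apply (cont_on_inv _ (fun y => (y - x)%C)).
  - apply (cont_on_plus _ (fun y => y) (fun _ => (- x)%C)); [apply cont_on_id|apply cont_on_const].
  - intros y Hy. apply Cminus_ne. now apply H.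
Qed.

(** Seen from [x] the segment turns counterclockwise, so the argument of [y - x], which is the
    imaginary part of the logarithm, increases along it. *)
Lemma Im_seg_int_kernel_pos a b x : 0 < cross (a - x) (b - a) -> 0 < Im (seg_int (fun y => (/ (y - x))%C) a b).
Proof.
  intros H.
  assert (Hne : forall t, (seg a b t - x)%C <> 0%C).
  { intros t. apply (cross_pos_ne _ (b - a)). now rewrite cross_seg_const. }
  assert (Hc : cont_on (segset a b) (fun y => (/ (y - x))%C)).
  { apply cont_on_kernel. intros y [t [_ ->]] E. apply (Hne t). rewrite E. ring. }
  set (M := Cmod (a - x) + Cmod (b - x)).
  assert (HM : 0 < M).
  { unfold M. assert (K := proj1 (Cmod_gt_0 _) (cross_pos_ne _ _ H)). generalize (Cmod_ge_0 (b - x)). lra. }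
  apply Rlt_le_trans with (cross (a - x) (b - a) / (M * M)).
  { apply Rdiv_lt_0_compat; [assumption|]. nra. }
  unfold seg_int. apply (path_int_Im_ge (fun t => ((b - a) * / (seg a b t - x))%C)).
  - apply path_cont_mult; [apply path_cont_const|]. eapply (path_cont_of_cont_on _ (fun y => (/ (y - x))%C)); eauto.
  - intros t Ht. change ((b - a) * / (seg a b t - x))%C with ((b - a) / (seg a b t - x))%C.
    rewrite Im_div_cross by apply Hne. rewrite cross_seg_const.
    assert (L : Cmod (seg a b t - x) <= M).
    { apply disk_seg; [| |assumption]; unfold M; generalize (Cmod_ge_0 (b - x)) (Cmod_ge_0 (a - x)); lra. }
    assert (L0 := proj1 (Cmod_gt_0 _) (Hne t)).
    apply Rmult_le_compat_l; [lra|]. apply Rinv_le_contravar; nra.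
Qed.

Lemma disk_convex c r : convex (disk c r).
Proof.
  intros a b Ha Hb t Ht. unfold disk in *.
  destruct (Rle_dec (Cmod (a - c)) (Cmod (b - c))).
  - apply Rle_lt_trans with (Cmod (b - c)); [|assumption]. apply disk_seg; lra.
  - apply Rle_lt_trans with (Cmod (a - c)); [|assumption]. apply disk_seg; lra.
Qed.

Lemma disk_center c r : 0 < r -> disk c r c.
Proof. intros. unfold disk. now rewrite Cmod_self. Qed.

Definition sq_vertex (c : C) (rho : R) (i : nat) : C :=
  (c + RtoC rho * match i with 0%nat => (-1, -1) | 1%nat => (1, -1) | 2%nat => (1, 1) | _ => (-1, 1) end)%C.

Definition on_square (c : C) (rho : R) (x : C) : Prop :=
  segset (sq_vertex c rho 0) (sq_vertex c rho 1) x \/ segset (sq_vertex c rho 1) (sq_vertex c rho 2) x \/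
  segset (sq_vertex c rho 2) (sq_vertex c rho 3) x \/ segset (sq_vertex c rho 3) (sq_vertex c rho 0) x.

Lemma on_square_dist c rho x : 0 < rho -> on_square c rho x -> rho <= Cmod (x - c).
Proof.
  intros Hr [[t [Ht ->]]|[[t [Ht ->]]|[[t [Ht ->]]|[t [Ht ->]]]]].
  - eapply Rle_trans; [|apply im_le_Cmod]. unfold seg, sq_vertex. simpl.
    match goal with |- _ <= Rabs ?e => replace e with (- rho) by ring end. rewrite Rabs_Ropp, Rabs_right; lra.
  - eapply Rle_trans; [|apply re_le_Cmod]. unfold seg, sq_vertex. simpl.
    match goal with |- _ <= Rabs ?e => replace e with rho by ring end. rewrite Rabs_right; lra.
  - eapply Rle_trans; [|apply im_le_Cmod]. unfold seg, sq_vertex. simpl.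
    match goal with |- _ <= Rabs ?e => replace e with rho by ring end. rewrite Rabs_right; lra.
  - eapply Rle_trans; [|apply re_le_Cmod]. unfold seg, sq_vertex. simpl.
    match goal with |- _ <= Rabs ?e => replace e with (- rho) by ring end. rewrite Rabs_Ropp, Rabs_right; lra.
Qed.

Lemma sq_vertex_in c rho i : 0 < rho -> disk c (2 * rho) (sq_vertex c rho i).
Proof.
  intros Hr. unfold disk, sq_vertex.
  apply Rle_lt_trans with (rho * (3/2)); [|lra].
  apply Cmod_le_sq; [lra|]. destruct i as [|[|[|i]]]; simpl; nra.
Qed.

Lemma sq_cross c rho x : Cmod (x - c) < rho ->
  0 < cross (sq_vertex c rho 0 - x) (sq_vertex c rho 1 - sq_vertex c rho 0) /\
  0 < cross (sq_vertex c rho 1 - x) (sq_vertex c rho 2 - sq_vertex c rho 1) /\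
  0 < cross (sq_vertex c rho 2 - x) (sq_vertex c rho 3 - sq_vertex c rho 2) /\
  0 < cross (sq_vertex c rho 3 - x) (sq_vertex c rho 0 - sq_vertex c rho 3).
Proof.
  intros H. assert (H1 := re_le_Cmod (x - c)). assert (H2 := im_le_Cmod (x - c)).
  apply Rabs_le_between in H1. apply Rabs_le_between in H2.
  destruct x as [x1 x2], c as [c1 c2]. unfold cross, sq_vertex. simpl in *.
  repeat split; nra.
Qed.

Lemma Im_plus (a b : C) : Im (a + b)%C = Im a + Im b.
Proof. reflexivity. Qed.

(** Cauchy's formula on the square.  The integral of [1/(y - x)] over the boundary serves as the
    constant of the formula; it is nonzero because its imaginary part is positive. *)
Lemma cauchy_bound c rho x : 0 < rho -> Cmod (x - c) < rho ->
  exists K, 0 <= K /\ forall h M, holo (disk c (2 * rho)) h ->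
    (forall y, on_square c rho y -> Cmod (h y) <= M) -> Cmod (h x) <= K * M.
Proof.
  intros Hr Hx. destruct (sq_cross c rho x Hx) as [X0 [X1 [X2 X3]]].
  set (v := sq_vertex c rho) in *.
  set (kernel := fun y => (/ (y - x))%C).
  set (W := (seg_int kernel (v 0%nat) (v 1%nat) + seg_int kernel (v 1%nat) (v 2%nat) + seg_int kernel (v 2%nat) (v 3%nat) + seg_int kernel (v 3%nat) (v 0%nat))%C).
  assert (HW : 0 < Cmod W).
  { apply Rlt_le_trans with (Im W); [|apply Rle_trans with (Rabs (Im W)); [apply Rle_abs|apply im_le_Cmod]].
    assert (Y0 := Im_seg_int_kernel_pos _ _ _ X0). assert (Y1 := Im_seg_int_kernel_pos _ _ _ X1).
    assert (Y2 := Im_seg_int_kernel_pos _ _ _ X2). assert (Y3 := Im_seg_int_kernel_pos _ _ _ X3).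
    unfold W. rewrite !Im_plus. fold kernel in Y0, Y1, Y2, Y3. lra. }
  set (eta := rho - Cmod (x - c)). assert (He : 0 < eta) by (unfold eta; lra).
  assert (Hfar : forall y, on_square c rho y -> eta <= Cmod (y - x)).
  { intros y Hy. apply on_square_dist in Hy; [|assumption]. unfold eta.
    generalize (Cmod_tri3 y x c). lra. }
  assert (Hne : forall y, on_square c rho y -> y <> x).
  { intros y Hy ->. specialize (Hfar x Hy). rewrite Cmod_self in Hfar. lra. }
  exists (16 * rho / eta / Cmod W). split.
  { apply Rdiv_le_0_compat; [apply Rdiv_le_0_compat|]; lra. }
  intros h M Hh HM.
  assert (Dx : disk c (2 * rho) x) by (unfold disk; lra).
  destruct (Hh x Dx) as [l Hl].
  destruct (dquot_tri_closed _ h x (h x) l (disk_convex c (2 * rho)) Hh (fun _ => conj eq_refl Hl)) as [Qc Qt].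
  assert (Vi : forall i, disk c (2 * rho) (v i)) by (intros; now apply sq_vertex_in).
  assert (hcont := holo_cont _ _ Hh).
  set (S := fun a b : C => forall y, segset a b y -> on_square c rho y).
  assert (S0 : S (v 0%nat) (v 1%nat)) by (intros y Hy; unfold on_square; tauto).
  assert (S1 : S (v 1%nat) (v 2%nat)) by (intros y Hy; unfold on_square; tauto).
  assert (S2 : S (v 2%nat) (v 3%nat)) by (intros y Hy; unfold on_square; tauto).
  assert (S3 : S (v 3%nat) (v 0%nat)) by (intros y Hy; unfold on_square; tauto).
  assert (Ck : forall a b, S a b -> cont_on (segset a b) kernel).
  { intros a b Hab. apply cont_on_kernel. intros y Hy. apply Hne. now apply Hab. }
  assert (Chk : forall a b, disk c (2*rho) a -> disk c (2*rho) b -> S a b -> cont_on (segset a b) (fun y => (h y * kernel y)%C)).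
  { intros a b Ha Hb Hab. apply cont_on_mult; [|auto]. apply (cont_on_seg (disk c (2*rho))); auto. apply disk_convex. }
  assert (E : forall a b, disk c (2*rho) a -> disk c (2*rho) b -> S a b -> seg_int (dquot h x (h x) l) a b = (seg_int (fun y => (h y * kernel y)%C) a b + - h x * seg_int kernel a b)%C).
  { intros a b Ha Hb Hab. rewrite <- seg_int_scal by auto. rewrite <- seg_int_plus; [|auto|apply cont_on_mult; [apply cont_on_const|auto]].
    apply seg_int_ext. intros y Hy. rewrite dquot_ne by auto. unfold kernel.
    assert (Hn := Cminus_ne _ _ (Hne y (Hab y Hy))). field. assumption. }
  assert (Len : forall a b, disk c (2*rho) a -> disk c (2*rho) b -> Cmod (b - a) <= 4 * rho).
  { intros a b Ha Hb. unfold disk in *. generalize (Cmod_tri3 b c a). rewrite (Cmod_minus_sym c a). lra. }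
  assert (HM0 : 0 <= M).
  { eapply Rle_trans; [apply Cmod_ge_0|]. apply (HM (v 0%nat)). left. apply segset_l. }
  assert (B : forall a b, disk c (2*rho) a -> disk c (2*rho) b -> S a b -> Cmod (seg_int (fun y => (h y * kernel y)%C) a b) <= M / eta * (4 * rho)).
  { intros a b Ha Hb Hab. eapply Rle_trans; [apply seg_int_bound with (M := M / eta)|].
    - auto.
    - intros y Hy. rewrite Cmod_mult. unfold kernel. rewrite Cmod_inv by (apply Cminus_ne; auto).
      apply Rmult_le_compat; [apply Cmod_ge_0| |auto|].
      + left. apply Rinv_0_lt_compat. specialize (Hfar y (Hab y Hy)). lra.
      + apply Rinv_le_contravar; auto.
    - apply Rmult_le_compat_l; [apply Rdiv_le_0_compat; lra|]. auto. }
  assert (T1 := Qt _ _ _ (Vi 0%nat) (Vi 1%nat) (Vi 2%nat)).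
  assert (T2 := Qt _ _ _ (Vi 0%nat) (Vi 2%nat) (Vi 3%nat)).
  unfold tri_int in T1, T2.
  rewrite (seg_int_rev _ (v 0%nat) (v 2%nat)) in T1 by (apply (cont_on_seg (disk c (2*rho))); auto; apply disk_convex).
  rewrite (E (v 0%nat) (v 1%nat)), (E (v 1%nat) (v 2%nat)) in T1 by auto.
  rewrite (E (v 2%nat) (v 3%nat)), (E (v 3%nat) (v 0%nat)) in T2 by auto.
  set (H0 := seg_int (fun y => (h y * kernel y)%C) (v 0%nat) (v 1%nat)) in *.
  set (H1 := seg_int (fun y => (h y * kernel y)%C) (v 1%nat) (v 2%nat)) in *.
  set (H2 := seg_int (fun y => (h y * kernel y)%C) (v 2%nat) (v 3%nat)) in *.
  set (H3 := seg_int (fun y => (h y * kernel y)%C) (v 3%nat) (v 0%nat)) in *.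
  assert (Sum : (h x * W)%C = (H0 + H1 + (H2 + H3))%C).
  { set (X := seg_int (dquot h x (h x) l) (v 0%nat) (v 2%nat)) in *.
    transitivity (h x * W + ((H0 + - h x * seg_int kernel (v 0%nat) (v 1%nat) + (H1 + - h x * seg_int kernel (v 1%nat) (v 2%nat)) + - X) + (X + (H2 + - h x * seg_int kernel (v 2%nat) (v 3%nat)) + (H3 + - h x * seg_int kernel (v 3%nat) (v 0%nat)))))%C.
    - rewrite T1, T2. ring.
    - unfold W. ring. }
  assert (Fin : Cmod (h x) * Cmod W <= 4 * (M / eta * (4 * rho))).
  { rewrite <- Cmod_mult, Sum. eapply Rle_trans; [apply Cmod_triangle|].
    assert (L1 := Cmod_triangle H0 H1). assert (L2 := Cmod_triangle H2 H3).
    assert (Cmod H0 <= M / eta * (4 * rho)) by (apply B; auto).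
    assert (Cmod H1 <= M / eta * (4 * rho)) by (apply B; auto).
    assert (Cmod H2 <= M / eta * (4 * rho)) by (apply B; auto).
    assert (Cmod H3 <= M / eta * (4 * rho)) by (apply B; auto). lra. }
  apply Rmult_le_reg_r with (Cmod W); [assumption|].
  eapply Rle_trans; [exact Fin|]. right. field. lra.
Qed.

(** The quotients [g / (y - c)^k] are still holomorphic, as [g] vanishes near [c].  Cauchy's
    estimate for them bounds [g x] by a constant times the [k]th power of [|x - c| / rho], for
    every [k]. *)
Lemma local_zero c rho g e : 0 < rho -> 0 < e -> holo (disk c (2 * rho)) g ->
  (forall y, disk c e y -> g y = 0%C) -> forall x, Cmod (x - c) < rho -> g x = 0%C.
Proof.
  intros Hr He Hg Hz x Hx.
  destruct (cauchy_bound c rho x Hr Hx) as [K [HK HC]].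
  assert (Vi : forall i, disk c (2 * rho) (sq_vertex c rho i)) by (intros; now apply sq_vertex_in).
  assert (Cs : forall i j, cont_on (segset (sq_vertex c rho i) (sq_vertex c rho j)) g).
  { intros i j. apply (cont_on_seg (disk c (2*rho))); auto. apply disk_convex. now apply holo_cont. }
  destruct (cont_on_bounded g _ _ (Cs 0%nat 1%nat)) as [M0 [P0 B0]].
  destruct (cont_on_bounded g _ _ (Cs 1%nat 2%nat)) as [M1 [P1 B1]].
  destruct (cont_on_bounded g _ _ (Cs 2%nat 3%nat)) as [M2 [P2 B2]].
  destruct (cont_on_bounded g _ _ (Cs 3%nat 0%nat)) as [M3 [P3 B3]].
  set (M := M0 + M1 + M2 + M3).
  assert (HM : forall y, on_square c rho y -> Cmod (g y) <= M).
  { unfold M. intros y [H|[H|[H|H]]]; [apply B0 in H|apply B1 in H|apply B2 in H|apply B3 in H]; lra. }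
  set (h := fun k y => (g y / (y - c) ^ k)%C).
  assert (Hh : forall k, holo (disk c (2 * rho)) (h k)).
  { intros k y Dy. destruct (classic (y = c)) as [->|N].
    - exists 0%C. apply (cderiv_local (fun _ => 0%C) _ _ _ e); [assumption| |apply cderiv_const].
      intros y Hy. unfold h. rewrite Hz by assumption. unfold Cdiv. ring.
    - induction k as [|k IH].
      + destruct (Hg y Dy) as [l Hl]. exists l. apply (cderiv_local g _ _ _ 1); [lra| |assumption].
        intros z _. unfold h. simpl. field.
      + destruct IH as [l Hl]. destruct (cderiv_quot (h k) c 0%C y l N Hl) as [m Hm].
        exists m. apply (cderiv_local _ _ _ _ (Cmod (y - c)) (proj1 (Cmod_gt_0 _) (Cminus_ne _ _ N))) with (2 := Hm).
        intros z Hz'. assert (Nz : z <> c). { intros ->. rewrite Cmod_minus_sym in Hz'. lra. }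
        apply Cminus_ne in Nz. unfold h. simpl. field. split; [|assumption]. now apply Cpow_nz. }
  destruct (classic (x = c)) as [->|N]; [apply Hz; now apply disk_center|].
  assert (Nx := Cminus_ne _ _ N). assert (Px := proj1 (Cmod_gt_0 _) Nx).
  set (q := Cmod (x - c) / rho).
  assert (Hq : 0 <= q < 1).
  { unfold q. split; [apply Rdiv_le_0_compat; lra|]. apply Rmult_lt_reg_r with rho; [assumption|]. field_simplify; lra. }
  assert (Bd : forall k, Cmod (g x) <= K * M * q ^ k).
  { intros k. assert (Hrk : 0 < rho ^ k) by (now apply pow_lt).
    assert (H := HC (h k) (M / rho ^ k) (Hh k)).
    assert (Hxk : 0 < Cmod (x - c) ^ k) by (now apply pow_lt).
    assert (H2 : Cmod (h k x) <= K * (M / rho ^ k)).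
    { apply H. intros y Hy. unfold h. assert (Fy := on_square_dist c rho y Hr Hy).
      rewrite Cmod_div by (apply Cpow_nz; apply Cmod_gt_0; lra). rewrite Cmod_pow.
      apply Rmult_le_compat; [apply Cmod_ge_0| |now apply HM|].
      - left. apply Rinv_0_lt_compat. apply pow_lt. lra.
      - apply Rinv_le_contravar; [assumption|]. apply pow_incr. lra. }
    unfold h in H2. rewrite Cmod_div in H2 by (now apply Cpow_nz). rewrite Cmod_pow in H2.
    unfold q. unfold Rdiv at 1. rewrite Rpow_mult_distr, pow_inv.
    apply Rmult_le_compat_r with (r := Cmod (x - c) ^ k) in H2; [|lra].
    replace (Cmod (g x) / Cmod (x - c) ^ k * Cmod (x - c) ^ k) with (Cmod (g x)) in H2 by (field; lra).
    eapply Rle_trans; [exact H2|]. right. field. lra. }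
  apply Cmod_eq_0. apply Rle_antisym; [|apply Cmod_ge_0]. apply Rnot_lt_le. intros L.
  assert (HKM : 0 <= K * M) by (apply Rmult_le_pos; unfold M; lra).
  destruct (pow_lt_1_zero q) with (y := Cmod (g x) / (K * M + 1)) as [k Hk].
  { rewrite Rabs_right; lra. } { apply Rdiv_lt_0_compat; lra. }
  specialize (Hk k (le_n k)). rewrite Rabs_right in Hk by (apply Rle_ge, pow_le; lra).
  specialize (Bd k). apply Rmult_lt_compat_r with (r := K * M + 1) in Hk; [|lra].
  replace (Cmod (g x) / (K * M + 1) * (K * M + 1)) with (Cmod (g x)) in Hk by (field; lra).
  assert (0 <= q ^ k) by (apply pow_le; lra). nra.
Qed.

Lemma ball_seg (W : C -> Prop) a b r : convex W -> (forall y, Cmod (y - a) < r -> W y) -> (forall y, Cmod (y - b) < r -> W y) ->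
  forall t, 0 <= t <= 1 -> forall y, Cmod (y - seg a b t) < r -> W y.
Proof.
  intros HW Ha Hb t Ht y Hy.
  replace y with (seg (a + (y - seg a b t)) (b + (y - seg a b t)) t) by (unfold seg; ring).
  apply HW; [apply Ha|apply Hb|assumption].
  - now replace (a + (y - seg a b t) - a)%C with (y - seg a b t)%C by ring.
  - now replace (b + (y - seg a b t) - b)%C with (y - seg a b t)%C by ring.
Qed.

(** Vanishing is propagated along the segment from [a] to [b] by steps that are short compared
    with its distance to the complement of [W]. *)
Theorem identity_zero W g a b e : convex W -> openC W -> holo W g -> W a -> W b -> 0 < e ->
  (forall y, disk a e y -> g y = 0%C) -> g b = 0%C.
Proof.
  intros HW OW Hg Wa Wb He Hz.
  destruct (OW a Wa) as [ra [Hra Ha]]. destruct (OW b Wb) as [rb [Hrb Hb]].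
  set (rho := Rmin ra rb / 2). assert (Hrho : 0 < rho) by (unfold rho; generalize (Rmin_pos _ _ Hra Hrb); lra).
  assert (BW : forall t, 0 <= t <= 1 -> forall y, Cmod (y - seg a b t) < 2 * rho -> W y).
  { apply ball_seg; [assumption| |]; intros y Hy; [apply Ha|apply Hb]; eapply Rlt_le_trans; try exact Hy; unfold rho;
    generalize (Rmin_l ra rb) (Rmin_r ra rb); lra. }
  destruct (nfloor_ex (Cmod (b - a) / (rho / 2))) as [N0 [_ HN]].
  { apply Rdiv_le_0_compat; [apply Cmod_ge_0|lra]. }
  set (N := S N0). assert (HN1 : INR N = INR N0 + 1) by apply S_INR.
  rewrite <- HN1 in HN. assert (HNp : 0 < INR N) by (rewrite HN1; generalize (pos_INR N0); lra).
  assert (Hstep : Cmod (b - a) / INR N < rho / 2).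
  { apply Rmult_lt_reg_r with (INR N); [assumption|].
    apply Rmult_lt_compat_r with (r := rho/2) in HN; [|lra].
    replace (Cmod (b - a) / INR N * INR N) with (Cmod (b - a)) by (field; lra).
    replace (Cmod (b - a) / (rho/2) * (rho/2)) with (Cmod (b - a)) in HN by (field; lra). lra. }
  assert (Claim : forall i, (i <= N)%nat -> exists e', 0 < e' /\ forall y, disk (seg a b (INR i / INR N)) e' y -> g y = 0%C).
  { induction i as [|i IH]; intros Hi.
    - exists e. split; [assumption|]. replace (INR 0 / INR N) with 0 by (change (INR 0) with 0; unfold Rdiv; ring). now rewrite seg_0.
    - destruct IH as [e' [He' H']]; [lia|].
      assert (Ti : 0 <= INR i / INR N <= 1).
      { split; [apply Rdiv_le_0_compat; [apply pos_INR|assumption]|].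
        apply Rmult_le_reg_r with (INR N); [assumption|].
        replace (INR i / INR N * INR N) with (INR i) by (field; lra). rewrite Rmult_1_l. apply le_INR. lia. }
      exists (rho / 2). split; [lra|]. intros y Hy.
      apply (local_zero (seg a b (INR i / INR N)) rho g e'); try assumption.
      + eapply holo_sub; [|exact Hg]. intros z Hz'. now apply (BW _ Ti).
      + unfold disk in Hy. eapply Rle_lt_trans; [apply (Cmod_tri3 _ (seg a b (INR (S i) / INR N)))|].
        rewrite Cmod_seg_diff.
        replace (INR (S i) / INR N - INR i / INR N) with (/ INR N) by (rewrite S_INR; field; lra).
        rewrite Rabs_right by (apply Rle_ge; left; now apply Rinv_0_lt_compat).
        unfold Rdiv in Hstep. lra. }
  destruct (Claim N (le_n N)) as [e' [He' H']]. apply H'.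
  replace (INR N / INR N) with 1 by (field; lra). rewrite seg_1. now apply disk_center.
Qed.

(** * Deforming a side of the contour *)

Fixpoint csum (n : nat) (f : nat -> C) : C :=
  match n with 0%nat => 0%C | S n => (csum n f + f n)%C end.

Lemma csum_ext n f g : (forall i, (i < n)%nat -> f i = g i) -> csum n f = csum n g.
Proof.
  induction n as [|n IH]; intros H; [reflexivity|]. simpl. rewrite IH, H; auto.
Qed.

Lemma csum_plus n f g : csum n (fun i => (f i + g i)%C) = (csum n f + csum n g)%C.
Proof. induction n as [|n IH]; simpl; [ring|]. rewrite IH. ring. Qed.

Lemma csum_scal n c f : csum n (fun i => (c * f i)%C) = (c * csum n f)%C.
Proof. induction n as [|n IH]; simpl; [ring|]. rewrite IH. ring. Qed.

Lemma csum_shift n f : csum (S n) f = (f 0%nat + csum n (fun i => f (S i)))%C.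
Proof.
  induction n as [|n IH]; [simpl; ring|].
  change (csum (S (S n)) f) with (csum (S n) f + f (S n))%C. rewrite IH. simpl. ring.
Qed.

Lemma csum_next m f : (1 <= m)%nat -> csum m (fun k => f (next m k)) = csum m f.
Proof.
  intros Hm. destruct m as [|m]; [lia|].
  rewrite (csum_shift m f).
  change (csum m (fun k => f (next (S m) k)) + f (next (S m) m) = f 0%nat + csum m (fun i => f (S i)))%C.
  replace (next (S m) m) with 0%nat
    by (unfold next; replace (m + 1)%nat with (S m) by lia; now rewrite Nat.Div0.mod_same).
  rewrite Cplus_comm. f_equal. apply csum_ext. intros i Hi. unfold next. f_equal.
  rewrite Nat.mod_small; lia.
Qed.

(** Each cell [X_i X_(i+1) X'_(i+1) X'_i] lies in a convex set on which its own integrand is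
    closed.  The transversal edges of neighbouring cells cancel because the two integrands agree
    there. *)
Lemma strip_deform n (D : nat -> C -> Prop) (Ks : nat -> C -> C) (X X' : nat -> C) :
  (forall i, (i <= n)%nat -> convex (D i) /\ tri_closed (D i) (Ks i) /\ D i (X i) /\ D i (X' i) /\ D i (X (S i)) /\ D i (X' (S i))) ->
  (forall i y, (i < n)%nat -> segset (X (S i)) (X' (S i)) y -> Ks i y = Ks (S i) y) ->
  csum (S n) (fun i => seg_int (Ks i) (X i) (X (S i))) =
  (seg_int (Ks 0%nat) (X 0%nat) (X' 0%nat) + csum (S n) (fun i => seg_int (Ks i) (X' i) (X' (S i))) + seg_int (Ks n) (X' (S n)) (X (S n)))%C.
Proof.
  induction n as [|n IH]; intros HD He.
  - destruct (HD 0%nat) as [Hc [[Ht0 Ht] [H1 [H2 [H3 H4]]]]]; [lia|]. simpl.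
    assert (T1 := Ht _ _ _ H1 H2 H4). assert (T2 := Ht _ _ _ H1 H4 H3). unfold tri_int in *.
    assert (Cv : forall u v, D 0%nat u -> D 0%nat v -> cont_on (segset u v) (Ks 0%nat)) by (intros; now apply (cont_on_seg (D 0%nat))).
    rewrite (seg_int_rev _ (X 0%nat) (X' 1%nat)) in T1 by auto.
    rewrite (seg_int_rev _ (X 0%nat) (X 1%nat)) in T2 by auto.
    set (A := seg_int (Ks 0%nat) (X 0%nat) (X 1%nat)) in *.
    set (B := seg_int (Ks 0%nat) (X 0%nat) (X' 1%nat)) in *.
    set (E := seg_int (Ks 0%nat) (X 0%nat) (X' 0%nat)) in *.
    set (F := seg_int (Ks 0%nat) (X' 0%nat) (X' 1%nat)) in *.
    set (G := seg_int (Ks 0%nat) (X' 1%nat) (X 1%nat)) in *.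
    replace (0 + A)%C with (E + F + G - (E + F + - B) - (B + G + - A))%C by ring.
    rewrite T1, T2. ring.
  - change (csum (S (S n)) (fun i => seg_int (Ks i) (X i) (X (S i)))) with
      (csum (S n) (fun i => seg_int (Ks i) (X i) (X (S i))) + seg_int (Ks (S n)) (X (S n)) (X (S (S n))))%C.
    rewrite IH; [|intros; apply HD; lia|intros; apply He; [lia|assumption]].
    destruct (HD (S n)) as [Hc [[Ht0 Ht] [H1 [H2 [H3 H4]]]]]; [lia|].
    assert (T1 := Ht _ _ _ H1 H2 H4). assert (T2 := Ht _ _ _ H1 H4 H3). unfold tri_int in *.
    assert (Cv : forall u v, D (S n) u -> D (S n) v -> cont_on (segset u v) (Ks (S n))) by (intros; now apply (cont_on_seg (D (S n)))).
    rewrite (seg_int_rev _ (X (S n)) (X' (S (S n)))) in T1 by auto.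
    rewrite (seg_int_rev _ (X (S n)) (X (S (S n)))) in T2 by auto.
    assert (Eq : seg_int (Ks n) (X' (S n)) (X (S n)) = (- seg_int (Ks (S n)) (X (S n)) (X' (S n)))%C).
    { rewrite <- seg_int_rev by auto. apply seg_int_ext. intros y Hy. apply He; [lia|]. now apply segset_rev. }
    rewrite Eq.
    change (csum (S (S n)) (fun i => seg_int (Ks i) (X' i) (X' (S i)))) with
      (csum (S n) (fun i => seg_int (Ks i) (X' i) (X' (S i))) + seg_int (Ks (S n)) (X' (S n)) (X' (S (S n))))%C.
    set (Y := csum (S n) (fun i => seg_int (Ks i) (X' i) (X' (S i)))).
    set (Z := seg_int (Ks 0%nat) (X 0%nat) (X' 0%nat)).
    set (A := seg_int (Ks (S n)) (X (S n)) (X (S (S n)))) in *.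
    set (B := seg_int (Ks (S n)) (X (S n)) (X' (S (S n)))) in *.
    set (E := seg_int (Ks (S n)) (X (S n)) (X' (S n))) in *.
    set (F := seg_int (Ks (S n)) (X' (S n)) (X' (S (S n)))) in *.
    set (G := seg_int (Ks (S n)) (X' (S (S n))) (X (S (S n)))) in *.
    replace A with (E + F + G - (E + F + - B) - (B + G + - A))%C by ring.
    rewrite T1, T2. ring.
Qed.

Lemma seg_int_polyline V g n (X : nat -> C) : convex V -> tri_closed V g -> (forall i, (i <= S n)%nat -> V (X i)) ->
  csum (S n) (fun i => seg_int g (X i) (X (S i))) = seg_int g (X 0%nat) (X (S n)).
Proof.
  intros HV [Hc Ht] HX. induction n as [|n IH]; [simpl; ring|].
  change (csum (S (S n)) (fun i => seg_int g (X i) (X (S i)))) with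
     (csum (S n) (fun i => seg_int g (X i) (X (S i))) + seg_int g (X (S n)) (X (S (S n))))%C.
  rewrite IH by (intros; apply HX; lia).
  assert (T := Ht _ _ _ (HX 0%nat ltac:(lia)) (HX (S n) ltac:(lia)) (HX (S (S n)) ltac:(lia))).
  unfold tri_int in T. rewrite (seg_int_rev g (X 0%nat) (X (S (S n)))) in T by (apply (cont_on_seg V); auto; apply HX; lia).
  set (A := seg_int g (X 0%nat) (X (S (S n)))) in *.
  set (B := seg_int g (X 0%nat) (X (S n))) in *.
  replace (B + seg_int g (X (S n)) (X (S (S n))))%C with (B + seg_int g (X (S n)) (X (S (S n))) + - A + A)%C by ring.
  rewrite T. ring.
Qed.

(** The part of the contour that belongs to one side is pushed into the polygon: the strip along
    the side to its inner edge, the legs at [w] and [w'] to segments ending at points [Q] and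
    [Q'] of the polygon.  [U] is the region inside, [Vp] and [Vm] are the neighbourhoods of the
    two corners, and the triangles with apex at a corner are supplied by [tri_apex]. *)
Lemma side_deform n (U Vp Vm : C -> Prop) (D : nat -> C -> Prop) (Kf Kc Kc' : C -> C) (Ks : nat -> C -> C)
  (X X' : nat -> C) (w w' Q Q' P P' : C) :
  convex U -> convex Vp -> convex Vm -> tri_closed U Kf -> tri_closed Vp Kc -> tri_closed Vm Kc' ->
  U Q -> U Q' -> (forall i, (i <= S n)%nat -> U (X' i)) ->
  Vp Q -> Vp P -> Vp (X 0%nat) -> Vp (X' 0%nat) ->
  Vm Q' -> Vm P' -> Vm (X (S n)) -> Vm (X' (S n)) ->
  (forall i, (i <= n)%nat -> convex (D i) /\ tri_closed (D i) (Ks i) /\ D i (X i) /\ D i (X' i) /\ D i (X (S i)) /\ D i (X' (S i))) ->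
  (forall i y, (i < n)%nat -> segset (X (S i)) (X' (S i)) y -> Ks i y = Ks (S i) y) ->
  (forall i y, (i <= n)%nat -> segset (X' i) (X' (S i)) y -> Ks i y = Kf y) ->
  (forall y, segset Q (X' 0%nat) y -> Kc y = Kf y) ->
  (forall y, segset (X' (S n)) Q' y -> Kc' y = Kf y) ->
  (forall y, segset (X 0%nat) (X' 0%nat) y -> Ks 0%nat y = Kc y) ->
  (forall y, segset (X' (S n)) (X (S n)) y -> Ks n y = Kc' y) ->
  tri_int Kc w Q P = 0%C -> cont_on (segset w P) Kc ->
  tri_int Kc' w' P' Q' = 0%C -> cont_on (segset w' P') Kc' ->
  (seg_int Kc w P + seg_int Kc P (X 0%nat) + csum (S n) (fun i => seg_int (Ks i) (X i) (X (S i))) + seg_int Kc' (X (S n)) P' + seg_int Kc' P' w')%C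
  = (seg_int Kc w Q + seg_int Kf Q Q' + seg_int Kc' Q' w')%C.
Proof.
  intros CO Cp Cm TO Tp Tm OQ OQ' OX pQ pP pX pX' mQ mP mX mX' HD E1 E2 E3 E4 E5 E6 A1 K1 A2 K2.
  rewrite (strip_deform n D Ks X X' HD E1).
  rewrite (csum_ext _ _ (fun i => seg_int Kf (X' i) (X' (S i)))) by (intros; apply seg_int_ext; intros; apply E2; [lia|assumption]).
  rewrite (seg_int_polyline U Kf n X' CO TO OX).
  rewrite (seg_int_ext (Ks 0%nat) Kc) by assumption.
  rewrite (seg_int_ext (Ks n) Kc') by assumption.
  destruct TO as [cO tO]. destruct Tp as [cp tp]. destruct Tm as [cm tm].
  assert (O1 := tO _ _ _ OQ (OX 0%nat ltac:(lia)) (OX (S n) ltac:(lia))).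
  assert (O2 := tO _ _ _ OQ (OX (S n) ltac:(lia)) OQ').
  assert (p1 := tp _ _ _ pQ pP pX). assert (p2 := tp _ _ _ pQ pX pX').
  assert (m1 := tm _ _ _ mQ mX' mX). assert (m2 := tm _ _ _ mQ mX mP).
  unfold tri_int in *.
  rewrite <- (seg_int_ext Kc Kf Q (X' 0%nat)) in O1 by assumption.
  rewrite <- (seg_int_ext Kc' Kf (X' (S n)) Q') in O2 by assumption.
  rewrite (seg_int_rev Kf Q (X' (S n))) in O1 by (apply (cont_on_seg U); auto).
  rewrite (seg_int_rev Kf Q Q') in O2 by (apply (cont_on_seg U); auto).
  rewrite (seg_int_rev Kc Q (X 0%nat)) in p1 by (apply (cont_on_seg Vp); auto).
  rewrite (seg_int_rev Kc Q (X' 0%nat)) in p2 by (apply (cont_on_seg Vp); auto).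
  rewrite (seg_int_rev Kc' Q' (X (S n))) in m1 by (apply (cont_on_seg Vm); auto).
  rewrite (seg_int_rev Kc' (X' (S n)) Q') in m1 by (apply (cont_on_seg Vm); auto).
  rewrite (seg_int_rev Kc w P) in A1 by assumption.

  assert (R2 : seg_int Kc' P' w' = (- seg_int Kc' w' P')%C) by (now apply seg_int_rev).
  rewrite R2.
  set (a1 := seg_int Kc w P) in *. set (a2 := seg_int Kc P (X 0%nat)) in *. set (a3 := seg_int Kc (X 0%nat) (X' 0%nat)) in *.
  set (a4 := seg_int Kf (X' 0%nat) (X' (S n))) in *. set (a5 := seg_int Kc' (X' (S n)) (X (S n))) in *.
  set (a6 := seg_int Kc' (X (S n)) P') in *. set (a7 := seg_int Kc' w' P') in *. set (a8 := seg_int Kc w Q) in *.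
  set (a9 := seg_int Kf Q Q') in *. set (b1 := seg_int Kc' Q' w') in *. set (b2 := seg_int Kc Q P) in *.
  set (b3 := seg_int Kc Q (X 0%nat)) in *. set (b4 := seg_int Kc Q (X' 0%nat)) in *. set (b5 := seg_int Kf Q (X' (S n))) in *.
  set (b6 := seg_int Kc' (X' (S n)) Q') in *. set (b7 := seg_int Kc' Q' (X (S n))) in *.
  set (b8 := seg_int Kc' P' Q') in *.
  transitivity (a8 + a9 + b1 + (a8 + b2 + - a1) * (-(1)) + (a7 + b8 + b1) * (-(1)) + (b4 + a4 + - b5) + (b5 + b6 + - a9)
     + (b2 + a2 + - b3) + (b3 + a3 + - b4) + (- b6 + a5 + - b7) + (b7 + a6 + b8))%C.
  - ring.
  - rewrite A1, A2, O1, O2, p1, p2, m1, m2. ring.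
Qed.

(** * Geometry of the polygon *)

(** For conditions that persist when the parameter decreases, finitely many may be met by one
    parameter value.  All constants of the contour are chosen in this way. *)
Lemma unif_small m (P : nat -> R -> Prop) :
  (forall k, (k < m)%nat -> exists e, 0 < e /\ forall x, 0 < x <= e -> P k x) ->
  exists e, 0 < e /\ forall k, (k < m)%nat -> P k e.
Proof.
  intros H. assert (H' : exists e, 0 < e /\ forall k, (k < m)%nat -> forall x, 0 < x <= e -> P k x).
  { induction m as [|n IH].
    - exists 1. split; [lra|]. intros; lia.
    - destruct IH as [e [He IH]]; [intros; apply H; lia|].
      destruct (H n) as [e' [He' H']]; [lia|].
      exists (Rmin e e'). split; [now apply Rmin_pos|]. intros k Hk x Hx.
      assert (x <= e /\ x <= e') by (generalize (Rmin_l e e') (Rmin_r e e'); lra).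
      destruct (Nat.eq_dec k n) as [->|N]; [apply H'|apply IH; [lia|]]; lra. }
  destruct H' as [e [He H']]. exists e. split; [assumption|]. intros k Hk. apply H'; [assumption|lra].
Qed.

Lemma small_and (P Q : R -> Prop) :
  (exists e, 0 < e /\ forall x, 0 < x <= e -> P x) -> (exists e, 0 < e /\ forall x, 0 < x <= e -> Q x) ->
  exists e, 0 < e /\ forall x, 0 < x <= e -> P x /\ Q x.
Proof.
  intros [e [He H]] [e' [He' H']]. exists (Rmin e e'). split; [now apply Rmin_pos|].
  intros x Hx. assert (x <= e /\ x <= e') by (generalize (Rmin_l e e') (Rmin_r e e'); lra).
  split; [apply H|apply H']; lra.
Qed.

Lemma small_quadratic a b c : 0 < a -> exists e, 0 < e /\ forall x, 0 < x <= e -> 0 < a + b * x + c * (x * x).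
Proof.
  intros Ha. set (K := Rabs b + Rabs c + 1).
  assert (HK : 0 < K) by (unfold K; generalize (Rabs_pos b) (Rabs_pos c); lra).
  exists (Rmin 1 (a / (2 * K))). split; [apply Rmin_pos; [lra|apply Rdiv_lt_0_compat; lra]|].
  intros x [Hx0 Hx]. assert (H1 : x <= 1) by (eapply Rle_trans; [exact Hx|apply Rmin_l]).
  assert (H2 : x <= a / (2 * K)) by (eapply Rle_trans; [exact Hx|apply Rmin_r]).
  apply Rmult_le_compat_r with (r := 2 * K) in H2; [|lra].
  replace (a / (2 * K) * (2 * K)) with a in H2 by (field; lra).
  assert (Hb : - Rabs b * x <= b * x) by (apply Rmult_le_compat_r; [lra|]; generalize (Rle_abs (- b)); rewrite Rabs_Ropp; lra).
  assert (Hc : - Rabs c * (x * x) <= c * (x * x)) by (apply Rmult_le_compat_r; [nra|]; generalize (Rle_abs (- c)); rewrite Rabs_Ropp; lra).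
  assert (Rabs c * (x * x) <= Rabs c * x) by (apply Rmult_le_compat_l; [apply Rabs_pos|nra]).
  unfold K in *. nra.
Qed.

Lemma small_lt a : 0 < a -> exists e, 0 < e /\ forall x, 0 < x <= e -> x < a.
Proof. intros Ha. exists (a / 2). split; [lra|]. intros; lra. Qed.

Lemma small_mul_lt a b : 0 < a -> exists e, 0 < e /\ forall x, 0 < x <= e -> x * b < a.
Proof.
  intros Ha. destruct (small_quadratic a (- b) 0 Ha) as [e [He H]]. exists e. split; [assumption|].
  intros x Hx. specialize (H x Hx). lra.
Qed.

Lemma unit_dir_scal (u : C) : u <> 0%C -> unit_dir u = (RtoC (/ Cmod u) * u)%C.
Proof.
  intros Hu. assert (H := proj1 (Cmod_gt_0 _) Hu). unfold unit_dir. rewrite RtoC_inv by lra.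
  field. intros K; apply RtoC_inj in K; lra.
Qed.

Lemma unit_dir_mod (u : C) : u <> 0%C -> Cmod (unit_dir u) = 1.
Proof.
  intros Hu. assert (H := proj1 (Cmod_gt_0 _) Hu). rewrite unit_dir_scal by assumption.
  rewrite Cmod_mult, Cmod_R, Rabs_right; [field; lra|]. apply Rle_ge. left. now apply Rinv_0_lt_compat.
Qed.

Lemma cross_scal_l r u v : cross (RtoC r * u) v = r * cross u v.
Proof. unfold cross. simpl. ring. Qed.

Lemma cross_scal_r r u v : cross u (RtoC r * v) = r * cross u v.
Proof. unfold cross. simpl. ring. Qed.

Lemma cross_opp_l u x : cross (- u) x = - cross u x.
Proof. unfold cross. simpl. ring. Qed.

Lemma cross_anti u x : cross u x = - cross x u.
Proof. unfold cross. simpl. ring. Qed.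

Lemma cross_self u : cross u u = 0.
Proof. unfold cross. simpl. ring. Qed.

Lemma cross_ne_l u v : 0 < cross u v -> u <> 0%C.
Proof. apply cross_pos_ne. Qed.

Lemma cross_ne_r u v : 0 < cross u v -> v <> 0%C.
Proof. intros H ->. unfold cross in H. simpl in H. lra. Qed.

Section Bisector.
Variables (e1 e2 : C).
Hypotheses (U1 : Cmod e1 = 1) (U2 : Cmod e2 = 1) (K : 0 < cross e1 e2).
Let d := unit_dir (- (e1 + e2)).

Lemma bis_sum_ne : (- (e1 + e2))%C <> 0%C.
Proof.
  intros H. assert (E : e2 = (- e1)%C) by (replace e2 with (- (- (e1 + e2)) - e1)%C by ring; rewrite H; ring).
  rewrite E in K. rewrite cross_anti, cross_opp_l, cross_self in K. lra.
Qed.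

Lemma bis_eq : exists r, 0 < r /\ d = (RtoC (- r) * (e1 + e2))%C.
Proof.
  exists (/ Cmod (- (e1 + e2))). split.
  - apply Rinv_0_lt_compat, Cmod_gt_0, bis_sum_ne.
  - unfold d. rewrite unit_dir_scal by apply bis_sum_ne. rewrite RtoC_opp. ring.
Qed.

Lemma bis_signs : Re (e1 * Cconj d) < 0 /\ Re (e2 * Cconj d) < 0 /\ 0 < Im (e1 * Cconj d) /\ Im (e2 * Cconj d) < 0.
Proof.
  destruct bis_eq as [r [Hr ->]].
  assert (N1 := Cmod_sq e1). assert (N2 := Cmod_sq e2). rewrite U1 in N1. rewrite U2 in N2.
  unfold cross in K. destruct e1 as [x1 y1], e2 as [x2 y2]. simpl in *.
  assert (Dot : 0 < 1 + (x1 * x2 + y1 * y2)) by nra.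
  assert (Kp : 0 < x1 * y2 - y1 * x2) by lra.
  assert (R1 := Rmult_lt_0_compat _ _ Hr Dot). assert (R2 := Rmult_lt_0_compat _ _ Hr Kp).
  repeat split; nra.
Qed.

(** A direction in the sector spanned by [e1] and [e2] is a combination of them with positive
    coefficients, up to the factor [cross e1 e2 > 0]; both lie in the open half-plane opposite
    to [d]. *)
Lemma bis_sector u : 0 < cross e1 u -> 0 < cross u e2 -> Re (u * Cconj d) < 0.
Proof.
  intros H1 H2. destruct bis_signs as [B1 [B2 _]].
  assert (E : cross e1 e2 * Re (u * Cconj d) = cross u e2 * Re (e1 * Cconj d) + cross e1 u * Re (e2 * Cconj d)).
  { unfold cross. simpl. ring. }
  nra.
Qed.
End Bisector.

Section Polygon.
Variables (m : nat) (w : nat -> C).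
Hypothesis Hpoly : convex_polygon m w.

Let Om := polygon_region m w.
Let nx := next m.
Let pv := prev m.
Let sd := side m w.
(** The distance from the line of side [k], multiplied by the length of the side and positive on
    the side of the polygon. *)
Definition height (k : nat) (z : C) : R := cross (side m w k) (z - w k).
Let d := exterior_bisector m w.
(** The coordinate that takes the corner to 0 and the exterior bisector to the positive real
    axis. *)
Definition ccoord (k : nat) (z : C) : C := ((z - w k) * Cconj (exterior_bisector m w k))%C.
(** The centroid of three corners is the handiest interior point. *)
Definition center : C := ((w 0%nat + w 1%nat + w 2%nat) / 3)%C.

Lemma three_corners : (3 <= m)%nat.
Proof. apply Hpoly. Qed.

Lemma next_cases k : (k < m)%nat -> (k + 1 < m /\ nx k = k + 1)%nat \/ (k + 1 = m /\ nx k = 0)%nat.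
Proof.
  intros Hk. destruct (Nat.eq_dec (k + 1) m) as [E|E].
  - right. split; [assumption|]. unfold nx, next. rewrite E. apply Nat.Div0.mod_same.
  - left. split; [lia|]. unfold nx, next. apply Nat.mod_small. lia.
Qed.

Lemma prev_cases k : (k < m)%nat -> (0 < k /\ pv k = k - 1)%nat \/ (k = 0 /\ pv k = m - 1)%nat.
Proof.
  intros Hk. destruct k as [|k].
  - right. split; [reflexivity|]. unfold pv, prev. rewrite Nat.mod_small; lia.
  - left. split; [lia|]. unfold pv, prev. replace (S k + (m - 1))%nat with (k + 1 * m)%nat by lia.
    rewrite Nat.Div0.mod_add. rewrite Nat.mod_small; lia.
Qed.

Lemma next_lt k : (k < m)%nat -> (nx k < m)%nat.
Proof. intros Hk. generalize three_corners. destruct (next_cases k Hk); lia. Qed.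

Lemma prev_lt k : (k < m)%nat -> (pv k < m)%nat.
Proof. intros Hk. generalize three_corners. destruct (prev_cases k Hk); lia. Qed.

Lemma next_prev k : (k < m)%nat -> nx (pv k) = k.
Proof.
  intros Hk. assert (H3 := three_corners). assert (Hp := prev_lt k Hk).
  destruct (prev_cases k Hk); destruct (next_cases (pv k) Hp); lia.
Qed.

Lemma prev_next k : (k < m)%nat -> pv (nx k) = k.
Proof.
  intros Hk. assert (H3 := three_corners). assert (Hp := next_lt k Hk).
  destruct (next_cases k Hk); destruct (prev_cases (nx k) Hp); lia.
Qed.

Lemma next_ne k : (k < m)%nat -> nx k <> k.
Proof. intros Hk. generalize three_corners. destruct (next_cases k Hk); lia. Qed.

Lemma prev_ne k : (k < m)%nat -> pv k <> k.
Proof. intros Hk. generalize three_corners. destruct (prev_cases k Hk); lia. Qed.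

Lemma prev_ne_next k : (k < m)%nat -> pv k <> nx k.
Proof. intros Hk. generalize three_corners. destruct (prev_cases k Hk); destruct (next_cases k Hk); lia. Qed.

Lemma height_seg k a b t : height k (seg a b t) = (1 - t) * height k a + t * height k b.
Proof. unfold height. rewrite seg_minus. apply cross_seg. Qed.

Lemma height_self k : height k (w k) = 0.
Proof. unfold height, cross. simpl. ring. Qed.

Lemma height_next k : height k (w (nx k)) = 0.
Proof. unfold height. apply cross_self. Qed.

Lemma height_pos k j : (k < m)%nat -> (j < m)%nat -> j <> k -> j <> nx k -> 0 < height k (w j).
Proof. intros. now apply Hpoly. Qed.

Lemma height_nonneg k j : (k < m)%nat -> (j < m)%nat -> 0 <= height k (w j).
Proof.
  intros Hk Hj. destruct (Nat.eq_dec j k) as [->|N1]; [rewrite height_self; lra|].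
  destruct (Nat.eq_dec j (nx k)) as [->|N2]; [rewrite height_next; lra|]. left. now apply height_pos.
Qed.

Lemma corners_distinct j k : (j < m)%nat -> (k < m)%nat -> j <> k -> w j <> w k.
Proof.
  intros Hj Hk N E. destruct (Nat.eq_dec j (nx k)) as [E2|N2].
  - assert (X := height_pos j (pv j) Hj (prev_lt j Hj) (prev_ne j Hj) (prev_ne_next j Hj)).
    rewrite E2 in X. rewrite (prev_next k Hk) in X. rewrite <- E2, <- E, height_self in X. lra.
  - assert (X := height_pos k j Hk Hj N N2). rewrite E, height_self in X. lra.
Qed.

Lemma height_comb3 k x y z a b c : x + y + z = 1 ->
  height k (RtoC x * a + RtoC y * b + RtoC z * c) = x * height k a + y * height k b + z * height k c.
Proof. intros H. unfold height, cross. simpl. replace x with (1 - y - z) by lra. ring. Qed.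

(** The heights over side [k] vanish at no more than two corners, so that one of three distinct
    corners contributes a positive amount. *)
Lemma comb3_region i j l x y z : (i < m)%nat -> (j < m)%nat -> (l < m)%nat -> i <> j -> i <> l -> j <> l ->
  0 < x -> 0 < y -> 0 < z -> x + y + z = 1 -> Om (RtoC x * w i + RtoC y * w j + RtoC z * w l)%C.
Proof.
  intros Hi Hj Hl Nij Nil Njl Hx Hy Hz E k Hk. fold (height k (RtoC x * w i + RtoC y * w j + RtoC z * w l)).
  rewrite height_comb3 by assumption.
  assert (A1 := height_nonneg k i Hk Hi). assert (A2 := height_nonneg k j Hk Hj). assert (A3 := height_nonneg k l Hk Hl).
  assert (0 <= x * height k (w i)) by (apply Rmult_le_pos; lra).
  assert (0 <= y * height k (w j)) by (apply Rmult_le_pos; lra).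
  assert (0 <= z * height k (w l)) by (apply Rmult_le_pos; lra).
  assert (C : (i <> k /\ i <> nx k) \/ (j <> k /\ j <> nx k) \/ (l <> k /\ l <> nx k)) by lia.
  destruct C as [[P Q]|[[P Q]|[P Q]]].
  - assert (0 < x * height k (w i)) by (apply Rmult_lt_0_compat; [lra|now apply height_pos]). lra.
  - assert (0 < y * height k (w j)) by (apply Rmult_lt_0_compat; [lra|now apply height_pos]). lra.
  - assert (0 < z * height k (w l)) by (apply Rmult_lt_0_compat; [lra|now apply height_pos]). lra.
Qed.

Lemma center_region : Om center.
Proof.
  assert (H3 := three_corners).
  replace center with (RtoC (1/3) * w 0%nat + RtoC (1/3) * w 1%nat + RtoC (1/3) * w 2%nat)%C.
  - apply comb3_region; try lia; lra.
  - unfold center. rewrite RtoC_div by lra. field.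
Qed.

Lemma region_convex : convex Om.
Proof.
  intros a b Ha Hb t Ht k Hk. fold (height k (seg a b t)). rewrite height_seg.
  specialize (Ha k Hk). specialize (Hb k Hk). fold (height k a) in Ha. fold (height k b) in Hb.
  destruct (Req_dec t 0) as [->|]; [lra|].
  assert (0 <= (1 - t) * height k a) by (apply Rmult_le_pos; lra).
  assert (0 < t * height k b) by (apply Rmult_lt_0_compat; lra). lra.
Qed.

Lemma height_diff k x y : height k x - height k y = cross (side m w k) (x - y).
Proof. unfold height, cross. simpl. ring. Qed.

Lemma cross_le u v : Rabs (cross u v) <= Cmod u * Cmod v.
Proof. unfold cross. eapply Rle_trans; [apply im_le_Cmod|]. now rewrite Cmod_mult, Cmod_conj. Qed.

Lemma region_open : openC Om.
Proof.
  intros x Hx.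
  destruct (unif_small m (fun k e => forall y, Cmod (y - x) < e -> 0 < height k y)) as [e [He H]].
  - intros k Hk. specialize (Hx k Hk). fold (height k x) in Hx.
    set (s := Cmod (side m w k)). assert (Hs : 0 <= s) by apply Cmod_ge_0.
    exists (height k x / (s + 1)). split; [apply Rdiv_lt_0_compat; lra|].
    intros e [He1 He2] y Hy. assert (B := cross_le (side m w k) (y - x)). rewrite <- height_diff in B. fold s in B.
    apply Rmult_le_compat_r with (r := s + 1) in He2; [|lra].
    replace (height k x / (s + 1) * (s + 1)) with (height k x) in He2 by (field; lra).
    apply Rabs_le_between in B. generalize (Cmod_ge_0 (y - x)). nra.
  - exists e. split; [assumption|]. intros y Hy k Hk. now apply (H k Hk).
Qed.

Let E1 k := unit_dir (w (nx k) - w k).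
Let E2 k := unit_dir (w (pv k) - w k).

Lemma side_prev_cross k : (k < m)%nat -> 0 < cross (w (nx k) - w k) (w (pv k) - w k).
Proof.
  intros Hk. apply (height_pos k (pv k)); try assumption.
  - now apply prev_lt. - now apply prev_ne. - now apply prev_ne_next.
Qed.

Lemma ext_bis_eq k : exterior_bisector m w k = unit_dir (- (E1 k + E2 k)).
Proof. reflexivity. Qed.

Lemma edge_dirs k : (k < m)%nat -> exists a b, 0 < a /\ 0 < b /\ E1 k = (RtoC a * (w (nx k) - w k))%C /\
  E2 k = (RtoC b * (w (pv k) - w k))%C /\ Cmod (E1 k) = 1 /\ Cmod (E2 k) = 1 /\ 0 < cross (E1 k) (E2 k).
Proof.
  intros Hk. assert (H := side_prev_cross k Hk).
  assert (N1 := cross_ne_l _ _ H). assert (N2 := cross_ne_r _ _ H).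
  exists (/ Cmod (w (nx k) - w k)), (/ Cmod (w (pv k) - w k)).
  assert (P1 := Rinv_0_lt_compat _ (proj1 (Cmod_gt_0 _) N1)).
  assert (P2 := Rinv_0_lt_compat _ (proj1 (Cmod_gt_0 _) N2)).
  repeat split; try assumption.
  - now apply unit_dir_scal. - now apply unit_dir_scal. - now apply unit_dir_mod. - now apply unit_dir_mod.
  - unfold E1, E2. rewrite !unit_dir_scal, cross_scal_l, cross_scal_r by assumption.
    apply Rmult_lt_0_compat; [assumption|]. now apply Rmult_lt_0_compat.
Qed.

Lemma d_unit k : (k < m)%nat -> Cmod (exterior_bisector m w k) = 1.
Proof.
  intros Hk. destruct (edge_dirs k Hk) as [a [b [Ha [Hb [H1 [H2 [U1 [U2 K]]]]]]]].
  rewrite ext_bis_eq. apply unit_dir_mod. now apply bis_sum_ne.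
Qed.

Lemma ccoord_region k z : (k < m)%nat -> Om z -> Re (ccoord k z) < 0.
Proof.
  intros Hk Hz. destruct (edge_dirs k Hk) as [a [b [Ha [Hb [H1 [H2 [U1 [U2 K]]]]]]]].
  unfold ccoord. rewrite ext_bis_eq. apply bis_sector; try assumption.
  - rewrite H1, cross_scal_l. apply Rmult_lt_0_compat; [assumption|]. apply (Hz k Hk).
  - rewrite H2, cross_scal_r. apply Rmult_lt_0_compat; [assumption|].
    assert (H := Hz (pv k) (prev_lt k Hk)). unfold side in H. fold nx in H. rewrite next_prev in H by assumption.
    replace (cross (z - w k) (w (pv k) - w k)) with (cross (w k - w (pv k)) (z - w (pv k))); [assumption|].
    unfold cross. simpl. ring.
Qed.

Lemma ccoord_next k : (k < m)%nat -> Re (ccoord k (w (nx k))) < 0 /\ 0 < Im (ccoord k (w (nx k))).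
Proof.
  intros Hk. destruct (edge_dirs k Hk) as [a [b [Ha [Hb [H1 [H2 [U1 [U2 K]]]]]]]].
  destruct (bis_signs _ _ U1 U2 K) as [B1 [B2 [B3 B4]]].
  rewrite <- ext_bis_eq in *. unfold ccoord. rewrite H1 in B1, B3.
  set (v := Cconj (exterior_bisector m w k)) in *. set (A := (w (nx k) - w k)%C) in *.
  rewrite <- Cmult_assoc in B1, B3. set (Av := (A * v)%C) in *.
  unfold Re, Im in *. simpl in *. split; nra.
Qed.

Lemma ccoord_prev k : (k < m)%nat -> Re (ccoord k (w (pv k))) < 0 /\ Im (ccoord k (w (pv k))) < 0.
Proof.
  intros Hk. destruct (edge_dirs k Hk) as [a [b [Ha [Hb [H1 [H2 [U1 [U2 K]]]]]]]].
  destruct (bis_signs _ _ U1 U2 K) as [B1 [B2 [B3 B4]]].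
  rewrite <- ext_bis_eq in *. unfold ccoord. rewrite H2 in B2, B4.
  set (v := Cconj (exterior_bisector m w k)) in *. set (A := (w (pv k) - w k)%C) in *.
  rewrite <- Cmult_assoc in B2, B4. set (Av := (A * v)%C) in *.
  unfold Re, Im in *. simpl in *. split; nra.
Qed.

(** The backward bisector enters the polygon: its height over the two adjacent sides grows
    linearly, and the other sides are at positive distance from the corner. *)
Lemma bis_inward k : (k < m)%nat -> exists e, 0 < e /\ forall x, 0 < x <= e ->
  Om (w k - RtoC x * exterior_bisector m w k)%C.
Proof.
  intros Hk. destruct (edge_dirs k Hk) as [a [b [Ha [Hb [H1 [H2 [U1 [U2 K]]]]]]]].
  destruct (bis_eq _ _ K) as [r [Hr Hd]]. rewrite <- ext_bis_eq in Hd.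
  destruct (small_mul_lt 1 (r * a + r * b)) as [e [He H]]; [lra|].
  exists e. split; [assumption|]. intros x Hx. specialize (H x Hx).
  rewrite Hd, H1, H2.
  assert (0 < x * (r * a)) by (apply Rmult_lt_0_compat; [lra|nra]).
  assert (0 < x * (r * b)) by (apply Rmult_lt_0_compat; [lra|nra]).
  replace (w k - RtoC x * (RtoC (- r) * (RtoC a * (w (nx k) - w k) + RtoC b * (w (pv k) - w k))))%C with
    (RtoC (1 - x * (r * a + r * b)) * w k + RtoC (x * (r * a)) * w (nx k) + RtoC (x * (r * b)) * w (pv k))%C.
  - apply comb3_region; try lra; try assumption.
    + now apply next_lt. + now apply prev_lt.
    + intros E. now apply (next_ne k Hk). + intros E. now apply (prev_ne k Hk).
    + intros E. now apply (prev_ne_next k Hk).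
  - rewrite RtoC_minus, !RtoC_mult, RtoC_plus, !RtoC_mult, RtoC_opp. ring.
Qed.
End Polygon.

(** * Separation and the constancy of winding integrals *)

Definition half_plane_form (nu q z : C) : R := Re (Cconj nu * (z - q))%C.

Lemma half_plane_form_seg nu q a b t : half_plane_form nu q (seg a b t) = (1 - t) * half_plane_form nu q a + t * half_plane_form nu q b.
Proof. unfold half_plane_form, seg. simpl. ring. Qed.

Lemma half_plane_form_diff nu q x y : half_plane_form nu q x - half_plane_form nu q y <= Cmod nu * Cmod (x - y).
Proof.
  replace (half_plane_form nu q x - half_plane_form nu q y) with (Re (Cconj nu * (x - y))%C) by (unfold half_plane_form; simpl; ring).
  eapply Rle_trans; [apply Rle_abs|]. eapply Rle_trans; [apply re_le_Cmod|]. rewrite Cmod_mult, Cmod_conj. lra.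
Qed.

Definition separated (Om : C -> Prop) (a b : C) : Prop := exists nu q,
  (forall z, Om z -> 0 < half_plane_form nu q z) /\ half_plane_form nu q a <= 0 /\ half_plane_form nu q b <= 0.

(** The gap [eta] is what makes polynomial approximation geometric; the legs, which touch the
    polygon at a corner, only satisfy [separated]. *)
Definition well_separated (Om : C -> Prop) (a b : C) : Prop := exists nu q eta, 0 < eta /\
  (forall z, Om z -> 0 < half_plane_form nu q z) /\ half_plane_form nu q a <= - eta /\ half_plane_form nu q b <= - eta.

Lemma well_separated_separated Om a b : well_separated Om a b -> separated Om a b.
Proof. intros [nu [q [e [He [H1 [H2 H3]]]]]]. exists nu, q. repeat split; auto; lra. Qed.

Lemma separated_sym Om a b : separated Om a b -> separated Om b a.
Proof. intros [nu [q [H1 [H2 H3]]]]. exists nu, q. auto. Qed.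

Lemma separated_avoid Om a b z x : separated Om a b -> Om z -> segset a b x -> x <> z.
Proof.
  intros [nu [q [H1 [H2 H3]]]] Hz [t [Ht ->]] E. specialize (H1 z Hz). rewrite <- E, half_plane_form_seg in H1.
  assert ((1 - t) * half_plane_form nu q a <= 0) by nra. assert (t * half_plane_form nu q b <= 0) by nra. lra.
Qed.

Lemma separated_dist (Om : C -> Prop) a b u v : separated Om a b -> Om u -> Om v -> exists e, 0 < e /\
  forall x y, segset a b x -> segset u v y -> e <= Cmod (x - y).
Proof.
  intros [nu [q [H1 [H2 H3]]]] Hu Hv. apply H1 in Hu. apply H1 in Hv.
  set (h := Rmin (half_plane_form nu q u) (half_plane_form nu q v)). assert (Hh : 0 < h) by now apply Rmin_pos.
  assert (Hm := Cmod_ge_0 nu).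
  exists (h / (Cmod nu + 1)). split; [apply Rdiv_lt_0_compat; lra|].
  intros x y [t [Ht ->]] [r [Hr ->]].
  assert (A : half_plane_form nu q (seg a b t) <= 0) by (rewrite half_plane_form_seg; nra).
  assert (B : h <= half_plane_form nu q (seg u v r)).
  { rewrite half_plane_form_seg. assert (h <= half_plane_form nu q u) by apply Rmin_l. assert (h <= half_plane_form nu q v) by apply Rmin_r. nra. }
  assert (D := half_plane_form_diff nu q (seg u v r) (seg a b t)). rewrite Cmod_minus_sym in D.
  apply Rmult_le_reg_r with (Cmod nu + 1); [lra|].
  replace (h / (Cmod nu + 1) * (Cmod nu + 1)) with h by (field; lra).
  generalize (Cmod_ge_0 (seg a b t - seg u v r)). nra.
Qed.

(** Differentiability of [A] with derivative [B], in the uniform form of a quadratic remainder,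
    which is stable under finite sums and lets the mean value argument run along a whole
    segment. *)
Definition quad_expansion (S : C -> Prop) (A B : C -> C) : Prop := exists K, 0 <= K /\
  forall x y, S x -> S y -> Cmod (A x - A y - (x - y) * B y) <= K * (Cmod (x - y) * Cmod (x - y)).

Lemma quad_expansion_plus S A B A' B' : quad_expansion S A B -> quad_expansion S A' B' -> quad_expansion S (fun x => (A x + A' x)%C) (fun x => (B x + B' x)%C).
Proof.
  intros [K [HK H]] [K' [HK' H']]. exists (K + K'). split; [lra|]. intros x y Sx Sy.
  specialize (H x y Sx Sy). specialize (H' x y Sx Sy).
  replace (A x + A' x - (A y + A' y) - (x - y) * (B y + B' y))%C with
    ((A x - A y - (x - y) * B y) + (A' x - A' y - (x - y) * B' y))%C by ring.
  eapply Rle_trans; [apply Cmod_triangle|]. lra.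
Qed.

Lemma quad_expansion_csum S n (A B : nat -> C -> C) : (forall i, (i < n)%nat -> quad_expansion S (A i) (B i)) ->
  quad_expansion S (fun x => csum n (fun i => A i x)) (fun x => csum n (fun i => B i x)).
Proof.
  induction n as [|n IH]; intros H.
  - exists 0. split; [lra|]. intros x y _ _. simpl. replace (0 - 0 - (x - y) * 0)%C with (RtoC 0) by ring.
    rewrite Cmod_0. lra.
  - simpl. apply quad_expansion_plus; [apply IH; intros; apply H; lia|apply H; lia].
Qed.

(** Cutting the segment into [N] equal steps bounds [|A v - A u|] by [N] times [K (|v - u| /
    N)^2]. *)
Lemma quad_expansion_const u v A B : quad_expansion (segset u v) A B -> (forall y, segset u v y -> B y = 0%C) -> A u = A v.
Proof.
  intros [K [HK H]] HB.
  set (c := Cmod (v - u)). assert (Hc : 0 <= c) by apply Cmod_ge_0.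
  assert (Step : forall N, (1 <= N)%nat -> Cmod (A v - A u) <= K * c * c / INR N).
  { intros N HN. assert (HNp : 0 < INR N) by (apply lt_0_INR; lia).
    assert (P : forall i, (i <= N)%nat -> Cmod (A (seg u v (INR i / INR N)) - A u) <= INR i * (K * (c / INR N * (c / INR N)))).
    { induction i as [|i IH]; intros Hi.
      - replace (INR 0 / INR N) with 0 by (change (INR 0) with 0; unfold Rdiv; ring).
        rewrite seg_0. replace (A u - A u)%C with (RtoC 0) by ring. rewrite Cmod_0. simpl. lra.
      - assert (Hr : forall j, (j <= N)%nat -> segset u v (seg u v (INR j / INR N))).
        { intros j Hj. exists (INR j / INR N). split; [|reflexivity].
          split; [apply Rdiv_le_0_compat; [apply pos_INR|assumption]|].
          apply Rmult_le_reg_r with (INR N); [assumption|].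
          replace (INR j / INR N * INR N) with (INR j) by (field; lra). rewrite Rmult_1_l. now apply le_INR. }
        specialize (IH ltac:(lia)).
        assert (Q := H _ _ (Hr (S i) Hi) (Hr i ltac:(lia))). rewrite HB in Q by (apply Hr; lia).
        rewrite Cmod_seg_diff in Q. fold c in Q.
        replace (INR (S i) / INR N - INR i / INR N) with (/ INR N) in Q by (rewrite S_INR; field; lra).
        rewrite Rabs_right in Q by (apply Rle_ge; left; now apply Rinv_0_lt_compat).
        replace (A (seg u v (INR (S i) / INR N)) - A u)%C with
          ((A (seg u v (INR (S i) / INR N)) - A (seg u v (INR i / INR N)) - (seg u v (INR (S i) / INR N) - seg u v (INR i / INR N)) * 0)
            + (A (seg u v (INR i / INR N)) - A u))%C by ring.
        eapply Rle_trans; [apply Cmod_triangle|].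
        replace (/ INR N * c) with (c / INR N) in Q by (unfold Rdiv; ring).
        eapply Rle_trans; [apply Rplus_le_compat; [exact Q|exact IH]|]. rewrite S_INR. right. ring. }
    specialize (P N (le_n N)). replace (INR N / INR N) with 1 in P by (field; lra). rewrite seg_1 in P.
    eapply Rle_trans; [exact P|]. right. field. lra. }
  symmetry. assert (Z : (A v - A u)%C = 0%C).
  { apply Cmod_eq_0. apply Rle_antisym; [|apply Cmod_ge_0]. apply Rnot_lt_le. intros L.
    assert (Hp : 0 <= K * c * c) by (repeat apply Rmult_le_pos; lra).
    destruct (nfloor_ex (K * c * c / Cmod (A v - A u))) as [N [_ HN]]; [apply Rdiv_le_0_compat; lra|].
    specialize (Step (S N) ltac:(lia)). rewrite S_INR in Step.
    assert (0 < INR N + 1) by (generalize (pos_INR N); lra).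
    apply Rmult_lt_compat_r with (r := Cmod (A v - A u)) in HN; [|assumption].
    replace (K * c * c / Cmod (A v - A u) * Cmod (A v - A u)) with (K * c * c) in HN by (field; lra).
    apply Rmult_le_compat_r with (r := INR N + 1) in Step; [|lra].
    replace (K * c * c / (INR N + 1) * (INR N + 1)) with (K * c * c) in Step by (field; lra). lra. }
  replace (A v) with (A v - A u + A u)%C by ring. rewrite Z. ring.
Qed.

Definition kernel (z y : C) : C := (/ (y - z))%C.

Lemma seg_int_kernel_sq a b z : (forall y, segset a b y -> y <> z) ->
  seg_int (fun y => (kernel z y * kernel z y)%C) a b = (kernel z a - kernel z b)%C.
Proof.
  intros H.
  assert (Ck : cont_on (segset a b) (kernel z)) by (now apply cont_on_kernel).
  rewrite (seg_int_FTC (fun y => (- kernel z y)%C)); [ring|now apply cont_on_mult|].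
  intros x Hx. assert (N := Cminus_ne _ _ (H x Hx)).
  replace (kernel z x * kernel z x)%C with (- - (/ ((x - z) * (x - z))))%C by (unfold kernel; field; assumption).
  apply (cderiv_opp (kernel z)). apply (cderiv_shift Cinv). now apply cderiv_inv.
Qed.

(** Differentiation under the integral sign: [1/(y - z)^2] has the primitive [- 1/(y - z)] in
    [y]. *)
Lemma quad_expansion_seg Om a b u v : separated Om a b -> Om u -> Om v -> convex Om ->
  quad_expansion (segset u v) (fun z => seg_int (kernel z) a b) (fun z => (kernel z a - kernel z b)%C).
Proof.
  intros HS Hu Hv HO. destruct (separated_dist Om a b u v HS Hu Hv) as [e [He H]].
  assert (HOs : forall x, segset u v x -> Om x) by (intros x; now apply convex_segset).
  assert (Hinv : 0 < / e) by now apply Rinv_0_lt_compat.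
  exists (/ e * / e * / e * Cmod (b - a)). split.
  { repeat apply Rmult_le_pos; try lra. apply Cmod_ge_0. }
  intros x y Hx Hy.
  assert (Av : forall z, segset u v z -> forall p, segset a b p -> p <> z).
  { intros z Hz p Hp. apply (separated_avoid Om a b z p); auto. }
  assert (Ck : forall z, segset u v z -> cont_on (segset a b) (kernel z)) by (intros; apply cont_on_kernel; auto).
  rewrite <- seg_int_kernel_sq by auto.
  assert (Cq : cont_on (segset a b) (fun p => ((-(1)) * kernel y p)%C)) by (apply cont_on_mult; [apply cont_on_const|auto]).
  assert (Cq2 : cont_on (segset a b) (fun p => ((- (x - y)) * (kernel y p * kernel y p))%C)).
  { apply cont_on_mult; [apply cont_on_const|apply cont_on_mult; auto]. }
  replace (seg_int (kernel x) a b - seg_int (kernel y) a b - (x - y) * seg_int (fun p => (kernel y p * kernel y p)%C) a b)%C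
   with (seg_int (fun p => (kernel x p + (-(1)) * kernel y p + (- (x - y)) * (kernel y p * kernel y p))%C) a b).
  2:{ rewrite (seg_int_plus (fun p => (kernel x p + (-(1)) * kernel y p)%C)) by (auto; apply cont_on_plus; auto).
      rewrite (seg_int_plus (kernel x)) by auto. rewrite !seg_int_scal by (auto; apply cont_on_mult; auto). ring. }
  replace (/ e * / e * / e * Cmod (b - a) * (Cmod (x - y) * Cmod (x - y))) with
   ((/ e * / e * / e * (Cmod (x - y) * Cmod (x - y))) * Cmod (b - a)) by ring.
  apply seg_int_bound.
  - apply cont_on_plus; [apply cont_on_plus; auto|auto].
  - intros p Hp. assert (Nx := Cminus_ne _ _ (Av x Hx p Hp)). assert (Ny := Cminus_ne _ _ (Av y Hy p Hp)).
    replace (kernel x p + -(1) * kernel y p + - (x - y) * (kernel y p * kernel y p))%C with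
      ((x - y) * (x - y) * (/ (p - x) * / (p - y) * / (p - y)))%C by (unfold kernel; field; split; assumption).
    rewrite !Cmod_mult, !Cmod_inv by assumption.
    assert (B1 := H p x Hp Hx). assert (B2 := H p y Hp Hy).
    assert (I1 : / Cmod (p - x) <= / e) by (apply Rinv_le_contravar; assumption).
    assert (I2 : / Cmod (p - y) <= / e) by (apply Rinv_le_contravar; assumption).
    assert (J1 : 0 < / Cmod (p - x)) by (apply Rinv_0_lt_compat; lra).
    assert (J2 : 0 < / Cmod (p - y)) by (apply Rinv_0_lt_compat; lra).
    rewrite Rmult_comm. apply Rmult_le_compat_r; [apply Rmult_le_pos; apply Cmod_ge_0|].
    apply Rmult_le_compat; try lra; [apply Rmult_le_pos; lra|]. apply Rmult_le_compat; lra.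
Qed.

(** * The Cauchy representation over the deformed contour *)

Lemma convex_and U V : convex U -> convex V -> convex (fun x => U x /\ V x).
Proof. intros HU HV a b [A1 A2] [B1 B2] t Ht. split; auto. Qed.

Lemma open_and U V : openC U -> openC V -> openC (fun x => U x /\ V x).
Proof.
  intros HU HV x [Ux Vx]. destruct (HU x Ux) as [d1 [H1 K1]]. destruct (HV x Vx) as [d2 [H2 K2]].
  exists (Rmin d1 d2). split; [now apply Rmin_pos|]. intros y Hy.
  split; [apply K1|apply K2]; eapply Rlt_le_trans; try exact Hy; [apply Rmin_l|apply Rmin_r].
Qed.

Lemma disk_open c r : openC (disk c r).
Proof.
  intros x Hx. unfold disk in *. exists (r - Cmod (x - c)). split; [lra|].
  intros y Hy. generalize (Cmod_tri3 y x c). lra.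
Qed.

Lemma open_affine (L : C -> R) K : 0 <= K -> (forall x y, Rabs (L x - L y) <= K * Cmod (x - y)) -> openC (fun x => 0 < L x).
Proof.
  intros HK HL x Hx. exists (L x / (K + 1)). split; [apply Rdiv_lt_0_compat; lra|].
  intros y Hy. specialize (HL y x). apply Rmult_lt_compat_r with (r := K + 1) in Hy; [|lra].
  replace (L x / (K + 1) * (K + 1)) with (L x) in Hy by (field; lra).
  apply Rabs_le_between in HL. generalize (Cmod_ge_0 (y - x)). nra.
Qed.

(** The continuations agree on the nonempty open set [W] intersected with [Om], hence on [W] by
    the identity theorem. *)
Lemma agree_on W Om F G a b : convex W -> openC W -> openC Om -> holo W F -> holo W G ->
  (forall y, W y -> Om y -> F y = G y) -> W a -> Om a -> W b -> F b = G b.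
Proof.
  intros CW OW OO HF HG He Wa Oa Wb.
  destruct (open_and _ _ OW OO a (conj Wa Oa)) as [e [Hep H]].
  assert (Z : (F b + - G b)%C = 0%C).
  { apply (identity_zero W (fun y => (F y + - G y)%C) a b e); try assumption.
    - intros x Wx. destruct (HF x Wx) as [l Hl]. destruct (HG x Wx) as [k Hk].
      exists (l + - k)%C. apply (cderiv_plus F (fun y => (- G y)%C)); [assumption|]. now apply cderiv_opp.
    - intros y Hy. destruct (H y Hy) as [Wy Oy]. rewrite He by assumption. ring. }
  replace (F b) with (F b + - G b + G b)%C by ring. rewrite Z. ring.
Qed.

Lemma cont_on_add_point V g p : openC V -> cont_on V g ->
  (forall e, 0 < e -> exists d, 0 < d /\ forall y, V y -> Cmod (y - p) < d -> Cmod (g y - g p) < e) ->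
  cont_on (fun x => V x \/ x = p) g.
Proof.
  intros OV Hg Hp x Hx e He.
  destruct (classic (x = p)) as [->|N].
  - destruct (Hp e He) as [d [Hd H]]. exists d. split; [assumption|]. intros y [Vy| ->] Hy; [now apply H|].
    replace (g p - g p)%C with (RtoC 0) by ring. now rewrite Cmod_0.
  - destruct Hx as [Vx|Ex]; [|contradiction].
    destruct (Hg x Vx e He) as [d [Hd H]]. destruct (OV x Vx) as [d' [Hd' H']].
    exists (Rmin d d'). split; [now apply Rmin_pos|]. intros y _ Hy.
    apply H; [apply H'|]; eapply Rlt_le_trans; try exact Hy; [apply Rmin_r|apply Rmin_l].
Qed.

Lemma dquot_cont_corner V F z c l p : openC V -> cont_on (fun x => V x \/ x = p) F -> p <> z ->
  cont_on V (dquot F z c l) -> cont_on (fun x => V x \/ x = p) (dquot F z c l).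
Proof.
  intros OV HF Npz Hc. apply cont_on_add_point; try assumption.
  intros e He.
  set (S := fun x => (V x \/ x = p) /\ x <> z).
  assert (HS : cont_on S (fun x => ((F x + - c) * / (x + - z))%C)).
  { apply cont_on_mult.
    - apply cont_on_plus; [|apply cont_on_const]. eapply cont_on_sub; [|exact HF]. intros x [H _]; exact H.
    - apply cont_on_inv.
      + apply cont_on_plus; [apply cont_on_id|apply cont_on_const].
      + intros x [_ N]. now apply Cminus_ne. }
  destruct (HS p (conj (or_intror eq_refl) Npz) e He) as [d [Hd H]].
  assert (Pz := proj1 (Cmod_gt_0 _) (Cminus_ne _ _ Npz)).
  exists (Rmin d (Cmod (p - z))). split; [now apply Rmin_pos|]. intros y Vy Hy.
  assert (Ny : y <> z).
  { intros ->. assert (Cmod (z - p) < Cmod (p - z)) by (eapply Rlt_le_trans; [exact Hy|apply Rmin_r]).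
    rewrite Cmod_minus_sym in H0. lra. }
  rewrite !dquot_ne by assumption. apply H; [split; [now left|assumption]|].
  eapply Rlt_le_trans; [exact Hy|apply Rmin_l].
Qed.

Section Contour.
Variables (m : nat) (w : nat -> C) (f : C -> C) (Fc : nat -> C -> C) (Fs : nat -> nat -> C -> C).
Variables (s R0 t0 eta tau : R) (n : nat).
Hypothesis Hpoly : convex_polygon m w.
Notation Om := (polygon_region m w).
Notation o := (center w).
Notation nx := (next m).
Notation d := (exterior_bisector m w).

(** The half-plane [tilt > 0] contains the leg direction [1 + sg i] and the inward direction -1,
    but no point of the slit; this is where the slope 2 comes from.  It also contains the side
    on the [sg] side of the corner. *)
Definition tilt (k : nat) (sg : R) (z : C) : R := sg * 2 * Im (ccoord m w k z) - Re (ccoord m w k z).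
(** A convex piece of the slit disk which contains one leg and one end of the strip along the
    adjacent side. *)
Definition half_disk (k : nat) (sg : R) (z : C) : Prop := disk (w k) s z /\ 0 < tilt k sg z.
Definition leg_end (k : nat) (sg : R) : C := (w k + RtoC R0 * ((1, sg) * d k))%C.
(** The points on the backward bisectors to which the corners are moved when the contour is
    deformed into the polygon. *)
Definition inset (k : nat) : C := (w k - RtoC R0 * d k)%C.
Definition node_time (i : nat) : R := t0 + INR i / INR (S n) * (1 - 2 * t0).
Definition side_pt (k : nat) (t : R) : C := seg (w k) (w (nx k)) t.
(** The negative parameter continues the segment from [o] beyond the side point. *)
Definition outer (k i : nat) : C := seg (side_pt k (node_time i)) o (- tau).
Definition inner (k i : nat) : C := seg (side_pt k (node_time i)) o tau.
(** The points lower than the centre over side [k]: convex, large enough for the insets and the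
    inner edge of the strip, and missing the centre, so that the kernel at the centre is
    holomorphic there. *)
Definition side_cap (k : nat) (z : C) : Prop := Om z /\ height m w k z < height m w k o.
Definition side_disk (k i : nat) : C -> Prop := disk (side_pt k (node_time i)) eta.

Hypotheses (Hs : 0 < s) (Hso : forall k, (k < m)%nat -> s <= Cmod (o - w k)).
Hypotheses (HR : 0 < R0) (HR2 : 2 * R0 < s)
  (HQ : forall k, (k < m)%nat -> Om (inset k) /\ height m w k (inset k) < height m w k o /\ height m w k (inset (nx k)) < height m w k o /\
     0 < cross (inset k - o) (inset (nx k) - inset k)).
Hypotheses (Ht0 : 0 < t0 < 1/2) (Ht0s : forall k, (k < m)%nat -> t0 * Cmod (side m w k) < s / 2).
Hypotheses (Heta : 0 < eta) (Hetao : forall k t, (k < m)%nat -> t0 <= t <= 1 - t0 -> eta <= Cmod (o - side_pt k t)).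
Hypotheses (Htau : 0 < tau < 1)
  (Htau2 : forall k t, (k < m)%nat -> 0 <= t <= 1 -> tau * Cmod (o - side_pt k t) < s / 2 /\ tau * Cmod (o - side_pt k t) < eta / 2)
  (Htau3 : forall k, (k < m)%nat -> 0 < tilt k 1 (seg (side_pt k t0) o tau) /\ 0 < tilt k 1 (seg (side_pt k t0) o (- tau)) /\
     0 < tilt (nx k) (-1) (seg (side_pt k (1 - t0)) o tau) /\ 0 < tilt (nx k) (-1) (seg (side_pt k (1 - t0)) o (- tau))).
Hypothesis (HN : forall k, (k < m)%nat -> Cmod (side m w k) / INR (S n) < eta / 2).

Lemma ccoord_seg k a b t : ccoord m w k (seg a b t) = seg (ccoord m w k a) (ccoord m w k b) t.
Proof. unfold ccoord, seg. ring. Qed.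

Lemma tilt_seg k sg a b t : tilt k sg (seg a b t) = (1 - t) * tilt k sg a + t * tilt k sg b.
Proof. unfold tilt. rewrite ccoord_seg. unfold seg. simpl. ring. Qed.

Lemma tilt_self k sg : tilt k sg (w k) = 0.
Proof. unfold tilt, ccoord. simpl. ring. Qed.

Lemma ccoord_dir k c : (k < m)%nat -> ccoord m w k (w k + c * d k) = c.
Proof.
  intros Hk. unfold ccoord. assert (H := Cmod2_conj (d k)). rewrite (d_unit m w Hpoly k Hk) in H.
  replace ((w k + c * d k - w k) * Cconj (d k))%C with (c * (d k * Cconj (d k)))%C by ring.
  rewrite <- H. rewrite RtoC_pow, Cpow_1_l. ring.
Qed.

Lemma ccoord_leg_end k sg : (k < m)%nat -> ccoord m w k (leg_end k sg) = (R0, R0 * sg).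
Proof.
  intros Hk. unfold leg_end. rewrite Cmult_assoc. rewrite ccoord_dir by assumption.
  apply injective_projections; simpl; ring.
Qed.

Lemma ccoord_inset k : (k < m)%nat -> ccoord m w k (inset k) = (- R0, 0).
Proof.
  intros Hk. unfold inset. replace (w k - RtoC R0 * d k)%C with (w k + (- RtoC R0) * d k)%C by ring.
  rewrite ccoord_dir by assumption. apply injective_projections; simpl; ring.
Qed.

Lemma Cmod_ccoord k z : (k < m)%nat -> Cmod (ccoord m w k z) = Cmod (z - w k).
Proof. intros Hk. unfold ccoord. rewrite Cmod_mult, Cmod_conj, (d_unit m w Hpoly k Hk). ring. Qed.

Lemma half_disk_convex k sg : convex (half_disk k sg).
Proof.
  apply convex_and; [apply disk_convex|]. intros a b Ha Hb t Ht. rewrite tilt_seg.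
  destruct (Req_dec t 0) as [->|]; [lra|].
  assert (0 <= (1 - t) * tilt k sg a) by (apply Rmult_le_pos; lra).
  assert (0 < t * tilt k sg b) by (apply Rmult_lt_0_compat; lra). lra.
Qed.

Lemma half_disk_open k sg : (k < m)%nat -> Rabs sg = 1 -> openC (half_disk k sg).
Proof.
  intros Hk Hsg. apply open_and; [apply disk_open|]. apply (open_affine _ 3); [lra|].
  intros x y.
  replace (tilt k sg x - tilt k sg y) with (sg * 2 * Im (ccoord m w k x - ccoord m w k y) + - Re (ccoord m w k x - ccoord m w k y))
    by (unfold tilt; simpl; ring).
  assert (E : Cmod (ccoord m w k x - ccoord m w k y) = Cmod (x - y)).
  { unfold ccoord. replace ((x - w k) * Cconj (d k) - (y - w k) * Cconj (d k))%C with ((x - y) * Cconj (d k))%C by ring.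
    rewrite Cmod_mult, Cmod_conj, (d_unit m w Hpoly k Hk). ring. }
  rewrite <- E. set (u := (ccoord m w k x - ccoord m w k y)%C).
  eapply Rle_trans; [apply Rabs_triang|]. rewrite Rabs_Ropp, !Rabs_mult, Hsg, (Rabs_right 2) by lra.
  generalize (re_le_Cmod u) (im_le_Cmod u). lra.
Qed.

Lemma half_disk_star k sg : forall x r, half_disk k sg x -> 0 < r <= 1 -> half_disk k sg (seg (w k) x r).
Proof.
  intros x r [H1 H2] Hr. split.
  - apply disk_convex; [now apply disk_center|assumption|lra].
  - rewrite tilt_seg, tilt_self. nra.
Qed.

Lemma half_disk_slit k sg z : (k < m)%nat -> half_disk k sg z -> slit_disk (w k) s (d k) z.
Proof.
  intros Hk [H1 H2]. split; [assumption|]. intros t Ht E. rewrite E in H2. unfold tilt in H2.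
  rewrite ccoord_dir in H2 by assumption. simpl in H2. lra.
Qed.

Lemma half_disk_inset k sg : (k < m)%nat -> half_disk k sg (inset k).
Proof.
  intros Hk. split.
  - unfold disk. rewrite <- Cmod_ccoord, ccoord_inset by assumption.
    apply Rle_lt_trans with R0; [|lra]. apply Cmod_le_sq; simpl; lra.
  - unfold tilt. rewrite ccoord_inset by assumption. simpl. lra.
Qed.

Lemma half_disk_leg_end k sg : (k < m)%nat -> sg * sg = 1 -> half_disk k sg (leg_end k sg).
Proof.
  intros Hk Hsg. split.
  - unfold disk. rewrite <- Cmod_ccoord, ccoord_leg_end by assumption.
    apply Rle_lt_trans with (2 * R0); [|lra]. apply Cmod_le_sq; simpl; [lra|].
    replace (R0 * R0 + R0 * sg * (R0 * sg)) with (R0 * R0 * (1 + sg * sg)) by ring. rewrite Hsg. nra.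
  - unfold tilt. rewrite ccoord_leg_end by assumption. simpl. nra.
Qed.

Lemma Sn_pos : 0 < INR (S n).
Proof. apply lt_0_INR. lia. Qed.

Lemma node_time_range i : (i <= S n)%nat -> t0 <= node_time i <= 1 - t0.
Proof.
  intros Hi. unfold node_time. assert (H := Sn_pos).
  assert (0 <= INR i / INR (S n) <= 1).
  { split; [apply Rdiv_le_0_compat; [apply pos_INR|assumption]|].
    apply Rmult_le_reg_r with (INR (S n)); [assumption|].
    replace (INR i / INR (S n) * INR (S n)) with (INR i) by (field; lra). rewrite Rmult_1_l. now apply le_INR. }
  nra.
Qed.

Lemma node_time_0 : node_time 0 = t0.
Proof. unfold node_time. change (INR 0) with 0. unfold Rdiv. ring. Qed.

Lemma node_time_end : node_time (S n) = 1 - t0.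
Proof. unfold node_time. generalize Sn_pos. intros. field. lra. Qed.

Lemma side_pt_rev k : (k < m)%nat -> side_pt k (1 - t0) = seg (w (nx k)) (w k) t0.
Proof. intros. unfold side_pt. now rewrite <- seg_rev. Qed.

Lemma start_in_disk k sg : (k < m)%nat -> Rabs sg = tau -> disk (w k) s (seg (side_pt k t0) o sg).
Proof.
  intros Hk Hsg. unfold disk.
  eapply Rle_lt_trans; [apply (Cmod_tri3 _ (side_pt k t0))|].
  assert (H1 : Cmod (seg (side_pt k t0) o sg - side_pt k t0) = tau * Cmod (o - side_pt k t0)).
  { replace (side_pt k t0) with (seg (side_pt k t0) o 0) at 2 by apply seg_0. rewrite Cmod_seg_diff.
    rewrite Rminus_0_r. now rewrite Hsg. }
  assert (H2 : Cmod (side_pt k t0 - w k) = t0 * Cmod (side m w k)).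
  { unfold side_pt. replace (w k) with (seg (w k) (w (nx k)) 0) at 2 by apply seg_0. rewrite Cmod_seg_diff.
    rewrite Rminus_0_r, Rabs_right by lra. reflexivity. }
  destruct (Htau2 k t0 Hk) as [H3 _]; [lra|]. specialize (Ht0s k Hk). lra.
Qed.

Lemma end_in_disk k sg : (k < m)%nat -> Rabs sg = tau -> disk (w (nx k)) s (seg (side_pt k (1 - t0)) o sg).
Proof.
  intros Hk Hsg. unfold disk.
  eapply Rle_lt_trans; [apply (Cmod_tri3 _ (side_pt k (1 - t0)))|].
  assert (H1 : Cmod (seg (side_pt k (1 - t0)) o sg - side_pt k (1 - t0)) = tau * Cmod (o - side_pt k (1 - t0))).
  { replace (side_pt k (1 - t0)) with (seg (side_pt k (1 - t0)) o 0) at 2 by apply seg_0. rewrite Cmod_seg_diff.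
    rewrite Rminus_0_r. now rewrite Hsg. }
  assert (H2 : Cmod (side_pt k (1 - t0) - w (nx k)) = t0 * Cmod (side m w k)).
  { unfold side_pt. replace (w (nx k)) with (seg (w k) (w (nx k)) 1) at 2 by apply seg_1. rewrite Cmod_seg_diff.
    replace (1 - t0 - 1) with (- t0) by ring. rewrite Rabs_Ropp, Rabs_right by lra. reflexivity. }
  destruct (Htau2 k (1 - t0) Hk) as [H3 _]; [lra|]. specialize (Ht0s k Hk). lra.
Qed.

Lemma Rabs_tau : Rabs tau = tau.
Proof. apply Rabs_right. lra. Qed.
Lemma Rabs_mtau : Rabs (- tau) = tau.
Proof. rewrite Rabs_Ropp. apply Rabs_tau. Qed.

Lemma half_disk_start k : (k < m)%nat -> half_disk k 1 (outer k 0) /\ half_disk k 1 (inner k 0).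
Proof.
  intros Hk. destruct (Htau3 k Hk) as [A [B _]]. unfold outer, inner. rewrite node_time_0.
  split; split; try assumption; apply start_in_disk; auto using Rabs_tau, Rabs_mtau.
Qed.

Lemma half_disk_end k : (k < m)%nat -> half_disk (nx k) (-1) (outer k (S n)) /\ half_disk (nx k) (-1) (inner k (S n)).
Proof.
  intros Hk. destruct (Htau3 k Hk) as [_ [_ [A B]]]. unfold outer, inner. rewrite node_time_end.
  split; split; try assumption; apply end_in_disk; auto using Rabs_tau, Rabs_mtau.
Qed.

Lemma side_disk_pt k i sg j : (k < m)%nat -> Rabs sg = tau -> (i <= S n)%nat -> (j = i \/ j = S i) -> (j <= S n)%nat ->
  side_disk k i (seg (side_pt k (node_time j)) o sg).
Proof.
  intros Hk Hsg Hi Hj Hj2. unfold side_disk, disk.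
  eapply Rle_lt_trans; [apply (Cmod_tri3 _ (side_pt k (node_time j)))|].
  assert (H1 : Cmod (seg (side_pt k (node_time j)) o sg - side_pt k (node_time j)) = tau * Cmod (o - side_pt k (node_time j))).
  { replace (side_pt k (node_time j)) with (seg (side_pt k (node_time j)) o 0) at 2 by apply seg_0. rewrite Cmod_seg_diff.
    rewrite Rminus_0_r. now rewrite Hsg. }
  assert (R1 := node_time_range j Hj2).
  destruct (Htau2 k (node_time j) Hk) as [_ H3]; [lra|].
  assert (H2 : Cmod (side_pt k (node_time j) - side_pt k (node_time i)) < eta / 2).
  { unfold side_pt. rewrite Cmod_seg_diff. specialize (HN k Hk). unfold side in HN. fold nx in HN.
    set (c := Cmod (w (nx k) - w k)) in *. assert (Hc : 0 <= c) by apply Cmod_ge_0.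
    assert (Hn := Sn_pos).
    destruct Hj as [->| ->].
    - replace (node_time i - node_time i) with 0 by ring. rewrite Rabs_R0. lra.
    - assert (E : node_time (S i) - node_time i = (1 - 2 * t0) / INR (S n)).
      { unfold node_time. rewrite (S_INR i). field. lra. }
      rewrite E. unfold Rdiv. rewrite Rabs_right by (apply Rle_ge, Rdiv_le_0_compat; lra).
      apply Rle_lt_trans with (c / INR (S n)); [|assumption].
      assert (Hi0 := Rinv_0_lt_compat _ Hn). unfold Rdiv.
      assert (0 <= c * / INR (S n)) by (apply Rmult_le_pos; lra).
      replace ((1 - 2 * t0) * / INR (S n) * c) with ((1 - 2 * t0) * (c * / INR (S n))) by ring. nra. }
  lra.
Qed.

Lemma side_pt_height k t j : (k < m)%nat -> (j < m)%nat -> 0 <= t <= 1 -> 0 <= height m w j (side_pt k t).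
Proof.
  intros Hk Hj Ht. unfold side_pt. rewrite height_seg.
  assert (A := height_nonneg m w Hpoly j k Hj Hk).
  assert (B := height_nonneg m w Hpoly j (nx k) Hj (next_lt m w Hpoly k Hk)).
  apply Rplus_le_le_0_compat; apply Rmult_le_pos; lra.
Qed.

Lemma side_pt_height_self k t : height m w k (side_pt k t) = 0.
Proof. unfold side_pt. rewrite height_seg, height_self, height_next. ring. Qed.

Lemma center_height k : (k < m)%nat -> 0 < height m w k o.
Proof. intros Hk. exact (center_region m w Hpoly k Hk). Qed.

Lemma inner_side_cap k i : (k < m)%nat -> (i <= S n)%nat -> side_cap k (inner k i).
Proof.
  intros Hk Hi. assert (Ho := center_height k Hk). assert (Ht := node_time_range i Hi). split.
  - intros j Hj. change (0 < height m w j (inner k i)). unfold inner. rewrite height_seg.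
    assert (A := side_pt_height k (node_time i) j Hk Hj ltac:(lra)). assert (B := center_height j Hj).
    assert (0 <= (1 - tau) * height m w j (side_pt k (node_time i))) by (apply Rmult_le_pos; lra).
    assert (0 < tau * height m w j o) by (apply Rmult_lt_0_compat; lra). lra.
  - unfold inner. rewrite height_seg, side_pt_height_self. nra.
Qed.

Lemma side_cap_convex k : convex (side_cap k).
Proof.
  apply convex_and; [now apply region_convex|]. intros a b Ha Hb t Ht. rewrite height_seg.
  destruct (Req_dec t 0) as [->|]; [lra|].
  assert ((1 - t) * height m w k a <= (1 - t) * height m w k o) by (apply Rmult_le_compat_l; lra).
  assert (t * height m w k b < t * height m w k o) by (apply Rmult_lt_compat_l; lra). lra.
Qed.

(** The functional [J] is left open because the same path is used for integrals of a function,
    for Cauchy integrals and for the winding integral. *)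
Definition contour_path (J : C -> C -> (C -> C) -> C) (Kc : nat -> C -> C) (Ks : nat -> nat -> C -> C) (k : nat) : C :=
  (J (w k) (leg_end k 1) (Kc k) + J (leg_end k 1) (outer k 0) (Kc k) + csum (S n) (fun i => J (outer k i) (outer k (S i)) (Ks k i))
   + J (outer k (S n)) (leg_end (nx k) (-1)) (Kc (nx k)) + J (leg_end (nx k) (-1)) (w (nx k)) (Kc (nx k)))%C.

(** The integrand is given by different functions on the parts of the contour; they have to
    agree with the interior one inside the polygon and with each other on the edges that the
    cells share. *)
Definition edges_agree (Kf : C -> C) (Kc : nat -> C -> C) (Ks : nat -> nat -> C -> C) : Prop :=
  (forall k y sg, (k < m)%nat -> (sg = 1 \/ sg = -1) -> Om y -> half_disk k sg y -> Kc k y = Kf y) /\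
  (forall k i y, (k < m)%nat -> (i <= n)%nat -> Om y -> side_disk k i y -> Ks k i y = Kf y) /\
  (forall k i y, (k < m)%nat -> (i < n)%nat -> segset (outer k (S i)) (inner k (S i)) y -> Ks k i y = Ks k (S i) y) /\
  (forall k y, (k < m)%nat -> segset (outer k 0) (inner k 0) y -> Ks k 0%nat y = Kc k y) /\
  (forall k y, (k < m)%nat -> segset (inner k (S n)) (outer k (S n)) y -> Ks k n y = Kc (nx k) y).

Definition local_closed (Kf : C -> C) (Kc : nat -> C -> C) (Ks : nat -> nat -> C -> C) : Prop :=
  (forall k, (k < m)%nat -> tri_closed (side_cap k) Kf) /\
  (forall k sg, (k < m)%nat -> (sg = 1 \/ sg = -1) -> tri_closed (half_disk k sg) (Kc k) /\ cont_on (fun x => half_disk k sg x \/ x = w k) (Kc k)) /\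
  (forall k i, (k < m)%nat -> (i <= n)%nat -> tri_closed (side_disk k i) (Ks k i)).

Lemma contour_side Kf Kc Ks k : edges_agree Kf Kc Ks -> local_closed Kf Kc Ks -> (k < m)%nat ->
  contour_path (fun a b g => seg_int g a b) Kc Ks k =
  (seg_int (Kc k) (w k) (inset k) + seg_int Kf (inset k) (inset (nx k)) + seg_int (Kc (nx k)) (inset (nx k)) (w (nx k)))%C.
Proof.
  intros [E1 [E2 [E3 [E4 E5]]]] [T1 [T2 T3]] Hk.
  assert (Hk' := next_lt m w Hpoly k Hk).
  destruct (HQ k Hk) as [Q1 [Q2 [Q3 _]]]. destruct (HQ (nx k) Hk') as [Q4 _].
  destruct (half_disk_start k Hk) as [X1 X2]. destruct (half_disk_end k Hk) as [X3 X4].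
  destruct (T2 k 1 Hk (or_introl eq_refl)) as [Tp Cp].
  destruct (T2 (nx k) (-1) Hk' (or_intror eq_refl)) as [Tm Cm].
  assert (Pp := half_disk_leg_end k 1 Hk ltac:(lra)). assert (Pm := half_disk_leg_end (nx k) (-1) Hk' ltac:(lra)).
  assert (Qp := half_disk_inset k 1 Hk). assert (Qm := half_disk_inset (nx k) (-1) Hk').
  unfold contour_path.
  apply (side_deform n (side_cap k) (half_disk k 1) (half_disk (nx k) (-1)) (side_disk k) Kf (Kc k) (Kc (nx k)) (Ks k) (outer k) (inner k)); try assumption.
  - apply side_cap_convex. - apply half_disk_convex. - apply half_disk_convex. - now apply T1.
  - split; assumption.
  - split; assumption.
  - intros. now apply inner_side_cap.
  - intros i Hi. split; [apply disk_convex|]. split; [now apply T3|].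
    repeat split; apply side_disk_pt; auto using Rabs_tau, Rabs_mtau; lia.
  - intros; now apply E3.
  - intros i y Hi Hy. apply E2; try assumption; try lia.
    + apply (convex_segset (side_cap k) (inner k i) (inner k (S i)) y (side_cap_convex k)) in Hy; [apply Hy| |]; apply inner_side_cap; auto; lia.
    + apply (convex_segset (side_disk k i) (inner k i) (inner k (S i)) y) in Hy; [apply Hy|apply disk_convex| |];
      apply side_disk_pt; auto using Rabs_tau, Rabs_mtau; lia.
  - intros y Hy. apply (E1 k y 1); auto.
    + apply (convex_segset Om (inset k) (inner k 0)); auto. now apply region_convex. apply inner_side_cap; [assumption|lia].
    + apply (convex_segset (half_disk k 1) (inset k) (inner k 0)); auto. apply half_disk_convex.
  - intros y Hy. apply (E1 (nx k) y (-1)); auto.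
    + apply (convex_segset Om (inner k (S n)) (inset (nx k))); auto. now apply region_convex. apply inner_side_cap; [assumption|lia].
    + apply (convex_segset (half_disk (nx k) (-1)) (inner k (S n)) (inset (nx k))); auto. apply half_disk_convex.
  - intros; now apply E4.
  - intros; now apply E5.
  - apply (tri_apex (half_disk k 1)); auto. apply half_disk_convex. apply half_disk_star.
  - eapply cont_on_sub; [|exact Cp]. intros x [r [Hr ->]].
    destruct (Req_dec r 0) as [->|]; [right; apply seg_0|left; apply half_disk_star; [assumption|lra]].
  - apply (tri_apex (half_disk (nx k) (-1))); auto. apply half_disk_convex. apply half_disk_star.
  - eapply cont_on_sub; [|exact Cm]. intros x [r [Hr ->]].
    destruct (Req_dec r 0) as [->|]; [right; apply seg_0|left; apply half_disk_star; [assumption|lra]].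
Qed.

(** The detours from a corner to its inset are made in both directions, once for each of the two
    sides meeting at the corner. *)
Lemma contour_total Kf Kc Ks : edges_agree Kf Kc Ks -> local_closed Kf Kc Ks ->
  csum m (contour_path (fun a b g => seg_int g a b) Kc Ks) = csum m (fun k => seg_int Kf (inset k) (inset (nx k))).
Proof.
  intros HE HL.
  rewrite (csum_ext _ _ (fun k => (seg_int (Kc k) (w k) (inset k) + seg_int Kf (inset k) (inset (nx k)) + - seg_int (Kc (nx k)) (w (nx k)) (inset (nx k)))%C)).
  - rewrite !csum_plus.
    rewrite (csum_ext _ (fun k => (- seg_int (Kc (nx k)) (w (nx k)) (inset (nx k)))%C)
       (fun k => (-(1) * (fun k => seg_int (Kc k) (w k) (inset k)) (nx k))%C)) by (intros; ring).
    rewrite csum_scal. assert (N := csum_next m (fun k => seg_int (Kc k) (w k) (inset k))).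
    cbv beta in *. rewrite N by (generalize (three_corners m w Hpoly); lia). ring.
  - intros k Hk. rewrite (contour_side Kf Kc Ks k HE HL Hk). f_equal. apply seg_int_rev.
    assert (Hk' := next_lt m w Hpoly k Hk).
    destruct HL as [_ [T2 _]]. destruct (T2 (nx k) 1 Hk' (or_introl eq_refl)) as [_ Cp].
    eapply cont_on_sub; [|exact Cp]. intros x [r [Hr ->]].
    destruct (Req_dec r 0) as [->|]; [right; apply seg_0|left; apply half_disk_star; [now apply half_disk_inset|lra]].
Qed.
Lemma height_half_plane_form k z : half_plane_form (Ci * side m w k) (w k) z = height m w k z.
Proof. unfold half_plane_form, height, cross. simpl. ring. Qed.

Lemma height_ccoord k z : (k < m)%nat -> height m w k z = cross (ccoord m w k (w (nx k))) (ccoord m w k z).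
Proof.
  intros Hk. unfold height, cross, ccoord, side.
  assert (H := Cmod2_conj (d k)). rewrite (d_unit m w Hpoly k Hk) in H.
  rewrite !Cmult_conj.
  replace (Cconj (w (nx k) - w k) * Cconj (Cconj (d k)) * ((z - w k) * Cconj (d k)))%C with
    (Cconj (w (nx k) - w k) * (z - w k) * (d k * Cconj (d k)))%C.
  - rewrite <- H, RtoC_pow, Cpow_1_l, Cmult_1_r. reflexivity.
  - replace (Cconj (Cconj (d k))) with (d k); [ring|]. destruct (d k). unfold Cconj. simpl. now rewrite Ropp_involutive.
Qed.

Lemma height_leg_end k : (k < m)%nat -> height m w k (leg_end k 1) < 0.
Proof.
  intros Hk. rewrite height_ccoord, ccoord_leg_end by assumption. destruct (ccoord_next m w Hpoly k Hk) as [A B].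
  revert A B. generalize (ccoord m w k (w (nx k))). intros v A B. unfold cross. simpl. unfold Re, Im in *. nra.
Qed.

Lemma height_leg_end_next k : (k < m)%nat -> height m w k (leg_end (nx k) (-1)) < 0.
Proof.
  intros Hk. assert (Hk' := next_lt m w Hpoly k Hk).
  assert (E : forall z, height m w k z = - cross (ccoord m w (nx k) (w k)) (ccoord m w (nx k) z)).
  { intros z. unfold ccoord, cross. assert (H := Cmod2_conj (d (nx k))). rewrite (d_unit m w Hpoly _ Hk') in H.
    rewrite !Cmult_conj.
    replace (Cconj (w k - w (nx k)) * Cconj (Cconj (d (nx k))) * ((z - w (nx k)) * Cconj (d (nx k))))%C with
      (Cconj (w k - w (nx k)) * (z - w (nx k)) * (d (nx k) * Cconj (d (nx k))))%C.
    - rewrite <- H, RtoC_pow, Cpow_1_l, Cmult_1_r. unfold height, cross, side. simpl. ring.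
    - replace (Cconj (Cconj (d (nx k)))) with (d (nx k)); [ring|]. destruct (d (nx k)). unfold Cconj. simpl. now rewrite Ropp_involutive. }
  rewrite E, ccoord_leg_end by assumption. destruct (ccoord_prev m w Hpoly (nx k) Hk') as [A B].
  rewrite (prev_next m w Hpoly k Hk) in A, B.
  revert A B. generalize (ccoord m w (nx k) (w k)). intros v A B. unfold cross. simpl. unfold Re, Im in *. nra.
Qed.

Lemma height_outer k i : (k < m)%nat -> height m w k (outer k i) < 0.
Proof.
  intros Hk. unfold outer. rewrite height_seg, side_pt_height_self. generalize (center_height k Hk). nra.
Qed.

Lemma well_separated_height k a b : (k < m)%nat -> height m w k a < 0 -> height m w k b < 0 -> well_separated Om a b.
Proof.
  intros Hk Ha Hb. exists (Ci * side m w k)%C, (w k), (Rmin (- height m w k a) (- height m w k b)).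
  rewrite !height_half_plane_form. split; [apply Rmin_pos; lra|]. split.
  - intros z Hz. rewrite height_half_plane_form. exact (Hz k Hk).
  - generalize (Rmin_l (- height m w k a) (- height m w k b)) (Rmin_r (- height m w k a) (- height m w k b)). lra.
Qed.

Lemma half_plane_form_ccoord k z : half_plane_form (- d k) (w k) z = - Re (ccoord m w k z).
Proof. unfold half_plane_form, ccoord. simpl. ring. Qed.

Lemma separated_leg k sg : (k < m)%nat -> separated Om (w k) (leg_end k sg).
Proof.
  intros Hk. exists (- d k)%C, (w k). repeat split.
  - intros z Hz. rewrite half_plane_form_ccoord. generalize (ccoord_region m w Hpoly k z Hk Hz). lra.
  - rewrite half_plane_form_ccoord. unfold ccoord. simpl. lra.
  - rewrite half_plane_form_ccoord, ccoord_leg_end by assumption. simpl. lra.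
Qed.

Lemma well_separated_chord k : (k < m)%nat -> well_separated Om (leg_end k (-1)) (leg_end k 1).
Proof.
  intros Hk. exists (- d k)%C, (w k), R0. rewrite !half_plane_form_ccoord, !ccoord_leg_end by assumption. simpl. repeat split; try lra.
  intros z Hz. rewrite half_plane_form_ccoord. generalize (ccoord_region m w Hpoly k z Hk Hz). lra.
Qed.

Lemma well_separated_start k : (k < m)%nat -> well_separated Om (leg_end k 1) (outer k 0).
Proof. intros Hk. apply (well_separated_height k); auto using height_leg_end, height_outer. Qed.

Lemma well_separated_strip k i : (k < m)%nat -> well_separated Om (outer k i) (outer k (S i)).
Proof. intros Hk. apply (well_separated_height k); auto using height_outer. Qed.

Lemma well_separated_end k : (k < m)%nat -> well_separated Om (outer k (S n)) (leg_end (nx k) (-1)).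
Proof. intros Hk. apply (well_separated_height k); auto using height_leg_end_next, height_outer. Qed.

Definition winding (z : C) : C := csum m (contour_path (fun a b _ => seg_int (kernel z) a b) (fun _ _ => 0%C) (fun _ _ _ => 0%C)).

(** The derivative in [z] of the kernel integral over one piece is the difference of the kernel
    between its ends.  The contour being closed, these differences telescope to zero. *)
Lemma winding_const z : Om z -> winding z = winding o.
Proof.
  intros Hz. assert (Ho := center_region m w Hpoly). symmetry.
  assert (CO := region_convex m w).
  apply (quad_expansion_const o z winding (fun y => csum m (fun k => contour_path (fun a b _ => (kernel y a - kernel y b)%C) (fun _ _ => 0%C) (fun _ _ _ => 0%C) k))).
  - unfold winding. apply (quad_expansion_csum _ m (fun k z => contour_path (fun a b _ => seg_int (kernel z) a b) (fun _ _ => 0%C) (fun _ _ _ => 0%C) k)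
      (fun k y => contour_path (fun a b _ => (kernel y a - kernel y b)%C) (fun _ _ => 0%C) (fun _ _ _ => 0%C) k)).
    intros k Hk. assert (Hk' := next_lt m w Hpoly k Hk). unfold contour_path.
    apply quad_expansion_plus; [apply quad_expansion_plus; [apply quad_expansion_plus; [apply quad_expansion_plus|]|]|].
    + apply (quad_expansion_seg Om); auto. now apply separated_leg.
    + apply (quad_expansion_seg Om); auto. now apply well_separated_separated, well_separated_start.
    + apply (quad_expansion_csum _ (S n) (fun i z => seg_int (kernel z) (outer k i) (outer k (S i))) (fun i y => (kernel y (outer k i) - kernel y (outer k (S i)))%C)).
      intros i Hi. apply (quad_expansion_seg Om); auto. now apply well_separated_separated, well_separated_strip.
    + apply (quad_expansion_seg Om); auto. now apply well_separated_separated, well_separated_end.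
    + apply (quad_expansion_seg Om); auto. apply separated_sym. now apply separated_leg.
  - intros y _.
    assert (Tel : forall N (g : nat -> C), csum N (fun i => (g i - g (S i))%C) = (g 0%nat - g N)%C).
    { induction N as [|N IH]; intros g; simpl; [ring|]. rewrite IH. ring. }
    rewrite (csum_ext _ _ (fun k => (kernel y (w k) + (-(1)) * kernel y (w (nx k)))%C)).
    + rewrite csum_plus, csum_scal. rewrite (csum_next m (fun k => kernel y (w k))) by (generalize (three_corners m w Hpoly); lia). ring.
    + intros k Hk. unfold contour_path. rewrite (Tel (S n) (fun i => kernel y (outer k i))). ring.
Qed.

Lemma kernel_holo V z : ~ V z -> holo V (kernel z).
Proof.
  intros H x Vx. eexists. apply (cderiv_shift Cinv). apply cderiv_inv. apply Cminus_ne. intros ->. contradiction.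
Qed.

Lemma half_disk_not_o k sg : (k < m)%nat -> ~ half_disk k sg o.
Proof. intros Hk [H _]. unfold disk in H. specialize (Hso k Hk). lra. Qed.

Lemma w_ne_o k : (k < m)%nat -> w k <> o.
Proof.
  intros Hk E. specialize (Hso k Hk). rewrite <- E in Hso. replace (w k - w k)%C with (RtoC 0) in Hso by ring.
  rewrite Cmod_0 in Hso. lra.
Qed.

(** The kernel at the centre is holomorphic on every region through which the contour is
    deformed, so the contour may be replaced by the polygon of the insets, each side of which
    turns counterclockwise about the centre. *)
Lemma winding_center_ne0 : winding o <> 0%C.
Proof.
  assert (E : winding o = csum m (fun k => seg_int (kernel o) (inset k) (inset (nx k)))).
  { unfold winding.
    transitivity (csum m (contour_path (fun a b g => seg_int g a b) (fun _ => kernel o) (fun _ _ => kernel o))); [reflexivity|].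
    apply contour_total.
    - repeat split; intros; reflexivity.
    - repeat split.
      + apply holo_cont. apply kernel_holo. intros [_ H0]. lra.
      + apply goursat; [apply side_cap_convex|]. apply kernel_holo. intros [_ H0]. lra.
      + apply holo_cont. apply kernel_holo. now apply half_disk_not_o.
      + apply goursat; [apply half_disk_convex|]. apply kernel_holo. now apply half_disk_not_o.
      + apply holo_cont. apply kernel_holo. intros [H1|H1]; [now apply (half_disk_not_o k sg)|now apply (w_ne_o k)].
      + apply holo_cont. apply kernel_holo. intros H1. unfold side_disk, disk in H1.
        assert (T := node_time_range i ltac:(lia)). specialize (Hetao k (node_time i) H T). lra.
      + apply goursat; [apply disk_convex|]. apply kernel_holo. intros H1. unfold side_disk, disk in H1.
        assert (T := node_time_range i ltac:(lia)). specialize (Hetao k (node_time i) H T). lra. }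
  assert (P : forall N, (N <= m)%nat -> (0 < N)%nat -> 0 < Im (csum N (fun k => seg_int (kernel o) (inset k) (inset (nx k))))).
  { induction N as [|N IH]; [lia|]. intros HN1 _.
    destruct (HQ N ltac:(lia)) as [_ [_ [_ X]]]. apply Im_seg_int_kernel_pos in X. fold (kernel o) in X.
    destruct N as [|N].
    - simpl csum. rewrite Im_plus. change (Im (RtoC 0)) with 0. rewrite Rplus_0_l. exact X.
    - change (csum (S (S N)) (fun k => seg_int (kernel o) (inset k) (inset (nx k)))) with
        (csum (S N) (fun k => seg_int (kernel o) (inset k) (inset (nx k))) + seg_int (kernel o) (inset (S N)) (inset (nx (S N))))%C.
      rewrite Im_plus. apply Rplus_lt_0_compat; [apply IH; lia|exact X]. }
  intros Z. specialize (P m (le_n m) ltac:(generalize (three_corners m w Hpoly); lia)).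
  rewrite <- E, Z in P. change (Im (RtoC 0)) with 0 in P. lra.
Qed.

Hypotheses (HFf : holo Om f)
  (HFc : forall k, (k < m)%nat -> holo (slit_disk (w k) s (d k)) (Fc k) /\ forall y, slit_disk (w k) s (d k) y -> Om y -> Fc k y = f y)
  (HFc0 : forall k, (k < m)%nat -> forall e, 0 < e -> exists r, 0 < r /\ forall y, slit_disk (w k) s (d k) y -> Cmod (y - w k) < r -> Cmod (Fc k y - Fc k (w k)) < e)
  (HFs : forall k i, (k < m)%nat -> (i <= n)%nat -> holo (side_disk k i) (Fs k i) /\ forall y, side_disk k i y -> Om y -> Fs k i y = f y).

Lemma sg_abs sg : sg = 1 \/ sg = -1 -> Rabs sg = 1.
Proof. intros [->| ->]; [apply Rabs_R1|]. rewrite Rabs_left; lra. Qed.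

Lemma Fc_holo k sg : (k < m)%nat -> holo (half_disk k sg) (Fc k).
Proof. intros Hk. destruct (HFc k Hk) as [H _]. eapply holo_sub; [|exact H]. intros x. now apply half_disk_slit. Qed.

Lemma Fc_cont k sg : (k < m)%nat -> (sg = 1 \/ sg = -1) -> cont_on (fun x => half_disk k sg x \/ x = w k) (Fc k).
Proof.
  intros Hk Hsg. apply cont_on_add_point.
  - apply half_disk_open; [assumption|now apply sg_abs].
  - apply holo_cont. now apply Fc_holo.
  - intros e He. destruct (HFc0 k Hk e He) as [r [Hr H]]. exists r. split; [assumption|].
    intros y Vy. apply H. now apply (half_disk_slit k sg).
Qed.

(** Two continuations whose domains overlap agree with [f], hence with each other, on the part
    of the overlap in the polygon, and the overlap is convex. *)
Lemma edges_agree_F : edges_agree f Fc Fs.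
Proof.
  assert (OO := region_open m w). repeat split.
  - intros k y sg Hk Hsg Oy Vy. apply (HFc k Hk); [|assumption]. now apply (half_disk_slit k sg).
  - intros k i y Hk Hi Oy Dy. now apply (HFs k i Hk Hi).
  - intros k i y Hk Hi Hy.
    assert (A1 : forall j sg, (j = i \/ j = S i) -> Rabs sg = tau -> side_disk k j (seg (side_pt k (node_time (S i))) o sg)).
    { intros j sg [->| ->] Hsg; apply side_disk_pt; auto; lia. }
    set (W := fun x => side_disk k i x /\ side_disk k (S i) x).
    apply (agree_on W Om _ _ (inner k (S i)) y).
    + apply convex_and; apply disk_convex.
    + apply open_and; apply disk_open.
    + assumption.
    + eapply holo_sub; [|apply (HFs k i Hk ltac:(lia))]. now intros x [H _].
    + eapply holo_sub; [|apply (HFs k (S i) Hk ltac:(lia))]. now intros x [_ H].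
    + intros x [H1 H2] Ox. rewrite (proj2 (HFs k i Hk ltac:(lia))) by assumption.
      symmetry. now apply (HFs k (S i) Hk ltac:(lia)).
    + split; apply A1; auto using Rabs_tau.
    + apply (inner_side_cap k (S i) Hk). lia.
    + apply (convex_segset W (outer k (S i)) (inner k (S i))); auto.
      * apply convex_and; apply disk_convex.
      * split; apply A1; auto using Rabs_mtau.
      * split; apply A1; auto using Rabs_tau.
  - intros k y Hk Hy. destruct (half_disk_start k Hk) as [V1 V2].
    set (W := fun x => side_disk k 0 x /\ half_disk k 1 x).
    assert (W2 : W (inner k 0)) by (split; [apply side_disk_pt; auto using Rabs_tau; lia|assumption]).
    assert (CW : convex W) by (apply convex_and; [apply disk_convex|apply half_disk_convex]).
    apply (agree_on W Om _ _ (inner k 0) y); try assumption.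
    + apply open_and; [apply disk_open|]. apply half_disk_open; [assumption|apply Rabs_R1].
    + eapply holo_sub; [|apply (HFs k 0 Hk ltac:(lia))]. now intros x [H _].
    + eapply holo_sub; [|apply (Fc_holo k 1 Hk)]. now intros x [_ H].
    + intros x [H1 H2] Ox. rewrite (proj2 (HFs k 0 Hk ltac:(lia))) by assumption.
      symmetry. apply (HFc k Hk); [now apply (half_disk_slit k 1)|assumption].
    + apply (inner_side_cap k 0 Hk). lia.
    + apply (convex_segset W (outer k 0) (inner k 0)); auto.
      split; [apply side_disk_pt; auto using Rabs_mtau; lia|assumption].
  - intros k y Hk Hy. destruct (half_disk_end k Hk) as [V1 V2]. assert (Hk' := next_lt m w Hpoly k Hk).
    set (W := fun x => side_disk k n x /\ half_disk (nx k) (-1) x).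
    assert (W2 : W (inner k (S n))) by (split; [apply side_disk_pt; auto using Rabs_tau; lia|assumption]).
    assert (CW : convex W) by (apply convex_and; [apply disk_convex|apply half_disk_convex]).
    apply (agree_on W Om _ _ (inner k (S n)) y); try assumption.
    + apply open_and; [apply disk_open|]. apply half_disk_open; [assumption|apply sg_abs; auto].
    + eapply holo_sub; [|apply (HFs k n Hk ltac:(lia))]. now intros x [H _].
    + eapply holo_sub; [|apply (Fc_holo (nx k) (-1) Hk')]. now intros x [_ H].
    + intros x [H1 H2] Ox. rewrite (proj2 (HFs k n Hk ltac:(lia))) by assumption.
      symmetry. apply (HFc (nx k) Hk'); [now apply (half_disk_slit (nx k) (-1))|assumption].
    + apply (inner_side_cap k (S n) Hk). lia.
    + apply (convex_segset W (inner k (S n)) (outer k (S n))); auto.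
      split; [apply side_disk_pt; auto using Rabs_mtau; lia|assumption].
Qed.

Lemma edges_agree_dquot z c l : edges_agree (dquot f z c l) (fun k => dquot (Fc k) z c l) (fun k i => dquot (Fs k i) z c l).
Proof.
  destruct edges_agree_F as [E1 [E2 [E3 [E4 E5]]]]. unfold dquot. repeat split.
  - intros k y sg Hk Hsg Oy Vy. now rewrite (E1 k y sg).
  - intros. now rewrite E2.
  - intros. now rewrite E3.
  - intros. now rewrite E4.
  - intros. now rewrite E5.
Qed.

Lemma dquot_tri_closed_region V F z l : convex V -> openC V -> holo V F -> (forall y, V y -> Om y -> F y = f y) ->
  Om z -> cderiv f z l -> tri_closed V (dquot F z (f z) l).
Proof.
  intros CV OV HF HE Oz Hl. apply dquot_tri_closed; try assumption.
  intros Vz. split; [symmetry; auto|].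
  destruct (open_and _ _ OV (region_open m w) z (conj Vz Oz)) as [e [He H]].
  apply (cderiv_local f F z l e); try assumption. intros y Hy. destruct (H y Hy). symmetry; auto.
Qed.

Lemma dquot_local_closed z l : Om z -> cderiv f z l ->
  local_closed (dquot f z (f z) l) (fun k => dquot (Fc k) z (f z) l) (fun k i => dquot (Fs k i) z (f z) l).
Proof.
  intros Oz Hl.
  assert (Hv : forall k sg, (k < m)%nat -> (sg = 1 \/ sg = -1) -> tri_closed (half_disk k sg) (dquot (Fc k) z (f z) l)).
  { intros k sg Hk Hsg. apply dquot_tri_closed_region; try assumption.
    - apply half_disk_convex. - apply half_disk_open; [assumption|now apply sg_abs]. - now apply Fc_holo.
    - intros y Vy Oy. apply (HFc k Hk); [now apply (half_disk_slit k sg)|assumption]. }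
  split; [|split].
  - intros k Hk. apply dquot_tri_closed; [apply side_cap_convex| |auto]. eapply holo_sub; [|exact HFf]. now intros x [H _].
  - intros k sg Hk Hsg. split; [now apply Hv|]. apply dquot_cont_corner.
    + apply half_disk_open; [assumption|now apply sg_abs].
    + now apply Fc_cont.
    + intros E. rewrite <- E in Oz. assert (A := Oz k Hk). fold (height m w k (w k)) in A. rewrite height_self in A. lra.
    + now apply Hv.
  - intros k i Hk Hi. destruct (HFs k i Hk Hi). apply dquot_tri_closed_region; try assumption. apply disk_convex. apply disk_open.
Qed.

(** Once inside the polygon, which is convex, the closed polyline through the insets is the
    boundary of a fan of triangles with apex at the centre. *)
Lemma cauchy_zero z l : Om z -> cderiv f z l ->
  csum m (contour_path (fun a b g => seg_int g a b) (fun k => dquot (Fc k) z (f z) l) (fun k i => dquot (Fs k i) z (f z) l)) = 0%C.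
Proof.
  intros Oz Hl. rewrite (contour_total _ _ _ (edges_agree_dquot z (f z) l) (dquot_local_closed z l Oz Hl)).
  assert (T : tri_closed Om (dquot f z (f z) l)) by (apply dquot_tri_closed; [now apply region_convex|assumption|auto]).
  destruct T as [Tc Tt]. assert (Oo := center_region m w Hpoly).
  set (H := fun k => seg_int (dquot f z (f z) l) o (inset k)).
  rewrite (csum_ext _ _ (fun k => (H (nx k) + (-(1)) * H k)%C)).
  - rewrite csum_plus, csum_scal, (csum_next m H) by (generalize (three_corners m w Hpoly); lia). ring.
  - intros k Hk. destruct (HQ k Hk) as [Q1 _]. destruct (HQ (nx k) (next_lt m w Hpoly k Hk)) as [Q2 _].
    assert (E := Tt _ _ _ Oo Q1 Q2). unfold tri_int in E.
    rewrite (seg_int_rev _ o (inset (nx k))) in E by (apply (cont_on_seg Om); auto; now apply region_convex).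
    fold (H k) in E. fold (H (nx k)) in E.
    replace (seg_int (dquot f z (f z) l) (inset k) (inset (nx k))) with
      ((H k + seg_int (dquot f z (f z) l) (inset k) (inset (nx k)) + - H (nx k)) + H (nx k) - H k)%C by ring.
    rewrite E. ring.
Qed.

Definition cauchy_int (z : C) (a b : C) (g : C -> C) : C := seg_int (fun y => (g y * kernel z y)%C) a b.

Lemma cauchy_int_dquot z c l a b g : separated Om a b -> Om z -> cont_on (segset a b) g ->
  seg_int (dquot g z c l) a b = (cauchy_int z a b g + (- c) * seg_int (kernel z) a b)%C.
Proof.
  intros HS Oz Hg. assert (Av : forall p, segset a b p -> p <> z) by (intros p; now apply (separated_avoid Om)).
  assert (Ck : cont_on (segset a b) (kernel z)) by (now apply cont_on_kernel).
  unfold cauchy_int. rewrite <- seg_int_scal by assumption. rewrite <- seg_int_plus.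
  - apply seg_int_ext. intros y Hy. rewrite dquot_ne by auto. unfold kernel. assert (N := Cminus_ne _ _ (Av y Hy)). field. assumption.
  - now apply cont_on_mult.
  - apply cont_on_mult; [apply cont_on_const|assumption].
Qed.

Lemma leg_cont k sg : (k < m)%nat -> (sg = 1 \/ sg = -1) -> cont_on (segset (w k) (leg_end k sg)) (Fc k).
Proof.
  intros Hk Hsg. eapply cont_on_sub; [|exact (Fc_cont k sg Hk Hsg)]. intros x [r [Hr ->]].
  destruct (Req_dec r 0) as [->|]; [right; apply seg_0|left].
  apply half_disk_star; [apply half_disk_leg_end; [assumption|destruct Hsg as [->| ->]; lra]|lra].
Qed.

Lemma start_cont k : (k < m)%nat -> cont_on (segset (leg_end k 1) (outer k 0)) (Fc k).
Proof.
  intros Hk. apply (cont_on_seg (half_disk k 1)); [apply half_disk_convex|apply holo_cont; now apply Fc_holo| |apply (half_disk_start k Hk)].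
  apply half_disk_leg_end; [assumption|lra].
Qed.

Lemma end_cont k : (k < m)%nat -> cont_on (segset (outer k (S n)) (leg_end (nx k) (-1))) (Fc (nx k)).
Proof.
  intros Hk. assert (Hk' := next_lt m w Hpoly k Hk).
  apply (cont_on_seg (half_disk (nx k) (-1))); [apply half_disk_convex|apply holo_cont; now apply Fc_holo|apply (half_disk_end k Hk)|].
  apply half_disk_leg_end; [assumption|lra].
Qed.

Lemma strip_cont k i : (k < m)%nat -> (i <= n)%nat -> cont_on (segset (outer k i) (outer k (S i))) (Fs k i).
Proof.
  intros Hk Hi. apply (cont_on_seg (side_disk k i)); [apply disk_convex|apply holo_cont; now apply HFs| |];
  apply side_disk_pt; auto using Rabs_mtau; lia.
Qed.

Lemma cauchy_formula z : Om z -> (winding o * f z)%C = csum m (contour_path (cauchy_int z) Fc Fs).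
Proof.
  intros Oz. destruct (HFf z Oz) as [l Hl]. assert (Z := cauchy_zero z l Oz Hl).
  rewrite <- (winding_const z Oz).
  assert (E : csum m (contour_path (fun a b g => seg_int g a b) (fun k => dquot (Fc k) z (f z) l) (fun k i => dquot (Fs k i) z (f z) l))
    = (csum m (contour_path (cauchy_int z) Fc Fs) + (- f z) * winding z)%C).
  { unfold winding. rewrite <- csum_scal, <- csum_plus. apply csum_ext. intros k Hk.
    assert (Hk' := next_lt m w Hpoly k Hk). unfold contour_path.
    rewrite (cauchy_int_dquot z (f z) l (w k)) by (auto using leg_cont, separated_leg).
    rewrite (cauchy_int_dquot z (f z) l (leg_end k 1)) by (auto using start_cont, well_separated_separated, well_separated_start).
    rewrite (cauchy_int_dquot z (f z) l (outer k (S n))) by (auto using end_cont, well_separated_separated, well_separated_end).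
    rewrite (cauchy_int_dquot z (f z) l (leg_end (nx k) (-1))).
    - rewrite (csum_ext (S n) (fun i => seg_int (dquot (Fs k i) z (f z) l) (outer k i) (outer k (S i)))
        (fun i => (cauchy_int z (outer k i) (outer k (S i)) (Fs k i) + (- f z) * seg_int (kernel z) (outer k i) (outer k (S i)))%C)).
      + rewrite csum_plus, csum_scal. ring.
      + intros i Hi. apply cauchy_int_dquot; auto using well_separated_separated, well_separated_strip. apply strip_cont; [assumption|lia].
    - apply separated_sym. now apply separated_leg.
    - assumption.
    - eapply cont_on_sub; [|apply (leg_cont (nx k) (-1) Hk'); auto]. intros x. now apply segset_rev. }
  rewrite E in Z. replace (winding z * f z)%C with (csum m (contour_path (cauchy_int z) Fc Fs) - (csum m (contour_path (cauchy_int z) Fc Fs) + - f z * winding z))%C by ring.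
  rewrite Z. ring.
Qed.

(** The triangle between the legs and the chord lies in a half-plane that does not contain [z]. *)
Lemma chord_kernel k z : (k < m)%nat -> Om z ->
  (seg_int (kernel z) (w k) (leg_end k 1) + (-(1)) * seg_int (kernel z) (w k) (leg_end k (-1)))%C = seg_int (kernel z) (leg_end k (-1)) (leg_end k 1).
Proof.
  intros Hk Oz. assert (Uz := ccoord_region m w Hpoly k z Hk Oz).
  set (H := fun y => Re (ccoord m w k z) < Re (ccoord m w k y)).
  assert (CH : convex H).
  { intros a b Ha Hb t Ht. unfold H in *. rewrite ccoord_seg. unfold seg.
    replace (Re (ccoord m w k a + t * (ccoord m w k b - ccoord m w k a))%C) with ((1 - t) * Re (ccoord m w k a) + t * Re (ccoord m w k b)) by (simpl; ring).
    destruct (Req_dec t 0) as [->|]; [lra|]. nra. }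
  assert (T : tri_closed H (kernel z)) by (apply goursat; [assumption|]; apply kernel_holo; unfold H; lra).
  assert (H0 : H (w k)).
  { unfold H. replace (ccoord m w k (w k)) with (RtoC 0) by (unfold ccoord; ring). exact Uz. }
  assert (H1 : forall sg, H (leg_end k sg)).
  { intros sg. unfold H. rewrite ccoord_leg_end by assumption. change (Re (ccoord m w k z) < R0). lra. }
  destruct T as [Tc Tt]. assert (E := Tt _ _ _ H0 (H1 (-1)) (H1 1)). unfold tri_int in E.
  rewrite (seg_int_rev (kernel z) (w k) (leg_end k 1)) in E by (apply (cont_on_seg H); auto).
  set (A := seg_int (kernel z) (w k) (leg_end k 1)) in *. set (B := seg_int (kernel z) (w k) (leg_end k (-1))) in *.
  set (D := seg_int (kernel z) (leg_end k (-1)) (leg_end k 1)) in *.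
  replace D with ((B + D + - A) + A - B)%C by ring. rewrite E. ring.
Qed.

Lemma cauchy_int_shift a b g z c : separated Om a b -> Om z -> cont_on (segset a b) g ->
  cauchy_int z a b g = (cauchy_int z a b (fun y => (g y - c)%C) + c * seg_int (kernel z) a b)%C.
Proof.
  intros HS Oz Hg. assert (Av : forall p, segset a b p -> p <> z) by (intros p; now apply (separated_avoid Om)).
  assert (Ck : cont_on (segset a b) (kernel z)) by (now apply cont_on_kernel).
  unfold cauchy_int. rewrite <- seg_int_scal by assumption. rewrite <- seg_int_plus.
  - apply seg_int_ext. intros y Hy. ring.
  - apply cont_on_mult; [|assumption]. now apply (cont_on_plus _ g (fun _ => (- c)%C)); [|apply cont_on_const].
  - apply cont_on_mult; [apply cont_on_const|assumption].
Qed.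

Definition corner_osc (k : nat) (y : C) : C := (Fc k y - Fc k (w k))%C.

Lemma corner_osc_cont k sg : (k < m)%nat -> (sg = 1 \/ sg = -1) -> cont_on (segset (w k) (leg_end k sg)) (corner_osc k).
Proof.
  intros Hk Hsg. apply (cont_on_plus _ (Fc k) (fun _ => (- Fc k (w k))%C)); [now apply leg_cont|apply cont_on_const].
Qed.

(** The value at the corner is subtracted on both legs and its integral moved to the chord,
    after the legs have been regrouped by corners. *)
Theorem representation z : Om z -> (winding o * f z)%C =
  csum m (fun k => (cauchy_int z (w k) (leg_end k 1) (corner_osc k) + (-(1)) * cauchy_int z (w k) (leg_end k (-1)) (corner_osc k)
     + cauchy_int z (leg_end k (-1)) (leg_end k 1) (fun _ => Fc k (w k))
     + cauchy_int z (leg_end k 1) (outer k 0) (Fc k) + csum (S n) (fun i => cauchy_int z (outer k i) (outer k (S i)) (Fs k i))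
     + cauchy_int z (outer k (S n)) (leg_end (nx k) (-1)) (Fc (nx k)))%C).
Proof.
  intros Oz. rewrite cauchy_formula by assumption.
  set (lp := fun k => cauchy_int z (w k) (leg_end k 1) (Fc k)). set (lm := fun k => cauchy_int z (w k) (leg_end k (-1)) (Fc k)).
  set (rest := fun k => (cauchy_int z (leg_end k 1) (outer k 0) (Fc k) + csum (S n) (fun i => cauchy_int z (outer k i) (outer k (S i)) (Fs k i))
     + cauchy_int z (outer k (S n)) (leg_end (nx k) (-1)) (Fc (nx k)))%C).
  transitivity (csum m (fun k => (lp k + (-(1)) * lm k + rest k)%C)).
  - rewrite !csum_plus, csum_scal. rewrite <- (csum_next m lm) by (generalize (three_corners m w Hpoly); lia).
    rewrite <- csum_scal, <- !csum_plus. apply csum_ext. intros k Hk. unfold contour_path, rest, lp, lm.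
    assert (Hk' := next_lt m w Hpoly k Hk).
    assert (E : cauchy_int z (leg_end (nx k) (-1)) (w (nx k)) (Fc (nx k)) = (- cauchy_int z (w (nx k)) (leg_end (nx k) (-1)) (Fc (nx k)))%C).
    { unfold cauchy_int. apply seg_int_rev. apply cont_on_mult; [apply leg_cont; auto|].
      apply cont_on_kernel. intros p Hp. apply (separated_avoid Om (w (nx k)) (leg_end (nx k) (-1))); auto using separated_leg. }
    rewrite E. ring.
  - apply csum_ext. intros k Hk. unfold rest, lp, lm.
    rewrite (cauchy_int_shift (w k) (leg_end k 1) (Fc k) z (Fc k (w k))) by (auto using separated_leg, leg_cont).
    rewrite (cauchy_int_shift (w k) (leg_end k (-1)) (Fc k) z (Fc k (w k))) by (auto using separated_leg, leg_cont).
    assert (E : cauchy_int z (leg_end k (-1)) (leg_end k 1) (fun _ => Fc k (w k)) = (Fc k (w k) * seg_int (kernel z) (leg_end k (-1)) (leg_end k 1))%C).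
    { unfold cauchy_int. apply seg_int_scal. apply cont_on_kernel. intros p Hp.
      apply (separated_avoid Om (leg_end k (-1)) (leg_end k 1)); auto using well_separated_separated, well_separated_chord. }
    rewrite E, <- chord_kernel by assumption. unfold corner_osc. ring.
Qed.
End Contour.

(** * Polynomial approximation of Cauchy transforms *)

(** As the sides add up to zero, the sum of the heights of [z] over all sides is independent of
    [z]; it is twice the area.  On the polygon all heights are positive, so each is bounded by
    that sum, and two heights over nonparallel sides determine [z]. *)
Lemma region_bounded m w : convex_polygon m w -> exists B, 0 <= B /\ forall z, polygon_region m w z -> Cmod z <= B.
Proof.
  intros Hp. assert (H3 := three_corners m w Hp).
  set (A := Im (csum m (fun k => (- (Cconj (side m w k) * w k))%C))).
  assert (Hsum : forall z, Im (csum m (fun k => (Cconj (side m w k) * (z - w k))%C)) = A).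
  { intros z. rewrite (csum_ext _ _ (fun k => (z * Cconj (w (next m k)) + (-(1)) * (z * Cconj (w k)) + - (Cconj (side m w k) * w k))%C)).
    - rewrite !csum_plus, !csum_scal. rewrite (csum_next m (fun k => Cconj (w k))) by lia.
      unfold A. f_equal. ring.
    - intros k Hk. unfold side.
      replace (Cconj (w (next m k) - w k)) with (Cconj (w (next m k)) - Cconj (w k))%C; [ring|].
      unfold Cconj, Cminus, Cplus, Copp. simpl. f_equal. ring. }
  assert (Bd : forall z, polygon_region m w z -> forall k, (k < m)%nat -> 0 < height m w k z <= A).
  { intros z Hz k Hk. split; [exact (Hz k Hk)|]. rewrite <- (Hsum z).
    assert (P : forall N, (N <= m)%nat -> 0 <= Im (csum N (fun k => (Cconj (side m w k) * (z - w k))%C)) /\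
       ((k < N)%nat -> height m w k z <= Im (csum N (fun k => (Cconj (side m w k) * (z - w k))%C)))).
    { induction N as [|N IH]; intros HN; [split; [simpl; lra|lia]|].
      destruct (IH ltac:(lia)) as [I1 I2]. simpl csum. rewrite Im_plus.
      assert (X := Hz N ltac:(lia)). unfold cross in X.
      split; [lra|]. intros HkN. destruct (Nat.eq_dec k N) as [->|NE].
      - unfold height, cross. lra.
      - specialize (I2 ltac:(lia)). lra. }
    apply (P m (le_n m)). assumption. }
  assert (N01 : next m 0 = 1%nat) by (unfold next; rewrite Nat.mod_small; lia).
  set (a := side m w 0). set (b := side m w 1).
  assert (K : 0 < cross a b).
  { assert (N12 : (next m 1 = 2 /\ 3 < m)%nat \/ (next m 1 = 2 /\ m = 3)%nat).
    { unfold next. rewrite Nat.mod_small; lia. }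
    assert (X : 0 < height m w 0 (w 2%nat)).
    { apply height_pos; try assumption; try lia; rewrite N01; lia. }
    assert (E : next m 1 = 2%nat) by (destruct N12; tauto).
    unfold a, b, side. rewrite N01, E. unfold height, side in X. rewrite N01 in X.
    unfold cross in *. simpl in *. lra. }
  exists (Cmod (w 1%nat) + A * (Cmod a + Cmod b) / cross a b).
  assert (A0 : 0 < A).
  { destruct (Bd _ (center_region m w Hp) 0%nat ltac:(lia)). lra. }
  split.
  { apply Rplus_le_le_0_compat; [apply Cmod_ge_0|]. apply Rdiv_le_0_compat; [|assumption].
    apply Rmult_le_pos; [lra|]. apply Rplus_le_le_0_compat; apply Cmod_ge_0. }
  intros z Hz. destruct (Bd z Hz 0%nat ltac:(lia)) as [L0 U0]. destruct (Bd z Hz 1%nat ltac:(lia)) as [L1 U1].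
  set (u := (z - w 1%nat)%C).
  assert (E0 : height m w 0 z = cross a u).
  { unfold height, a, u, side. rewrite N01. unfold cross. simpl. ring. }
  assert (E1 : height m w 1 z = cross b u) by reflexivity.
  rewrite E0 in *. rewrite E1 in *.
  assert (Eu : (RtoC (cross a b) * u)%C = (RtoC (- cross b u) * a + RtoC (cross a u) * b)%C).
  { unfold cross. apply injective_projections; simpl; ring. }
  assert (Hu : cross a b * Cmod u <= A * (Cmod a + Cmod b)).
  { rewrite <- (Rabs_right (cross a b)) by lra. rewrite <- Cmod_R, <- Cmod_mult, Eu.
    eapply Rle_trans; [apply Cmod_triangle|]. rewrite !Cmod_mult, !Cmod_R, Rabs_Ropp, !Rabs_right by lra.
    generalize (Cmod_ge_0 a) (Cmod_ge_0 b). nra. }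
  replace z with (w 1%nat + u)%C by (unfold u; ring).
  eapply Rle_trans; [apply Cmod_triangle|]. apply Rplus_le_compat_l.
  apply Rmult_le_reg_r with (cross a b); [assumption|].
  replace (A * (Cmod a + Cmod b) / cross a b * cross a b) with (A * (Cmod a + Cmod b)) by (field; lra). lra.
Qed.

(** Polynomials are handled as functions; the list of coefficients only serves to say that the
    degree is less than [d]. *)
Definition polyfun (d : nat) (g : C -> C) : Prop :=
  exists l : list C, (length l <= d)%nat /\ forall z, poly_eval l z = g z.

Lemma polyfun_mono d e g : (d <= e)%nat -> polyfun d g -> polyfun e g.
Proof. intros H [l [Hl E]]. exists l. split; [lia|assumption]. Qed.

Lemma polyfun_ext d g h : (forall z, g z = h z) -> polyfun d g -> polyfun d h.
Proof. intros H [l [Hl E]]. exists l. split; [assumption|]. intros z. now rewrite E. Qed.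

Lemma polyfun_zero d : polyfun d (fun _ => 0%C).
Proof. exists nil. split; [simpl; lia|reflexivity]. Qed.

Lemma polyfun_const d c : polyfun (S d) (fun _ => c).
Proof. exists (c :: nil). split; [simpl; lia|]. intros z. simpl. ring. Qed.

Lemma polyfun_scal d c g : polyfun d g -> polyfun d (fun z => (c * g z)%C).
Proof.
  intros [l [Hl E]]. exists (map (fun a => (c * a)%C) l). split; [now rewrite length_map|].
  intros z. rewrite <- E. clear. induction l as [|a l IH]; simpl; [ring|]. rewrite IH. ring.
Qed.

Fixpoint poly_add (l k : list C) : list C :=
  match l, k with
  | nil, _ => k
  | _, nil => l
  | a :: l', b :: k' => (a + b)%C :: poly_add l' k'
  end.

Lemma poly_add_eval l k z : poly_eval (poly_add l k) z = (poly_eval l z + poly_eval k z)%C.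
Proof.
  revert k. induction l as [|a l IH]; intros [|b k]; simpl; try ring. rewrite IH. ring.
Qed.

Lemma poly_add_length l k : (length (poly_add l k) <= Nat.max (length l) (length k))%nat.
Proof. revert k. induction l as [|a l IH]; intros [|b k]; simpl; try lia. specialize (IH k). lia. Qed.

Lemma polyfun_plus d g h : polyfun d g -> polyfun d h -> polyfun d (fun z => (g z + h z)%C).
Proof.
  intros [l [Hl E]] [k [Hk F]]. exists (poly_add l k). split.
  - generalize (poly_add_length l k). lia.
  - intros z. now rewrite poly_add_eval, E, F.
Qed.

Lemma polyfun_X d g : polyfun d g -> polyfun (S d) (fun z => (z * g z)%C).
Proof.
  intros [l [Hl E]]. exists (RtoC 0 :: l). split; [simpl; lia|]. intros z. simpl. rewrite E. ring.
Qed.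

Lemma polyfun_linear_factor d a g : polyfun d g -> polyfun (S d) (fun z => ((z - a) * g z)%C).
Proof.
  intros H. apply (polyfun_ext _ (fun z => (z * g z + (- a) * g z)%C)); [intros; ring|].
  apply polyfun_plus; [now apply polyfun_X|]. apply (polyfun_mono d); [lia|]. now apply polyfun_scal.
Qed.

Definition root_prod (L : list C) (z : C) : C := fold_right (fun b v => ((z - b) * v)%C) 1%C L.

Lemma polyfun_root_prod_mult d L g : polyfun d g -> polyfun (length L + d) (fun z => (root_prod L z * g z)%C).
Proof.
  intros H. induction L as [|a L IH]; simpl.
  - apply (polyfun_ext _ g); [intros; ring|assumption].
  - apply (polyfun_ext _ (fun z => ((z - a) * (root_prod L z * g z))%C)); [intros; ring|]. now apply polyfun_linear_factor.
Qed.

Lemma polyfun_root_prod L : polyfun (S (length L)) (root_prod L).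
Proof.
  apply (polyfun_ext _ (fun z => (root_prod L z * 1)%C)); [intros; ring|].
  apply (polyfun_mono (length L + 1)); [lia|]. apply (polyfun_root_prod_mult 1 L (fun _ => 1%C)). apply polyfun_const.
Qed.

(** The Cauchy transform of the density [h dt] carried by the segment. *)
Definition transform (h : R -> C) (a b z : C) : C := path_int (fun t => (h t * / (seg a b t - z))%C).

Lemma path_cont_inv_seg a b z : (forall t, 0 <= t <= 1 -> seg a b t <> z) -> path_cont (fun t => (/ (seg a b t - z))%C).
Proof.
  intros H. apply path_cont_inv.
  - apply (path_cont_plus (seg a b) (fun _ => (- z)%C)); [apply path_cont_segid|apply path_cont_const].
  - intros t Ht. apply Cminus_ne. now apply H.
Qed.

Lemma transform_bound h a b z M : path_cont h -> (forall t, 0 <= t <= 1 -> seg a b t <> z) ->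
  (forall t, 0 <= t <= 1 -> Cmod (h t) / Cmod (seg a b t - z) <= M) -> Cmod (transform h a b z) <= M.
Proof.
  intros Hh Hz HM. apply path_int_bound.
  - apply path_cont_mult; [assumption|now apply path_cont_inv_seg].
  - intros t Ht. rewrite Cmod_mult, Cmod_inv by (apply Cminus_ne; auto). now apply HM.
Qed.

Lemma transform_poly_step h a b c z : path_cont h -> (forall t, 0 <= t <= 1 -> seg a b t <> z) -> (forall t, 0 <= t <= 1 -> seg a b t <> c) ->
  transform h a b z = (path_int (fun t => (h t * / (seg a b t - c))%C) + (z - c) * transform (fun t => (h t * / (seg a b t - c))%C) a b z)%C.
Proof.
  intros Hh Hz Hc. unfold transform. assert (I := path_cont_inv_seg a b z Hz). assert (J := path_cont_inv_seg a b c Hc).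
  rewrite <- path_int_scal by (apply path_cont_mult; [now apply path_cont_mult|assumption]).
  rewrite <- path_int_plus.
  - apply path_int_ext. intros t Ht. assert (N1 := Cminus_ne _ _ (Hz t ltac:(lra))). assert (N2 := Cminus_ne _ _ (Hc t ltac:(lra))).
    field. split; assumption.
  - now apply path_cont_mult.
  - apply path_cont_mult; [apply path_cont_const|]. apply path_cont_mult; [now apply path_cont_mult|assumption].
Qed.

(** The geometric series of [1/(y - z)] in powers of [(z - c)/(y - c)], with its exact
    remainder. *)
Lemma transform_poly d : forall h a b c, path_cont h -> (forall t, 0 <= t <= 1 -> seg a b t <> c) ->
  exists p, polyfun d p /\ forall z, (forall t, 0 <= t <= 1 -> seg a b t <> z) ->
   transform h a b z = (p z + (z - c) ^ d * transform (fun t => (h t * (/ (seg a b t - c)) ^ d)%C) a b z)%C.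
Proof.
  induction d as [|d IH]; intros h a b c Hh Hc.
  - exists (fun _ => 0%C). split; [apply polyfun_zero|]. intros z Hz. simpl.
    rewrite Cplus_0_l, Cmult_1_l. apply path_int_ext. intros t _. ring.
  - assert (Hh1 : path_cont (fun t => (h t * / (seg a b t - c))%C)) by (apply path_cont_mult; [assumption|now apply path_cont_inv_seg]).
    destruct (IH _ a b c Hh1 Hc) as [p [Hp E]].
    set (c0 := path_int (fun t => (h t * / (seg a b t - c))%C)).
    exists (fun z => (c0 + (z - c) * p z)%C). split.
    + apply polyfun_plus; [apply polyfun_const|now apply polyfun_linear_factor].
    + intros z Hz. rewrite (transform_poly_step h a b c z Hh Hz Hc). fold c0. rewrite (E z Hz).
      replace (transform (fun t => (h t * / (seg a b t - c) * (/ (seg a b t - c)) ^ d)%C) a b z)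
        with (transform (fun t => (h t * (/ (seg a b t - c)) ^ S d)%C) a b z)
        by (apply path_int_ext; intros t _; simpl; ring).
      simpl. ring.
Qed.

Definition geom_approx (Om : C -> Prop) (F : C -> C) : Prop := exists M q, 0 <= M /\ 0 <= q < 1 /\
  forall d, exists p, polyfun d p /\ forall z, Om z -> Cmod (F z - p z) <= M * q ^ d.

Lemma geom_approx_ext Om F G : (forall z, Om z -> F z = G z) -> geom_approx Om F -> geom_approx Om G.
Proof.
  intros H [M [q [HM [Hq A]]]]. exists M, q. split; [assumption|]. split; [assumption|].
  intros d. destruct (A d) as [p [Hp E]]. exists p. split; [assumption|]. intros z Hz. rewrite <- H by assumption. auto.
Qed.

Lemma geom_approx_plus Om F G : geom_approx Om F -> geom_approx Om G -> geom_approx Om (fun z => (F z + G z)%C).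
Proof.
  intros [M [q [HM [Hq A]]]] [M' [q' [HM' [Hq' A']]]]. exists (M + M'), (Rmax q q').
  split; [lra|]. split; [unfold Rmax; destruct Rle_dec; lra|].
  intros d. destruct (A d) as [p [Hp E]]. destruct (A' d) as [p' [Hp' E']].
  exists (fun z => (p z + p' z)%C). split; [now apply polyfun_plus|]. intros z Hz.
  replace (F z + G z - (p z + p' z))%C with ((F z - p z) + (G z - p' z))%C by ring.
  eapply Rle_trans; [apply Cmod_triangle|]. specialize (E z Hz). specialize (E' z Hz).
  assert (q ^ d <= Rmax q q' ^ d) by (apply pow_incr; split; [lra|apply Rmax_l]).
  assert (q' ^ d <= Rmax q q' ^ d) by (apply pow_incr; split; [lra|apply Rmax_r]).
  assert (M * q ^ d <= M * Rmax q q' ^ d) by (apply Rmult_le_compat_l; lra).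
  assert (M' * q' ^ d <= M' * Rmax q q' ^ d) by (apply Rmult_le_compat_l; lra). lra.
Qed.

Lemma geom_approx_zero Om : geom_approx Om (fun _ => 0%C).
Proof.
  exists 0, 0. split; [lra|]. split; [lra|]. intros d. exists (fun _ => 0%C). split; [apply polyfun_zero|].
  intros z _. rewrite Cmod_self. lra.
Qed.

Lemma geom_approx_csum Om n (F : nat -> C -> C) : (forall i, (i < n)%nat -> geom_approx Om (F i)) ->
  geom_approx Om (fun z => csum n (fun i => F i z)).
Proof.
  induction n as [|n IH]; intros H; simpl; [apply geom_approx_zero|].
  apply geom_approx_plus; [apply IH; intros; apply H; lia|apply H; lia].
Qed.

Lemma Cmod_sq_shift nu q T y : Cmod (y - (q + RtoC T * nu)) * Cmod (y - (q + RtoC T * nu)) =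
  Cmod (y - q) * Cmod (y - q) - 2 * T * half_plane_form nu q y + T * T * (Cmod nu * Cmod nu).
Proof. rewrite !Cmod_sq. unfold half_plane_form. destruct nu, q, y. simpl. ring. Qed.

(** Seen from a centre far away along the normal of the separating line, the polygon is closer
    than the segment by a definite factor, so the geometric series about that centre converges
    uniformly. *)
Lemma well_separated_geom_approx Om a b h B : well_separated Om a b -> (forall z, Om z -> Cmod z <= B) -> path_cont h -> geom_approx Om (transform h a b).
Proof.
  intros Hf HB Hh.
  assert (Av : forall z, Om z -> forall t, 0 <= t <= 1 -> seg a b t <> z).
  { intros z Hz t Ht. apply (separated_avoid Om a b); [now apply well_separated_separated|assumption|now exists t]. }
  destruct Hf as [nu [q0 [eta [He [H1 [H2 H3]]]]]].
  destruct (path_cont_bounded h Hh) as [Mh [HMh HM]].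
  set (B' := B + Cmod q0).
  (* Squared distances to c = q0 + T nu are at most B'^2 + X on the region and at least 2 T eta + X on
     the segment; T is chosen so that 2 T eta exceeds B'^2. *)
  set (T := (B' * B' + 1) / eta).
  set (c := (q0 + RtoC T * nu)%C).
  assert (HT : T * eta = B' * B' + 1) by (unfold T; field; lra).
  assert (HT0 : 0 < T) by (unfold T; apply Rdiv_lt_0_compat; nra).
  set (X := T * T * (Cmod nu * Cmod nu)). assert (HX : 0 <= X) by (unfold X; apply Rmult_le_pos; [nra|apply Rmult_le_pos; apply Cmod_ge_0]).
  assert (Sq : forall y, Cmod (y - c) * Cmod (y - c) = Cmod (y - q0) * Cmod (y - q0) - 2 * T * half_plane_form nu q0 y + X).
  { intros y. apply Cmod_sq_shift. }
  set (U := B' * B' + X). set (V := X + 2 * (B' * B' + 1)).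
  assert (HUV : 0 <= U < V) by (unfold U, V; nra).
  assert (SV : 0 < sqrt V) by (apply sqrt_lt_R0; lra).
  assert (Lz : forall z, Om z -> Cmod (z - c) <= sqrt U).
  { intros z Hz. apply Rsqr_incr_0_var; [|apply sqrt_pos]. unfold Rsqr. rewrite sqrt_sqrt by lra. rewrite Sq.
    specialize (H1 z Hz). assert (Hz1 : Cmod (z - q0) <= B').
    { unfold B'. specialize (HB z Hz). generalize (Cmod_triangle z (- q0)). rewrite Cmod_opp. unfold Cminus. lra. }
    assert (Cmod (z - q0) * Cmod (z - q0) <= B' * B') by (apply Rmult_le_compat; auto using Cmod_ge_0).
    unfold U. nra. }
  assert (Ly : forall t, 0 <= t <= 1 -> sqrt V <= Cmod (seg a b t - c)).
  { intros t Ht. apply Rsqr_incr_0_var; [|apply Cmod_ge_0]. unfold Rsqr. rewrite sqrt_sqrt by lra. rewrite Sq.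
    assert (L : half_plane_form nu q0 (seg a b t) <= - eta) by (rewrite half_plane_form_seg; nra).
    generalize (Cmod_ge_0 (seg a b t - q0)). unfold V. nra. }
  assert (Hc : forall t, 0 <= t <= 1 -> seg a b t <> c).
  { intros t Ht E. specialize (Ly t Ht). rewrite E in Ly. rewrite Cmod_self in Ly. lra. }
  set (q := sqrt U / sqrt V).
  assert (Hq : 0 <= q < 1).
  { unfold q. split; [apply Rdiv_le_0_compat; [apply sqrt_pos|assumption]|].
    apply Rmult_lt_reg_r with (sqrt V); [assumption|]. unfold Rdiv. rewrite Rmult_assoc, Rinv_l, Rmult_1_r, Rmult_1_l by lra.
    apply sqrt_lt_1; lra. }
  set (g := sqrt V - sqrt U). assert (Hg : 0 < g) by (unfold g; assert (sqrt U < sqrt V) by (apply sqrt_lt_1; lra); lra).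
  exists (Mh / g), q. split; [apply Rdiv_le_0_compat; lra|]. split; [assumption|].
  intros d. destruct (transform_poly d h a b c Hh Hc) as [p [Hp E]]. exists p. split; [assumption|].
  intros z Hz. rewrite E by auto.
  replace (p z + (z - c) ^ d * transform (fun t => (h t * (/ (seg a b t - c)) ^ d)%C) a b z - p z)%C with
    ((z - c) ^ d * transform (fun t => (h t * (/ (seg a b t - c)) ^ d)%C) a b z)%C by ring.
  rewrite Cmod_mult, Cmod_pow.
  assert (Pc : forall e, path_cont (fun t => ((/ (seg a b t - c)) ^ e)%C)).
  { induction e as [|e IHe]; simpl; [apply path_cont_const|]. apply path_cont_mult; [now apply path_cont_inv_seg|assumption]. }
  assert (SVd : 0 < sqrt V ^ d) by (now apply pow_lt).
  apply Rle_trans with (sqrt U ^ d * (Mh / sqrt V ^ d / g)).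
  - apply Rmult_le_compat; [apply pow_le, Cmod_ge_0|apply Cmod_ge_0|apply pow_incr; split; [apply Cmod_ge_0|auto]|].
    apply transform_bound.
    + now apply path_cont_mult.
    + auto.
    + intros t Ht. assert (N := Cminus_ne _ _ (Hc t Ht)). rewrite Cmod_mult, Cmod_pow, Cmod_inv by assumption.
      assert (Lyt := Ly t Ht). assert (Lzz := Lz z Hz).
      assert (G : g <= Cmod (seg a b t - z)).
      { unfold g. generalize (Cmod_tri3 (seg a b t) z c). lra. }
      rewrite pow_inv. apply Rmult_le_compat.
      * apply Rmult_le_pos; [apply Cmod_ge_0|]. left. apply Rinv_0_lt_compat. apply pow_lt. lra.
      * left. apply Rinv_0_lt_compat. lra.
      * apply Rmult_le_compat; [apply Cmod_ge_0| |auto|].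
        -- left. apply Rinv_0_lt_compat. apply pow_lt. lra.
        -- apply Rinv_le_contravar; [assumption|]. apply pow_incr. lra.
      * apply Rinv_le_contravar; assumption.
  - right. unfold q. unfold Rdiv at 4. rewrite Rpow_mult_distr, pow_inv. field. lra.
Qed.

(** * Clustered poles at one corner *)

Lemma is_RInt_power E kap eps : 0 < kap -> 0 < eps <= 1 ->
  is_RInt (fun t => E * Rpower t (kap - 1)) eps 1 (E / kap * (1 - Rpower eps kap)).
Proof.
  intros Hk He.
  assert (H := is_RInt_derive (V := R_CompleteNormedModule) (fun t => E / kap * Rpower t kap) (fun t => E * Rpower t (kap - 1)) eps 1).
  replace (E / kap * (1 - Rpower eps kap)) with (E / kap * Rpower 1 kap - E / kap * Rpower eps kap).
  2:{ unfold Rpower at 1. rewrite ln_1, Rmult_0_r, exp_0. ring. }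
  apply H.
  - intros t. rewrite Rmin_left, Rmax_right by lra. intros Ht.
    replace (E * Rpower t (kap - 1)) with (E / kap * (kap * Rpower t (kap - 1))) by (field; lra).
    apply is_derive_scal. apply is_derive_Reals. apply derivable_pt_lim_power. lra.
  - intros t. rewrite Rmin_left, Rmax_right by lra. intros Ht.
    apply (continuous_scal_r E (fun t => Rpower t (kap - 1))).
    apply (ex_derive_continuous (fun t => Rpower t (kap - 1))). eexists.
    apply is_derive_Reals. apply derivable_pt_lim_power. lra.
Qed.

(** The comparison function may be unbounded at 0, so it is integrated over [[e, 1]] only; the
    rest of the integral is at most [e] times a bound of [h], and [e] tends to 0. *)
Lemma path_int_power h E kap : path_cont h -> 0 <= E -> 0 < kap ->
  (forall t, 0 < t <= 1 -> Cmod (h t) <= E * Rpower t (kap - 1)) -> Cmod (path_int h) <= E / kap.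
Proof.
  intros Hh HE Hk HB. destruct (path_cont_bounded h Hh) as [M [HM Hb]].
  assert (Eps : forall e, 0 < e <= 1 -> Cmod (path_int h) <= E / kap + M * e).
  { intros e He. unfold path_int.
    rewrite <- (RInt_Chasles (V := C_R_CompleteNormedModule) h 0 e 1) by (apply ex_RInt_path_cont; [assumption|lra|lra]).
    change plus with Cplus. eapply Rle_trans; [apply Cmod_triangle|].
    assert (I1 : Cmod (RInt (V := C_R_CompleteNormedModule) h 0 e) <= (e - 0) * M).
    { rewrite Cmod_norm. apply (norm_RInt_le_const (V := C_R_NormedModule) h 0 e); [lra| |].
      - intros t Ht. assert (Q := Hb t ltac:(lra)). rewrite Cmod_norm in Q. exact Q.
      - apply (RInt_correct (V := C_R_CompleteNormedModule)). apply ex_RInt_path_cont; [assumption|lra|lra]. }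
    assert (I2 : Cmod (RInt (V := C_R_CompleteNormedModule) h e 1) <= E / kap * (1 - Rpower e kap)).
    { rewrite Cmod_norm. apply (norm_RInt_le (V := C_R_NormedModule) h (fun t => E * Rpower t (kap - 1)) e 1); [lra| | |].
      - intros t Ht. assert (Q := HB t ltac:(lra)). rewrite Cmod_norm in Q. exact Q.
      - apply (RInt_correct (V := C_R_CompleteNormedModule)). apply ex_RInt_path_cont; [assumption|lra|lra].
      - now apply is_RInt_power. }
    assert (0 < Rpower e kap) by apply exp_pos.
    assert (0 <= E / kap) by (apply Rdiv_le_0_compat; lra). nra. }
  apply Rnot_lt_le. intros L.
  set (e := Rmin 1 ((Cmod (path_int h) - E / kap) / (2 * (M + 1)))).
  assert (He : 0 < e) by (apply Rmin_pos; [lra|apply Rdiv_lt_0_compat; lra]).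
  specialize (Eps e (conj He (Rmin_l _ _))).
  assert (e <= (Cmod (path_int h) - E / kap) / (2 * (M + 1))) by apply Rmin_r.
  apply Rmult_le_compat_r with (r := 2 * (M + 1)) in H; [|lra].
  replace ((Cmod (path_int h) - E / kap) / (2 * (M + 1)) * (2 * (M + 1))) with (Cmod (path_int h) - E / kap) in H by (field; lra).
  nra.
Qed.

(** A pair consists of a reflected point and the pole belonging to it. *)
Definition node_quot (L : list (C * C)) (y : C) : C :=
  fold_right (fun p v => ((y - snd p) / (y - fst p) * v)%C) 1%C L.

(** This is the identity [(z - be)/(y - z) = (al - be)/(y - al) + (z - al)/(y - z) . (y - be)/(y
    - al)] under the integral sign. *)
Lemma transform_pair_step h a b al be z : path_cont h -> (forall t, 0 <= t <= 1 -> seg a b t <> z) -> (forall t, 0 <= t <= 1 -> seg a b t <> al) ->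
  ((z - be) * transform h a b z)%C = ((al - be) * path_int (fun t => (h t * / (seg a b t - al))%C)
     + (z - al) * transform (fun t => (h t * ((seg a b t - be) / (seg a b t - al)))%C) a b z)%C.
Proof.
  intros Hh Hz Hc. unfold transform. assert (I := path_cont_inv_seg a b z Hz). assert (J := path_cont_inv_seg a b al Hc).
  assert (P : path_cont (fun t => (h t * ((seg a b t - be) / (seg a b t - al)))%C)).
  { apply path_cont_mult; [assumption|]. apply path_cont_mult; [|assumption].
    apply (path_cont_plus (seg a b) (fun _ => (- be)%C)); [apply path_cont_segid|apply path_cont_const]. }
  rewrite <- !path_int_scal by (apply path_cont_mult; assumption).
  rewrite <- path_int_plus.
  - apply path_int_ext. intros t Ht. assert (N1 := Cminus_ne _ _ (Hz t ltac:(lra))). assert (N2 := Cminus_ne _ _ (Hc t ltac:(lra))).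
    field. split; assumption.
  - apply path_cont_mult; [apply path_cont_const|now apply path_cont_mult].
  - apply path_cont_mult; [apply path_cont_const|]. now apply path_cont_mult.
Qed.

Lemma node_quot_path_cont L a b : (forall p t, In p L -> 0 <= t <= 1 -> seg a b t <> fst p) -> path_cont (fun t => node_quot L (seg a b t)).
Proof.
  induction L as [|p L IH]; intros H; simpl; [apply path_cont_const|].
  apply path_cont_mult; [|apply IH; intros; apply H; simpl; auto].
  apply path_cont_mult.
  - apply (path_cont_plus (seg a b) (fun _ => (- snd p)%C)); [apply path_cont_segid|apply path_cont_const].
  - apply path_cont_inv_seg. intros. apply H; simpl; auto.
Qed.

(** Iterating [transform_pair_step] leaves the products of the factors in front of the kernel;
    what is split off is a polynomial over the product of the poles. *)
Lemma transform_pairs L : forall h a b, path_cont h -> (forall p t, In p L -> 0 <= t <= 1 -> seg a b t <> fst p) ->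
  exists p, polyfun (length L) p /\ forall z, (forall t, 0 <= t <= 1 -> seg a b t <> z) ->
   (root_prod (map snd L) z * transform h a b z)%C = (p z + root_prod (map fst L) z * transform (fun t => (h t * node_quot L (seg a b t))%C) a b z)%C.
Proof.
  induction L as [|[al be] L IH]; intros h a b Hh HL.
  - exists (fun _ => 0%C). split; [apply polyfun_zero|]. intros z Hz. simpl.
    rewrite Cplus_0_l, !Cmult_1_l. apply path_int_ext. intros t _. ring.
  - assert (Hal : forall t, 0 <= t <= 1 -> seg a b t <> al) by (intros; apply (HL (al, be)); simpl; auto).
    set (h1 := fun t => (h t * ((seg a b t - be) / (seg a b t - al)))%C).
    assert (Hh1 : path_cont h1).
    { apply path_cont_mult; [assumption|]. apply path_cont_mult.
      - apply (path_cont_plus (seg a b) (fun _ => (- be)%C)); [apply path_cont_segid|apply path_cont_const].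
      - now apply path_cont_inv_seg. }
    destruct (IH h1 a b Hh1) as [p [Hp E]]; [intros; apply HL; simpl; auto|].
    set (c0 := ((al - be) * path_int (fun t => (h t * / (seg a b t - al))%C))%C).
    exists (fun z => (c0 * root_prod (map snd L) z + (z - al) * p z)%C). split.
    + simpl. apply polyfun_plus.
      * apply polyfun_scal. rewrite <- (length_map snd L). apply polyfun_root_prod.
      * now apply polyfun_linear_factor.
    + intros z Hz. simpl.
      replace ((z - be) * root_prod (map snd L) z * transform h a b z)%C with (root_prod (map snd L) z * ((z - be) * transform h a b z))%C by ring.
      rewrite (transform_pair_step h a b al be z Hh Hz Hal). fold c0. fold h1.
      replace (transform (fun t => (h t * ((seg a b t - be) / (seg a b t - al) * node_quot L (seg a b t)))%C) a b z)
        with (transform (fun t => (h1 t * node_quot L (seg a b t))%C) a b z)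
        by (apply path_int_ext; intros t _; unfold h1; ring).
      replace (root_prod (map snd L) z * (c0 + (z - al) * transform h1 a b z))%C with
        (root_prod (map snd L) z * c0 + (z - al) * (root_prod (map snd L) z * transform h1 a b z))%C by ring.
      rewrite (E z Hz). ring.
Qed.

Fixpoint prodR (n : nat) (x : nat -> R) : R := match n with 0%nat => 1 | S n => prodR n x * x n end.

Lemma prodR_range n x : (forall j, (j < n)%nat -> 0 <= x j <= 1) -> 0 <= prodR n x <= 1.
Proof.
  induction n as [|n IH]; intros H; simpl; [lra|].
  assert (A := IH (fun j Hj => H j ltac:(lia))). assert (B := H n ltac:(lia)). nra.
Qed.

Lemma prodR_window n x kap j0 W : 0 <= kap -> (forall j, (j < n)%nat -> 0 <= x j <= 1) ->
  (forall j, (j0 <= j < j0 + W)%nat -> x j <= kap) -> (j0 + W <= n)%nat -> prodR n x <= kap ^ W.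
Proof.
  intros Hk. revert W. induction n as [|n IH]; intros W Hx Hw HW.
  - replace W with 0%nat by lia. simpl. lra.
  - assert (A := prodR_range n x (fun j Hj => Hx j ltac:(lia))). assert (B := Hx n ltac:(lia)). simpl prodR.
    destruct W as [|W].
    + simpl. nra.
    + destruct (Nat.eq_dec (j0 + S W) (S n)) as [E|E].
      * assert (I := IH W (fun j Hj => Hx j ltac:(lia)) (fun j Hj => Hw j ltac:(lia)) ltac:(lia)).
        assert (D := Hw n ltac:(lia)). simpl. rewrite (Rmult_comm kap).
        apply Rmult_le_compat; lra.
      * assert (I := IH (S W) (fun j Hj => Hx j ltac:(lia)) Hw ltac:(lia)). nra.
Qed.

Lemma node_quot_app L K y : node_quot (L ++ K) y = (node_quot L y * node_quot K y)%C.
Proof. induction L as [|p L IH]; simpl; [ring|]. rewrite IH. ring. Qed.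

Lemma node_quot_seq (F : nat -> C * C) n y :
  Cmod (node_quot (map F (seq 0 n)) y) = prodR n (fun j => Cmod ((y - snd (F j)) / (y - fst (F j)))).
Proof.
  induction n as [|n IH]; [simpl; apply Cmod_1|].
  rewrite seq_S, map_app, node_quot_app, Cmod_mult, IH. simpl. rewrite Cmult_1_r. reflexivity.
Qed.

Section Corner.
Variables (Om : C -> Prop) (w0 d : C) (R0 sg delta sigma : R) (g : C -> C) (M : R).
Hypotheses (Hd : Cmod d = 1) (HOm : forall z, Om z -> Re ((z - w0) * Cconj d) < 0) (HR : 0 < R0) (Hsg : sg * sg = 1)
  (Hdel : 0 < delta) (Hsig : 0 < sigma).
Let P := (w0 + RtoC R0 * ((1, sg) * d))%C.
Hypotheses (Hg : cont_on (segset w0 P) g) (HM : 0 <= M)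
  (Hgb : forall t, 0 < t <= 1 -> Cmod (g (seg w0 P t)) <= M * Rpower t delta).

(** The mirror image at the corner comes first, the pole on the exterior bisector second. *)
Definition node_pair (b : R) : C * C := ((w0 - RtoC b * d)%C, (w0 + RtoC b * d)%C).

Lemma unit_mul_conj : (d * Cconj d)%C = 1%C.
Proof. rewrite <- Cmod2_conj, Hd. apply injective_projections; simpl; ring. Qed.

Lemma Cmod_rot z : Cmod z = Cmod (z * Cconj d).
Proof. rewrite Cmod_mult, Cmod_conj, Hd. ring. Qed.

(** The perpendicular bisector of the two points passes through the corner and leaves the
    polygon on the side of the mirror image. *)
Lemma node_pair_z z b : Om z -> 0 < b -> Cmod (z - fst (node_pair b)) <= Cmod (z - snd (node_pair b)) /\ 0 < Cmod (z - snd (node_pair b)).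
Proof.
  intros Hz Hb. rewrite (Cmod_rot (z - fst (node_pair b))), (Cmod_rot (z - snd (node_pair b))). unfold node_pair. simpl.
  replace ((z - (w0 - b * d)) * Cconj d)%C with ((z - w0) * Cconj d + RtoC b * (d * Cconj d))%C by ring.
  replace ((z - (w0 + b * d)) * Cconj d)%C with ((z - w0) * Cconj d - RtoC b * (d * Cconj d))%C by ring.
  rewrite unit_mul_conj. specialize (HOm z Hz). revert HOm. generalize ((z - w0) * Cconj d)%C. intros u Hu.
  split.
  - apply Rsqr_incr_0_var; [|apply Cmod_ge_0]. unfold Rsqr. rewrite !Cmod_sq. destruct u as [u1 u2]. simpl in *. nra.
  - apply Cmod_gt_0. intros E. assert (E1 : Re (u - b * 1)%C = 0) by (rewrite E; reflexivity).
    destruct u as [u1 u2]. simpl in *. lra.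
Qed.

Lemma seg_ccoord t : ((seg w0 P t - w0) * Cconj d)%C = (RtoC (t * R0) * (1, sg))%C.
Proof.
  unfold seg, P. replace ((w0 + t * (w0 + R0 * ((1, sg) * d) - w0) - w0) * Cconj d)%C with (t * R0 * (1, sg) * (d * Cconj d))%C by ring.
  rewrite unit_mul_conj, RtoC_mult. ring.
Qed.

Lemma node_pair_seg t b : Cmod (seg w0 P t - fst (node_pair b)) * Cmod (seg w0 P t - fst (node_pair b)) = (t * R0 + b) * (t * R0 + b) + t * R0 * (t * R0) /\
  Cmod (seg w0 P t - snd (node_pair b)) * Cmod (seg w0 P t - snd (node_pair b)) = (t * R0 - b) * (t * R0 - b) + t * R0 * (t * R0).
Proof.
  rewrite (Cmod_rot (seg w0 P t - fst (node_pair b))), (Cmod_rot (seg w0 P t - snd (node_pair b))). unfold node_pair. simpl fst. simpl snd.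
  replace ((seg w0 P t - (w0 - b * d)) * Cconj d)%C with ((seg w0 P t - w0) * Cconj d + RtoC b * (d * Cconj d))%C by ring.
  replace ((seg w0 P t - (w0 + b * d)) * Cconj d)%C with ((seg w0 P t - w0) * Cconj d - RtoC b * (d * Cconj d))%C by ring.
  rewrite unit_mul_conj, seg_ccoord, !Cmod_sq. generalize (t * R0). intros r. simpl.
  assert (E : (r * sg) * (r * sg) = r * r) by (replace (r * sg * (r * sg)) with (r * r * (sg * sg)) by ring; rewrite Hsg; ring).
  split; nra.
Qed.

Lemma node_pair_seg_ne t b : 0 <= t -> 0 < b -> 0 < Cmod (seg w0 P t - fst (node_pair b)).
Proof.
  intros Ht Hb. destruct (node_pair_seg t b) as [E _].
  assert (H := Cmod_ge_0 (seg w0 P t - fst (node_pair b))).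
  assert (0 <= t * R0) by (apply Rmult_le_pos; lra). nra.
Qed.

Lemma ratio_le1 t b : 0 <= t -> 0 < b -> 0 <= Cmod ((seg w0 P t - snd (node_pair b)) / (seg w0 P t - fst (node_pair b))) <= 1.
Proof.
  intros Ht Hb. assert (N := node_pair_seg_ne t b Ht Hb). destruct (node_pair_seg t b) as [E1 E2].
  split; [apply Cmod_ge_0|]. rewrite Cmod_div by (now apply Cmod_gt_0).
  assert (0 <= t * R0) by (apply Rmult_le_pos; lra).
  apply Rmult_le_reg_r with (Cmod (seg w0 P t - fst (node_pair b))); [assumption|].
  unfold Rdiv. rewrite Rmult_assoc, Rinv_l, Rmult_1_r, Rmult_1_l by lra.
  apply Rsqr_incr_0_var; [|lra]. unfold Rsqr. rewrite E1, E2. nra.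
Qed.

(** In units of the distance parameter [t R0], with [b] in [[1/2, 1]], the squared quotient [((1
    - b)^2 + 1)/((1 + b)^2 + 1)] is at most 5/13. *)
Lemma ratio_window t b : 0 < t -> t * R0 / 2 <= b <= t * R0 ->
  Cmod ((seg w0 P t - snd (node_pair b)) / (seg w0 P t - fst (node_pair b))) <= 3/4.
Proof.
  intros Ht Hb. assert (Hr : 0 < t * R0) by (apply Rmult_lt_0_compat; lra).
  assert (N := node_pair_seg_ne t b ltac:(lra) ltac:(lra)). destruct (node_pair_seg t b) as [E1 E2].
  rewrite Cmod_div by (now apply Cmod_gt_0).
  apply Rmult_le_reg_r with (Cmod (seg w0 P t - fst (node_pair b))); [assumption|].
  unfold Rdiv at 1. rewrite Rmult_assoc, Rinv_l, Rmult_1_r by lra.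
  apply Rsqr_incr_0_var; [|lra]. unfold Rsqr.
  replace (3 / 4 * Cmod (seg w0 P t - fst (node_pair b)) * (3 / 4 * Cmod (seg w0 P t - fst (node_pair b)))) with
    (9/16 * (Cmod (seg w0 P t - fst (node_pair b)) * Cmod (seg w0 P t - fst (node_pair b)))) by field.
  rewrite E1, E2. set (r := t * R0) in *. nra.
Qed.

Definition pole_dist (N j : nat) : R := R0 * exp (- sigma * INR j / sqrt (INR N)).

Lemma pole_dist_pos N j : 0 < pole_dist N j.
Proof. unfold pole_dist. apply Rmult_lt_0_compat; [assumption|apply exp_pos]. Qed.

(** The product of the factors in [y], over the outer half of the poles only. *)
Definition damping (N : nat) (t : R) : R := Cmod (node_quot (map (fun j => node_pair (pole_dist N j)) (seq 0 (N / 2))) (seg w0 P t)).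

(** The poles with distance between [t R0 / 2] and [t R0] from the corner have consecutive
    indices, [sqrt N . ln 2 / sigma] in number up to rounding.  The lower bound on [t] and the
    size of [N] ensure that all of them occur in the outer half. *)
Lemma damping_window N t : (6 <= N)%nat -> 8 * ln 2 / sigma <= sqrt (INR N) -> exp (- (sigma * sqrt (INR N) / 8)) <= t <= 1 ->
  damping N t <= 4/3 * exp (- (ln 2 * (- ln (3/4)) / sigma * sqrt (INR N))).
Proof.
  intros HN6 HNs Ht.
  assert (HN : 6 <= INR N) by (replace 6 with (INR 6) by (simpl; lra); now apply le_INR).
  set (q := sqrt (INR N)) in *. assert (Hq : 0 < q) by (apply sqrt_lt_R0; lra).
  assert (Hqq : q * q = INR N) by (apply sqrt_sqrt; lra).
  assert (Htp : 0 < t) by (eapply Rlt_le_trans; [apply exp_pos|apply Ht]).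
  assert (L2 : 0 < ln 2) by (rewrite <- ln_1; apply ln_increasing; lra).
  (* The indices j with X <= j <= X + Y are those whose pole has distance between t R0 / 2 and t R0;
     since X and Y are at most N / 8, they stay below N / 2. *)
  set (X := q * (- ln t) / sigma). set (Y := q * ln 2 / sigma).
  assert (Hlt : 0 <= - ln t).
  { assert (ln t <= ln 1) by (destruct (Rle_lt_or_eq_dec t 1) as [A|A]; [lra|left; apply ln_increasing; lra|rewrite A; lra]).
    rewrite ln_1 in H. lra. }
  assert (Hlt2 : - ln t <= sigma * q / 8).
  { assert (A : ln (exp (- (sigma * q / 8))) <= ln t).
    { destruct (Rle_lt_or_eq_dec _ _ (proj1 Ht)) as [B|B]; [left; apply ln_increasing; [apply exp_pos|exact B]|rewrite B; lra]. }
    rewrite ln_exp in A. lra. }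
  assert (HX : 0 <= X <= INR N / 8).
  { unfold X. split; [apply Rdiv_le_0_compat; [apply Rmult_le_pos; lra|lra]|].
    apply Rmult_le_reg_r with sigma; [assumption|]. unfold Rdiv at 1. rewrite Rmult_assoc, Rinv_l, Rmult_1_r by lra.
    rewrite <- Hqq. replace (q * q / 8 * sigma) with (q * (sigma * q / 8)) by field. apply Rmult_le_compat_l; lra. }
  assert (HY : 0 <= Y <= INR N / 8).
  { unfold Y. split; [apply Rdiv_le_0_compat; [apply Rmult_le_pos; lra|lra]|].
    rewrite <- Hqq. replace (q * ln 2 / sigma) with (q * (8 * ln 2 / sigma / 8)) by (field; lra).
    replace (q * q / 8) with (q * (q / 8)) by field. apply Rmult_le_compat_l; lra. }
  destruct (nfloor_ex X (proj1 HX)) as [j1 [J1 J2]]. destruct (nfloor_ex Y (proj1 HY)) as [W [W1 W2]].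
  assert (HN2 : INR N - 1 <= 2 * INR (N / 2)).
  { assert (A := Nat.div_mod_eq N 2). assert (B := Nat.mod_upper_bound N 2 ltac:(lia)).
    assert (D : (N <= 2 * (N / 2) + 1)%nat) by lia. apply le_INR in D. rewrite plus_INR, mult_INR in D. change (INR 1) with 1 in D. change (INR 2) with (1 + 1) in D. lra. }
  assert (Hw : damping N t <= (3/4) ^ W).
  { unfold damping. rewrite node_quot_seq. apply (prodR_window _ _ _ (S j1) W); [lra| | |].
    - intros j _. apply ratio_le1; [lra|apply pole_dist_pos].
    - intros j [A B]. apply le_INR in A. rewrite S_INR in A.
      assert (B' : (j + 1 <= S j1 + W)%nat) by lia. apply le_INR in B'. rewrite !plus_INR, (S_INR j1) in B'. change (INR 1) with 1 in B'.
      assert (U1 : X <= INR j <= X + Y) by lra.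
      assert (U2 : - ln t <= sigma * INR j / q <= - ln t + ln 2).
      { unfold X, Y in U1. destruct U1 as [U1 U1'].
        apply Rmult_le_compat_r with (r := sigma / q) in U1; [|apply Rdiv_le_0_compat; lra].
        apply Rmult_le_compat_r with (r := sigma / q) in U1'; [|apply Rdiv_le_0_compat; lra].
        replace (q * - ln t / sigma * (sigma / q)) with (- ln t) in U1 by (field; lra).
        replace ((q * - ln t / sigma + q * ln 2 / sigma) * (sigma / q)) with (- ln t + ln 2) in U1' by (field; lra).
        replace (INR j * (sigma / q)) with (sigma * INR j / q) in U1, U1' by (field; lra). lra. }
      apply ratio_window; [assumption|]. unfold pole_dist. fold q.
      replace (- sigma * INR j / q) with (- (sigma * INR j / q)) by (field; lra).
      set (e := sigma * INR j / q) in *.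
      assert (Ea : exp (- e) <= t).
      { rewrite <- (exp_ln t) by assumption. destruct (Rle_lt_or_eq_dec (- e) (ln t)) as [C1|C1]; [lra|left; now apply exp_increasing|rewrite C1; lra]. }
      assert (Eb : t / 2 <= exp (- e)).
      { assert (t / 2 = exp (ln t - ln 2)). { unfold Rminus. rewrite exp_plus, exp_Ropp, !exp_ln by lra. reflexivity. }
        rewrite H. destruct (Rle_lt_or_eq_dec (ln t - ln 2) (- e)) as [C1|C1]; [lra|left; now apply exp_increasing|rewrite C1; lra]. }
      split; nra.
    - apply INR_le. rewrite plus_INR, S_INR. lra. }
  eapply Rle_trans; [exact Hw|].
  (* Rounding costs at most one factor 3/4, whence the constant 4/3. *)
  set (lam := - ln (3/4)).
  assert (Hlam : 0 < lam). { unfold lam. assert (ln (3/4) < ln 1) by (apply ln_increasing; lra). rewrite ln_1 in H. lra. }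
  assert (E1 : (3/4) ^ W = exp (- (lam * INR W))).
  { rewrite <- Rpower_pow by lra. unfold Rpower, lam. f_equal. ring. }
  assert (E2 : 4/3 = exp lam). { unfold lam. rewrite exp_Ropp, exp_ln by lra. field. }
  rewrite E1, E2, <- exp_plus.
  replace (lam + - (ln 2 * lam / sigma * q)) with (- (lam * (Y - 1))) by (unfold Y; field; lra).
  assert (C0 : - (lam * INR W) <= - (lam * (Y - 1))).
  { apply Ropp_le_contravar. apply Rmult_le_compat_l; lra. }
  destruct (Rle_lt_or_eq_dec _ _ C0) as [C1|C1]; [left; now apply exp_increasing|rewrite C1; lra].
Qed.

Lemma damping_le1 N t : 0 <= t -> 0 <= damping N t <= 1.
Proof.
  intros Ht. unfold damping. rewrite node_quot_seq. apply prodR_range. intros j _. apply ratio_le1; [assumption|apply pole_dist_pos].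
Qed.

(** The first term comes from the poles comparable with the point of the leg, the second from
    the part of the leg too close to the corner for such poles to exist. *)
Definition rate : R := Rmin (ln 2 * (- ln (3/4)) / sigma) (sigma * delta / 16).

Lemma exp_le x y : x <= y -> exp x <= exp y.
Proof. intros H. destruct (Rle_lt_or_eq_dec _ _ H) as [C1|C1]; [left; now apply exp_increasing|rewrite C1; lra]. Qed.

(** For [t >= exp (- sigma sqrt N / 8)] the damping is effective; for smaller [t] the power of
    [t] takes over. *)
Lemma damping_power N t : (6 <= N)%nat -> 8 * ln 2 / sigma <= sqrt (INR N) -> 0 < t <= 1 ->
  Rpower t (delta / 2) * damping N t <= 4/3 * exp (- rate * sqrt (INR N)).
Proof.
  intros HN HNs Ht. set (q := sqrt (INR N)) in *.
  assert (Hq : 0 <= q) by apply sqrt_pos.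
  assert (Hpsi := damping_le1 N t ltac:(lra)).
  assert (Hlt : ln t <= 0).
  { rewrite <- ln_1. destruct (Rle_lt_or_eq_dec t 1) as [A|A]; [lra|left; apply ln_increasing; lra|rewrite A; lra]. }
  assert (Hp1 : 0 < Rpower t (delta / 2) <= 1).
  { split; [apply exp_pos|]. rewrite <- exp_0. apply exp_le. nra. }
  destruct (Rle_dec (exp (- (sigma * q / 8))) t) as [A|A].
  - assert (H := damping_window N t HN HNs (conj A (proj2 Ht))). fold q in H.
    apply Rle_trans with (damping N t); [nra|]. eapply Rle_trans; [exact H|].
    apply Rmult_le_compat_l; [lra|]. apply exp_le.
    assert (rate <= ln 2 * - ln (3 / 4) / sigma) by apply Rmin_l. nra.
  - assert (B : ln t < - (sigma * q / 8)).
    { apply Rnot_le_lt in A. apply ln_increasing in A; [|lra]. now rewrite ln_exp in A. }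
    assert (D : Rpower t (delta / 2) <= exp (- rate * q)).
    { apply exp_le. assert (rate <= sigma * delta / 16) by apply Rmin_r.
      assert (delta / 2 * ln t <= delta / 2 * (- (sigma * q / 8))) by (apply Rmult_le_compat_l; lra). nra. }
    assert (0 < exp (- rate * q)) by apply exp_pos. nra.
Qed.

Lemma rate_pos : 0 < rate.
Proof.
  unfold rate. apply Rmin_pos.
  - apply Rdiv_lt_0_compat; [|assumption]. apply Rmult_lt_0_compat.
    + rewrite <- ln_1. apply ln_increasing; lra.
    + assert (ln (3/4) < ln 1) by (apply ln_increasing; lra). rewrite ln_1 in H. lra.
  - apply Rdiv_lt_0_compat; [|lra]. now apply Rmult_lt_0_compat.
Qed.

Lemma root_prod_node_pair_le z (B : nat -> R) l : Om z -> (forall j, 0 < B j) ->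
  Cmod (root_prod (map fst (map (fun j => node_pair (B j)) l)) z) <= Cmod (root_prod (map snd (map (fun j => node_pair (B j)) l)) z) /\
  0 < Cmod (root_prod (map snd (map (fun j => node_pair (B j)) l)) z).
Proof.
  intros Hz HB. induction l as [|j l IH]; [cbn; rewrite Cmod_1; lra|].
  cbn [map root_prod fold_right]. fold (root_prod (map fst (map (fun j => node_pair (B j)) l)) z).
  fold (root_prod (map snd (map (fun j => node_pair (B j)) l)) z). rewrite !Cmod_mult.
  destruct (node_pair_z z (B j) Hz (HB j)) as [A1 A2]. destruct IH as [I1 I2]. split.
  - apply Rmult_le_compat; try apply Cmod_ge_0; assumption.
  - now apply Rmult_lt_0_compat.
Qed.

(** Projection to the exterior bisector: the leg has coordinate [t R0] there and the polygon a
    negative one. *)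
Lemma leg_dist z t : Om z -> 0 <= t -> t * R0 <= Cmod (seg w0 P t - z) /\ seg w0 P t <> z.
Proof.
  intros Hz Ht. assert (E : t * R0 < Re ((seg w0 P t - z) * Cconj d)%C).
  { replace ((seg w0 P t - z) * Cconj d)%C with ((seg w0 P t - w0) * Cconj d - (z - w0) * Cconj d)%C by ring.
    rewrite seg_ccoord. specialize (HOm z Hz). revert HOm. generalize ((z - w0) * Cconj d)%C. generalize (t * R0).
    intros r u Hu. unfold Re in *. simpl in *. lra. }
  assert (F : Re ((seg w0 P t - z) * Cconj d)%C <= Cmod (seg w0 P t - z)).
  { rewrite Cmod_rot. eapply Rle_trans; [apply Rle_abs|apply re_le_Cmod]. }
  split; [lra|]. intros K. assert (0 <= t * R0) by (apply Rmult_le_pos; lra).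
  assert (Z : Cmod (seg w0 P t - z) = 0) by (rewrite K; apply Cmod_self). lra.
Qed.

(** One half of the exponent [delta] pays for the smallness, the other half for the
    integrability of [t^(delta - 1)], which arises since the kernel is as large as [1/(t R0)]. *)
Lemma corner_approx N : (6 <= N)%nat -> 8 * ln 2 / sigma <= sqrt (INR N) ->
  exists p, polyfun (N / 2) p /\ forall z, Om z ->
    0 < Cmod (root_prod (map (clustered_point w0 d R0 sigma N) (seq 0 (N / 2))) z) /\
    Cmod (seg_int (fun y => (g y * kernel z y)%C) w0 P - p z / root_prod (map (clustered_point w0 d R0 sigma N) (seq 0 (N / 2))) z)
      <= (Cmod (P - w0) * M / R0 * (4/3) / (delta / 2)) * exp (- rate * sqrt (INR N)).
Proof.
  intros HN HNs.
  set (L := map (fun j => node_pair (pole_dist N j)) (seq 0 (N / 2))).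
  set (h := fun t => ((P - w0) * g (seg w0 P t))%C).
  assert (Hh : path_cont h) by (apply path_cont_mult; [apply path_cont_const|]; eapply path_cont_of_cont_on; eauto).
  assert (HL : forall p t, In p L -> 0 <= t <= 1 -> seg w0 P t <> fst p).
  { intros p t Hp Ht. unfold L in Hp. apply in_map_iff in Hp. destruct Hp as [j [<- _]].
    assert (X := node_pair_seg_ne t (pole_dist N j) ltac:(lra) (pole_dist_pos N j)). intros K. rewrite K in X.
    replace (fst (node_pair (pole_dist N j)) - fst (node_pair (pole_dist N j)))%C with (RtoC 0) in X by ring. rewrite Cmod_0 in X. lra. }
  destruct (transform_pairs L h w0 P Hh HL) as [p [Hp E]].
  assert (LL : length L = (N / 2)%nat) by (unfold L; rewrite length_map, length_seq; reflexivity).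
  rewrite LL in Hp. exists p. split; [assumption|]. intros z Hz.
  assert (EL : map (clustered_point w0 d R0 sigma N) (seq 0 (N / 2)) = map snd L).
  { unfold L. rewrite map_map. apply map_ext. intros j. reflexivity. }
  rewrite EL. destruct (root_prod_node_pair_le z (pole_dist N) (seq 0 (N / 2)) Hz (pole_dist_pos N)) as [Q1 Q2]. fold L in Q1, Q2.
  split; [assumption|].
  assert (Av : forall t, 0 <= t <= 1 -> seg w0 P t <> z) by (intros t Ht; apply leg_dist; [assumption|lra]).
  assert (EC : seg_int (fun y => (g y * kernel z y)%C) w0 P = transform h w0 P z).
  { apply path_int_ext. intros t _. unfold h, kernel. ring. }
  rewrite EC. specialize (E z Av). set (D := root_prod (map snd L) z) in *. set (A := root_prod (map fst L) z) in *.
  set (J := transform (fun t => (h t * node_quot L (seg w0 P t))%C) w0 P z) in *.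
  assert (ND : D <> 0%C) by (now apply Cmod_gt_0).
  replace (transform h w0 P z - p z / D)%C with (A / D * J)%C.
  2:{ replace (transform h w0 P z) with ((D * transform h w0 P z) / D)%C by (field; assumption). rewrite E. field. assumption. }
  rewrite Cmod_mult, Cmod_div by assumption.
  assert (AD : 0 <= Cmod A / Cmod D <= 1).
  { split; [apply Rdiv_le_0_compat; [apply Cmod_ge_0|assumption]|].
    apply Rmult_le_reg_r with (Cmod D); [assumption|]. unfold Rdiv. rewrite Rmult_assoc, Rinv_l by lra. lra. }
  apply Rle_trans with (Cmod J).
  { rewrite <- (Rmult_1_l (Cmod J)) at 2. apply Rmult_le_compat_r; [apply Cmod_ge_0|lra]. }
  set (Bc := Cmod (P - w0) * M / R0).
  assert (HBc : 0 <= Bc) by (unfold Bc; apply Rdiv_le_0_compat; [apply Rmult_le_pos; [apply Cmod_ge_0|assumption]|assumption]).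
  replace (Bc * (4/3) / (delta / 2) * exp (- rate * sqrt (INR N))) with ((Bc * (4/3 * exp (- rate * sqrt (INR N)))) / (delta / 2)) by (field; lra).
  apply path_int_power.
  - apply path_cont_mult; [|now apply path_cont_inv_seg]. apply path_cont_mult; [assumption|now apply node_quot_path_cont].
  - apply Rmult_le_pos; [assumption|]. generalize (exp_pos (- rate * sqrt (INR N))). lra.
  - lra.
  - intros t Ht. assert (N1 := Cminus_ne _ _ (Av t ltac:(lra))).
    rewrite !Cmod_mult, Cmod_inv by assumption.
    change (Cmod (node_quot L (seg w0 P t))) with (damping N t).
    unfold h. rewrite Cmod_mult.
    assert (Fz := proj1 (leg_dist z t Hz ltac:(lra))). assert (tR : 0 < t * R0) by (apply Rmult_lt_0_compat; lra).
    assert (Iz : / Cmod (seg w0 P t - z) <= / (t * R0)) by (apply Rinv_le_contravar; assumption).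
    assert (Hpsi := damping_le1 N t ltac:(lra)). assert (Hpp := damping_power N t HN HNs Ht).
    assert (Hgt := Hgb t Ht).
    apply Rle_trans with (Cmod (P - w0) * (M * Rpower t delta) * damping N t * / (t * R0)).
    + apply Rmult_le_compat.
      * repeat apply Rmult_le_pos; try apply Cmod_ge_0; lra.
      * left. apply Rinv_0_lt_compat. lra.
      * apply Rmult_le_compat_r; [lra|]. apply Rmult_le_compat_l; [apply Cmod_ge_0|assumption].
      * assumption.
    + assert (Et : Rpower t delta * / t = Rpower t (delta / 2) * Rpower t (delta / 2 - 1)).
      { rewrite <- Rpower_plus. replace (delta / 2 + (delta / 2 - 1)) with (delta + - (1)) by field.
        rewrite Rpower_plus, Rpower_Ropp, Rpower_1 by lra. reflexivity. }
      replace (Cmod (P - w0) * (M * Rpower t delta) * damping N t * / (t * R0)) with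
        (Bc * damping N t * (Rpower t delta * / t)) by (unfold Bc; field; lra).
      rewrite Et.
      assert (0 < Rpower t (delta / 2 - 1)) by apply exp_pos.
      replace (Bc * damping N t * (Rpower t (delta / 2) * Rpower t (delta / 2 - 1))) with
        (Bc * (Rpower t (delta / 2) * damping N t) * Rpower t (delta / 2 - 1)) by ring.
      apply Rmult_le_compat_r; [lra|]. apply Rmult_le_compat_l; assumption.
Qed.
End Corner.

(** * Choice of the contour *)

Lemma fin_choice {A : Type} (m : nat) (P : nat -> A -> Prop) : inhabited A ->
  (forall k, (k < m)%nat -> exists x, P k x) -> exists f, forall k, (k < m)%nat -> P k (f k).
Proof.
  intros i H. exists (fun k => epsilon i (P k)). intros k Hk. apply epsilon_spec. now apply H.
Qed.

Lemma cauchy_int_geom_approx Om a b g B : well_separated Om a b -> (forall z, Om z -> Cmod z <= B) -> cont_on (segset a b) g ->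
  geom_approx Om (fun z => cauchy_int z a b g).
Proof.
  intros Hf HB Hg. apply (geom_approx_ext Om (transform (fun t => ((b - a) * g (seg a b t))%C) a b)).
  - intros z _. apply path_int_ext. intros t _. unfold kernel. ring.
  - apply (well_separated_geom_approx Om a b _ B); try assumption. apply path_cont_mult; [apply path_cont_const|]. eapply path_cont_of_cont_on; eauto.
Qed.

Lemma small_seg m w k sg p o : 0 < tilt m w k sg p -> exists e, 0 < e /\ forall x, 0 < x <= e -> 0 < tilt m w k sg (seg p o x).
Proof.
  intros Hp. destruct (small_quadratic _ (tilt m w k sg o - tilt m w k sg p) 0 Hp) as [e [He H]]. exists e. split; [assumption|].
  intros x Hx. specialize (H x Hx). rewrite tilt_seg. lra.
Qed.

Lemma small_seg_opp m w k sg p o : 0 < tilt m w k sg p -> exists e, 0 < e /\ forall x, 0 < x <= e -> 0 < tilt m w k sg (seg p o (- x)).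
Proof.
  intros Hp. destruct (small_quadratic _ (tilt m w k sg p - tilt m w k sg o) 0 Hp) as [e [He H]]. exists e. split; [assumption|].
  intros x Hx. specialize (H x Hx). rewrite tilt_seg. lra.
Qed.

Section Constants.
Variables (m : nat) (w : nat -> C) (f : C -> C) (delta : R).
Hypotheses (Hpoly : convex_polygon m w) (Hf : analytic_on (polygon_region m w) f)
  (Hsides : forall (k : nat) (p : C), (k < m)%nat -> open_side m w k p ->
     extends_near (polygon_region m w) f p)
  (Hdelta : 0 < delta)
  (Hcorners : forall k : nat, (k < m)%nat ->
     corner_continuation (polygon_region m w) f (w k) (exterior_bisector m w k) delta).
Notation Om := (polygon_region m w).
Notation o := (center w).
Notation nx := (next m).
Notation d := (exterior_bisector m w).

(** A Lebesgue number for the disks of continuation that cover a compact part of the side. *)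
Lemma side_extension k t0 : (k < m)%nat -> 0 < t0 < 1/2 -> exists eta, 0 < eta /\ forall t, t0 <= t <= 1 - t0 ->
  exists F, holo (disk (side_pt m w k t) eta) F /\ forall y, disk (side_pt m w k t) eta y -> Om y -> F y = f y.
Proof.
  intros Hk Ht0.
  assert (H : forall t, exists eps : posreal, t0 <= t <= 1 - t0 -> exists F, holo (disk (side_pt m w k t) eps) F /\
      forall y, disk (side_pt m w k t) eps y -> Om y -> F y = f y).
  { intros t. destruct (classic (t0 <= t <= 1 - t0)) as [Ht|Ht].
    - destruct (Hsides k (side_pt m w k t) Hk) as [e [F [He [H1 H2]]]].
      + exists t. split; [lra|]. unfold side_pt, seg, side. reflexivity.
      + exists (mkposreal e He). intros _. exists F. split; [now apply analytic_holo|assumption].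
    - exists (mkposreal 1 Rlt_0_1). tauto. }
  set (eps := fun t => epsilon (inhabits (mkposreal 1 Rlt_0_1)) (fun e : posreal => t0 <= t <= 1 - t0 -> exists F, holo (disk (side_pt m w k t) e) F /\
      forall y, disk (side_pt m w k t) e y -> Om y -> F y = f y)).
  assert (Heps : forall t, t0 <= t <= 1 - t0 -> exists F, holo (disk (side_pt m w k t) (eps t)) F /\
      forall y, disk (side_pt m w k t) (eps t) y -> Om y -> F y = f y).
  { intros t. exact (epsilon_spec (inhabits (mkposreal 1 Rlt_0_1)) _ (H t)). }
  set (c := Cmod (side m w k) + 1). assert (Hc : 0 < c) by (unfold c; generalize (Cmod_ge_0 (side m w k)); lra).
  assert (Hgp : forall t, 0 < eps t / (2 * c)) by (intros t; apply Rdiv_lt_0_compat; [apply cond_pos|lra]).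
  destruct (compactness_value_1d t0 (1 - t0) (fun t => mkposreal _ (Hgp t))) as [g Hg].
  assert (Hg0 := cond_pos g).
  exists (g * c). split; [now apply Rmult_lt_0_compat|]. intros x Hx.
  destruct (NNPP _ (Hg x Hx)) as [t [Ht [H1 H2]]]. simpl in H1, H2.
  destruct (Heps t Ht) as [F [F1 F2]].
  assert (Sub : forall y, disk (side_pt m w k x) (g * c) y -> disk (side_pt m w k t) (eps t) y).
  { intros y Hy. unfold disk in *. eapply Rle_lt_trans; [apply (Cmod_tri3 _ (side_pt m w k x))|].
    unfold side_pt in *. rewrite Cmod_seg_diff. fold (side m w k).
    apply Rmult_lt_compat_r with (r := c) in H1; [|assumption]. apply Rmult_le_compat_r with (r := c) in H2; [|lra].
    replace (eps t / (2 * c) * c) with (eps t / 2) in H1, H2 by (field; lra).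
    assert (Rabs (x - t) * Cmod (side m w k) <= Rabs (x - t) * c) by (apply Rmult_le_compat_l; [apply Rabs_pos|unfold c; lra]).
    lra. }
  exists F. split.
  - eapply holo_sub; [|exact F1]. assumption.
  - intros y Hy. apply F2. now apply Sub.
Qed.

(** The data of a corner with the disk shrunk so that the Hoelder bound holds on all of it. *)
Definition corner_data (k : nat) (x : R * (C -> C) * C * R) : Prop :=
  let '(s, F, L, M) := x in 0 < s /\ 0 <= M /\ holo (slit_disk (w k) s (d k)) F /\
   (forall y, slit_disk (w k) s (d k) y -> Om y -> F y = f y) /\
   forall y, slit_disk (w k) s (d k) y -> Cmod (F y - L) <= M * Rpower (Cmod (y - w k)) delta.

Lemma slit_disk_sub c s s' u y : s <= s' -> slit_disk c s u y -> slit_disk c s' u y.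
Proof. intros H [H1 H2]. split; [unfold disk in *; lra|assumption]. Qed.

Lemma corner_data_ex k : (k < m)%nat -> exists x, corner_data k x.
Proof.
  intros Hk. destruct (Hcorners k Hk) as [s [F [L [Hs [[H1 H2] [_ [M [eps [Heps HM]]]]]]]]].
  exists (Rmin s eps, F, L, Rmax 0 M). split; [now apply Rmin_pos|]. split; [apply Rmax_l|].
  assert (Sub : forall y, slit_disk (w k) (Rmin s eps) (d k) y -> slit_disk (w k) s (d k) y).
  { intros y. apply slit_disk_sub, Rmin_l. }
  split; [|split].
  - eapply holo_sub; [|apply analytic_holo; exact H1]. assumption.
  - intros y Hy. apply H2. now apply Sub.
  - intros y Hy. eapply Rle_trans; [apply HM; [now apply Sub|]|].
    + destruct Hy as [Hy _]. unfold disk in *. generalize (Rmin_r s eps). lra.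
    + apply Rmult_le_compat_r; [left; apply exp_pos|apply Rmax_r].
Qed.

(** Everything but the leg integrals of the corner oscillations is put into [Rest].  One length
    [R0] for all corners serves at the same time as the scale of the poles. *)
Theorem cauchy_representation : exists (R0 : R) (W : C) (G : nat -> C -> C) (Rest : C -> C),
  0 < R0 /\ W <> 0%C /\
  (forall j k, (j < m)%nat -> (k < m)%nat -> j <> k -> 2 * R0 < Cmod (w j - w k)) /\
  geom_approx Om Rest /\
  (forall k sg, (k < m)%nat -> (sg = 1 \/ sg = -1) -> cont_on (segset (w k) (leg_end m w R0 k sg)) (G k) /\
     exists M, 0 <= M /\ forall t, 0 < t <= 1 -> Cmod (G k (seg (w k) (leg_end m w R0 k sg) t)) <= M * Rpower t delta) /\
  forall z, Om z -> (W * f z)%C =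
    (csum m (fun k => (cauchy_int z (w k) (leg_end m w R0 k 1) (G k) + (-(1)) * cauchy_int z (w k) (leg_end m w R0 k (-1)) (G k))%C) + Rest z)%C.
Proof.
  assert (H3 := three_corners m w Hpoly).
  destruct (fin_choice m corner_data (inhabits (1, (fun x => x), RtoC 0, 1)) corner_data_ex) as [cd Hcd].
  set (sk := fun k => fst (fst (fst (cd k)))). set (Fk := fun k => snd (fst (fst (cd k)))).
  set (Lk := fun k => snd (fst (cd k))). set (Mk := fun k => snd (cd k)).
  assert (Hk' : forall k, (k < m)%nat -> 0 < sk k /\ 0 <= Mk k /\ holo (slit_disk (w k) (sk k) (d k)) (Fk k) /\
   (forall y, slit_disk (w k) (sk k) (d k) y -> Om y -> Fk k y = f y) /\
   forall y, slit_disk (w k) (sk k) (d k) y -> Cmod (Fk k y - Lk k) <= Mk k * Rpower (Cmod (y - w k)) delta).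
  { intros k Hk. specialize (Hcd k Hk). unfold sk, Fk, Lk, Mk. destruct (cd k) as [[[s F] L] M]. exact Hcd. }
  (* The limit is inserted as value at the corner, which makes the continuation continuous at the tip of
     the legs. *)
  set (Fc := fun k y => if excluded_middle_informative (y = w k) then Lk k else Fk k y).
  assert (Fcw : forall k, Fc k (w k) = Lk k) by (intros k; unfold Fc; now destruct excluded_middle_informative).
  assert (Fcn : forall k y, y <> w k -> Fc k y = Fk k y) by (intros k y Hy; unfold Fc; now destruct excluded_middle_informative).
  assert (Sne : forall k s y, slit_disk (w k) s (d k) y -> y <> w k).
  { intros k s y [_ H] E. apply (H 0); [lra|]. rewrite E. ring. }
  (* The corner disks must miss the centre, where the winding integral is evaluated. *)
  destruct (unif_small m (fun k s => s <= sk k /\ s <= Cmod (o - w k))) as [s [Hs Hss]].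
  { intros k Hk. exists (Rmin (sk k) (Cmod (o - w k))). split.
    - apply Rmin_pos; [apply Hk'; assumption|]. apply Cmod_gt_0. apply Cminus_ne.
      intros E. assert (A := center_height m w Hpoly k Hk). rewrite E, height_self in A. lra.
    - intros x [_ Hx]. split; eapply Rle_trans; try exact Hx; [apply Rmin_l|apply Rmin_r]. }
  (* The legs stay in the corner disks, poles of different corners stay apart, and the insets lie in the
     polygon, in counterclockwise order around the centre, those of the ends of a side being lower than
     the centre over that side. *)
  destruct (unif_small m (fun k x => 2 * x < s /\ (forall j, (j < m)%nat -> j <> k -> 2 * x < Cmod (w j - w k)) /\
     Om (inset m w x k) /\ height m w k (inset m w x k) < height m w k o /\ height m w k (inset m w x (nx k)) < height m w k o /\
     0 < cross (inset m w x k - o) (inset m w x (nx k) - inset m w x k))) as [R0 [HR0 HR]].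
  { intros k Hk. assert (Ho := center_height m w Hpoly k Hk).
    repeat apply small_and.
    - destruct (small_lt (s / 2)) as [e [He H]]; [lra|]. exists e. split; [assumption|]. intros x Hx. specialize (H x Hx). lra.
    - destruct (unif_small m (fun j e => forall x, 0 < x <= e -> j <> k -> 2 * x < Cmod (w j - w k))) as [e [He H]].
      + intros j Hj. destruct (Nat.eq_dec j k) as [->|N]; [exists 1; split; [lra|]; intros; congruence|].
        assert (P : 0 < Cmod (w j - w k)).
        { apply Cmod_gt_0, Cminus_ne. now apply (corners_distinct m w Hpoly). }
        exists (Cmod (w j - w k) / 4). split; [lra|]. intros; lra.
      + exists e. split; [assumption|]. intros x Hx j Hj. now apply (H j Hj).
    - now apply bis_inward.
    - destruct (small_mul_lt (height m w k o) (- cross (side m w k) (d k)) Ho) as [e [He H]]. exists e. split; [assumption|].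
      intros x Hx. replace (height m w k (inset m w x k)) with (x * - cross (side m w k) (d k)); [now apply H|].
      unfold height, inset, cross. simpl. ring.
    - destruct (small_mul_lt (height m w k o) (- cross (side m w k) (d (nx k))) Ho) as [e [He H]]. exists e. split; [assumption|].
      intros x Hx. replace (height m w k (inset m w x (nx k))) with (x * - cross (side m w k) (d (nx k))); [now apply H|].
      unfold height, inset, side, cross. simpl. ring.
    - destruct (small_quadratic (height m w k o) (- (cross (w k - o) (d (nx k) - d k) + cross (d k) (side m w k))) (cross (d k) (d (nx k) - d k)) Ho) as [e [He H]].
      exists e. split; [assumption|]. intros x Hx. specialize (H x Hx).
      eapply Rlt_le_trans; [exact H|right].
      unfold height, inset, side. generalize (d k) (d (nx k)) (w k) (w (nx k)) o. intros a b c e' g. unfold cross. simpl. ring. }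
  assert (HR2 : 2 * R0 < s) by apply (HR 0%nat ltac:(lia)).
  assert (HQ := fun k Hk => proj2 (proj2 (HR k Hk))).
  (* The strip along a side begins and ends at parameters whose points are well inside the corner disks. *)
  destruct (unif_small m (fun k x => x < 1/2 /\ x * Cmod (side m w k) < s / 2)) as [t0 [Ht00 Ht01]].
  { intros k Hk. apply small_and; [apply small_lt; lra|apply small_mul_lt; lra]. }
  assert (Ht0 : 0 < t0 < 1/2) by (split; [assumption|apply (Ht01 0%nat ltac:(lia))]).
  assert (Ht0s := fun k Hk => proj2 (Ht01 k Hk)).
  (* Between these parameters the side is compact, so that a common radius of continuation exists; it
     depends on t0, because the radius may tend to zero at the corners. *)
  destruct (unif_small m (fun k x => (forall t, t0 <= t <= 1 - t0 -> x <= Cmod (o - side_pt m w k t)) /\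
     forall t, t0 <= t <= 1 - t0 -> exists F, holo (disk (side_pt m w k t) x) F /\ forall y, disk (side_pt m w k t) x y -> Om y -> F y = f y))
    as [eta [Heta Heta1]].
  { intros k Hk. apply small_and.
    - assert (Ho := center_height m w Hpoly k Hk). set (c := Cmod (side m w k)). assert (Hc : 0 <= c) by apply Cmod_ge_0.
      exists (height m w k o / (c + 1)). split; [apply Rdiv_lt_0_compat; lra|]. intros x [Hx0 Hx] t Ht.
      assert (X := cross_le (side m w k) (o - side_pt m w k t)). rewrite <- height_diff, side_pt_height_self in X. fold c in X.
      rewrite Rminus_0_r, Rabs_right in X by lra.
      eapply Rle_trans; [exact Hx|]. apply Rmult_le_reg_r with (c + 1); [lra|].
      replace (height m w k o / (c + 1) * (c + 1)) with (height m w k o) by (field; lra).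
      generalize (Cmod_ge_0 (o - side_pt m w k t)). nra.
    - destruct (side_extension k t0 Hk Ht0) as [e [He H]]. exists e. split; [assumption|]. intros x Hx t Ht.
      destruct (H t Ht) as [F [F1 F2]]. exists F.
      assert (Sub : forall y, disk (side_pt m w k t) x y -> disk (side_pt m w k t) e y) by (intros y Hy; unfold disk in *; lra).
      split; [eapply holo_sub; [|exact F1]; assumption|]. intros y Hy. apply F2. now apply Sub. }
  assert (Hetao := fun k t Hk => proj1 (Heta1 k Hk) t).
  assert (HetaF := fun k t Hk => proj2 (Heta1 k Hk) t).
  (* The strip is thin compared with these radii, and its ends remain in the half disks, which contain a
     neighbourhood of the end points on the side. *)
  destruct (unif_small m (fun k x => x < 1 /\ x * (Cmod (o - w k) + Cmod (side m w k)) < s / 2 /\ x * (Cmod (o - w k) + Cmod (side m w k)) < eta / 2 /\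
     0 < tilt m w k 1 (seg (side_pt m w k t0) o x) /\ 0 < tilt m w k 1 (seg (side_pt m w k t0) o (- x)) /\
     0 < tilt m w (nx k) (-1) (seg (side_pt m w k (1 - t0)) o x) /\ 0 < tilt m w (nx k) (-1) (seg (side_pt m w k (1 - t0)) o (- x))))
    as [tau [Htau0 Htau4]].
  { intros k Hk.
    assert (Lp : 0 < tilt m w k 1 (side_pt m w k t0)).
    { unfold side_pt. rewrite tilt_seg, tilt_self. destruct (ccoord_next m w Hpoly k Hk) as [A B].
      assert (0 < tilt m w k 1 (w (nx k))) by (unfold tilt; lra). nra. }
    assert (Lm : 0 < tilt m w (nx k) (-1) (side_pt m w k (1 - t0))).
    { rewrite (side_pt_rev m) by assumption. rewrite tilt_seg, tilt_self.
      assert (Hn := next_lt m w Hpoly k Hk). destruct (ccoord_prev m w Hpoly (nx k) Hn) as [A B].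
      rewrite (prev_next m w Hpoly k Hk) in A, B.
      assert (0 < tilt m w (nx k) (-1) (w k)) by (unfold tilt; lra). nra. }
    repeat apply small_and; try (apply small_mul_lt; lra); try (now apply small_seg); try (now apply small_seg_opp). apply small_lt; lra. }
  assert (Htau : 0 < tau < 1) by (split; [assumption|apply (Htau4 0%nat ltac:(lia))]).
  assert (Htau2 : forall k t, (k < m)%nat -> 0 <= t <= 1 -> tau * Cmod (o - side_pt m w k t) < s / 2 /\ tau * Cmod (o - side_pt m w k t) < eta / 2).
  { intros k t Hk Ht. destruct (Htau4 k Hk) as [_ [A [B _]]].
    assert (D : Cmod (o - side_pt m w k t) <= Cmod (o - w k) + Cmod (side m w k)).
    { eapply Rle_trans; [apply (Cmod_tri3 _ (w k))|]. apply Rplus_le_compat_l. unfold side_pt.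
      rewrite <- (seg_0 (w k) (w (nx k))) at 1. rewrite Cmod_seg_diff. fold (side m w k).
      replace (0 - t) with (- t) by ring. rewrite Rabs_Ropp, Rabs_right by lra. generalize (Cmod_ge_0 (side m w k)). nra. }
    assert (tau * Cmod (o - side_pt m w k t) <= tau * (Cmod (o - w k) + Cmod (side m w k))) by (apply Rmult_le_compat_l; lra). lra. }
  assert (Htau3 := fun k Hk => proj2 (proj2 (proj2 (Htau4 k Hk)))).
  (* The cells of the strip are short enough for each to fit into one disk of continuation. *)
  destruct (unif_small m (fun k e => forall x, 0 < x <= e -> x * Cmod (side m w k) < eta / 2)) as [x0 [Hx0 Hx1]].
  { intros k Hk. destruct (small_mul_lt (eta / 2) (Cmod (side m w k))) as [e [He H]]; [lra|].
    exists e. split; [assumption|]. intros x Hx y Hy. apply H. lra. }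
  destruct (nfloor_ex (/ x0)) as [n [_ Hn]]; [left; now apply Rinv_0_lt_compat|].
  assert (HN : forall k, (k < m)%nat -> Cmod (side m w k) / INR (S n) < eta / 2).
  { intros k Hk. rewrite S_INR. unfold Rdiv at 1. rewrite Rmult_comm. apply Hx1; [assumption|].
    assert (0 < / x0) by (now apply Rinv_0_lt_compat).
    split; [apply Rinv_0_lt_compat; lra|]. rewrite <- (Rinv_inv x0). apply Rinv_le_contravar; lra. }
  destruct (fin_choice m (fun k (F : nat -> C -> C) => forall i, (i <= n)%nat -> holo (side_disk m w t0 eta n k i) (F i) /\
     (forall y : C, side_disk m w t0 eta n k i y -> Om y -> F i y = f y))) as [Fs HFs0].
  { exact (inhabits (fun _ x => x)). }
  { intros k Hk. destruct (fin_choice (S n) (fun i (F : C -> C) => holo (side_disk m w t0 eta n k i) F /\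
     (forall y : C, side_disk m w t0 eta n k i y -> Om y -> F y = f y))) as [F HF].
    - exact (inhabits (fun x => x)).
    - intros i Hi. apply (HetaF k (node_time t0 n i) Hk). apply node_time_range; auto; lia.
    - exists F. intros i Hi. apply HF. lia. }
  assert (HFs : forall k i, (k < m)%nat -> (i <= n)%nat -> holo (side_disk m w t0 eta n k i) (Fs k i) /\
     (forall y : C, side_disk m w t0 eta n k i y -> Om y -> Fs k i y = f y)) by (intros; now apply HFs0).
  assert (HFf : holo Om f) by (now apply analytic_holo).
  assert (HFc : forall k, (k < m)%nat -> holo (slit_disk (w k) s (d k)) (Fc k) /\
     forall y, slit_disk (w k) s (d k) y -> Om y -> Fc k y = f y).
  { intros k Hk. destruct (Hk' k Hk) as [_ [_ [A [B _]]]]. assert (Sub := fun y => slit_disk_sub (w k) s (sk k) (d k) y (proj1 (Hss k Hk))).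
    split.
    - intros y Hy. assert (Ny := Sne k s y Hy). destruct (A y (Sub y Hy)) as [l Hl]. exists l.
      apply (cderiv_local (Fk k) _ _ _ (Cmod (y - w k))); [apply Cmod_gt_0; now apply Cminus_ne| |assumption].
      intros x Hx. symmetry. apply Fcn. intros ->. rewrite Cmod_minus_sym in Hx. lra.
    - intros y Hy Oy. rewrite Fcn by (now apply (Sne k s)). apply B; auto. }
  assert (HFb : forall k, (k < m)%nat -> forall y, slit_disk (w k) s (d k) y -> Cmod (Fc k y - Fc k (w k)) <= Mk k * Rpower (Cmod (y - w k)) delta).
  { intros k Hk y Hy. rewrite Fcw, Fcn by (now apply (Sne k s)). apply Hk'; [assumption|].
    apply (slit_disk_sub _ s); [apply Hss; assumption|assumption]. }
  assert (HFc0 : forall k, (k < m)%nat -> forall e, 0 < e -> exists r, 0 < r /\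
     forall y, slit_disk (w k) s (d k) y -> Cmod (y - w k) < r -> Cmod (Fc k y - Fc k (w k)) < e).
  { intros k Hk e He. destruct (Hk' k Hk) as [_ [HM _]].
    set (q := e / (Mk k + 1)). assert (Hq : 0 < q) by (unfold q; apply Rdiv_lt_0_compat; lra).
    exists (Rpower q (/ delta)). split; [apply exp_pos|]. intros y Hy Hr.
    eapply Rle_lt_trans; [apply HFb; assumption|].
    assert (Py : 0 < Cmod (y - w k)) by (apply Cmod_gt_0, Cminus_ne; now apply (Sne k s)).
    assert (P : Rpower (Cmod (y - w k)) delta < q).
    { replace q with (Rpower (Rpower q (/ delta)) delta).
      - apply Rlt_Rpower_l; [assumption|]. split; assumption.
      - rewrite Rpower_mult, Rinv_l, Rpower_1 by lra. reflexivity. }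
    assert (0 < Rpower (Cmod (y - w k)) delta) by apply exp_pos.
    assert (Eq : q * (Mk k + 1) = e) by (unfold q; field; lra). nra. }
  destruct (region_bounded m w Hpoly) as [B [HB HBz]].
  exists R0, (winding m w R0 t0 tau n o), (corner_osc w Fc), (fun z => csum m (fun k =>
     (cauchy_int z (leg_end m w R0 k (-1)) (leg_end m w R0 k 1) (fun _ => Fc k (w k))
     + cauchy_int z (leg_end m w R0 k 1) (outer m w t0 tau n k 0) (Fc k) + csum (S n) (fun i => cauchy_int z (outer m w t0 tau n k i) (outer m w t0 tau n k (S i)) (Fs k i))
     + cauchy_int z (outer m w t0 tau n k (S n)) (leg_end m w R0 (nx k) (-1)) (Fc (nx k)))%C)).
  split; [assumption|]. split; [|split; [|split; [|split]]].
  - apply (winding_center_ne0 m w s R0 t0 eta tau n); try assumption. intros k Hk. now apply Hss.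
  - intros j k Hj Hk N. now apply (HR k Hk).
  - apply (geom_approx_csum Om m (fun k z => (cauchy_int z (leg_end m w R0 k (-1)) (leg_end m w R0 k 1) (fun _ => Fc k (w k))
     + cauchy_int z (leg_end m w R0 k 1) (outer m w t0 tau n k 0) (Fc k) + csum (S n) (fun i => cauchy_int z (outer m w t0 tau n k i) (outer m w t0 tau n k (S i)) (Fs k i))
     + cauchy_int z (outer m w t0 tau n k (S n)) (leg_end m w R0 (nx k) (-1)) (Fc (nx k)))%C)).
    intros k Hk. apply geom_approx_plus; [apply geom_approx_plus; [apply geom_approx_plus|]|].
    + apply (cauchy_int_geom_approx Om _ _ _ B); [now apply well_separated_chord|assumption|apply cont_on_const].
    + apply (cauchy_int_geom_approx Om _ _ _ B); [now apply well_separated_start|assumption|].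
      apply (start_cont m w f Fc s R0 t0 eta tau n); assumption.
    + apply (geom_approx_csum Om (S n) (fun i z => cauchy_int z (outer m w t0 tau n k i) (outer m w t0 tau n k (S i)) (Fs k i))).
      intros i Hi. apply (cauchy_int_geom_approx Om _ _ _ B); [now apply well_separated_strip|assumption|].
      apply (strip_cont m w f Fs s t0 eta tau n); try assumption. lia.
    + apply (cauchy_int_geom_approx Om _ _ _ B); [now apply well_separated_end|assumption|].
      apply (end_cont m w f Fc s R0 t0 eta tau n); assumption.
  - intros k sg Hk Hsg. split; [apply (corner_osc_cont m w f Fc s R0 t0 tau); assumption|].
    destruct (Hk' k Hk) as [_ [HM _]].
    exists (Mk k * Rpower (2 * R0) delta). split; [apply Rmult_le_pos; [assumption|left; apply exp_pos]|].
    intros t Ht.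
    assert (Vt : half_disk m w s k sg (seg (w k) (leg_end m w R0 k sg) t)).
    { apply half_disk_star; [assumption| |lra]. apply (half_disk_leg_end m w s R0 t0 tau); try assumption. destruct Hsg as [->| ->]; lra. }
    eapply Rle_trans; [apply HFb; [assumption|now apply (half_disk_slit m w s Hpoly k sg)]|].
    rewrite Rmult_assoc. apply Rmult_le_compat_l; [assumption|]. rewrite Rpower_mult_distr by lra.
    apply Rle_Rpower_l; [lra|].
    assert (E : Cmod (seg (w k) (leg_end m w R0 k sg) t - w k) = t * Cmod (leg_end m w R0 k sg - w k)).
    { replace (seg (w k) (leg_end m w R0 k sg) t - w k)%C with (RtoC t * (leg_end m w R0 k sg - w k))%C by (unfold seg; ring).
      rewrite Cmod_mult, Cmod_R, Rabs_right by lra. reflexivity. }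
    rewrite E. rewrite <- (Cmod_ccoord m w Hpoly) by assumption. rewrite (ccoord_leg_end m w R0 Hpoly) by assumption.
    split.
    + apply Rmult_lt_0_compat; [lra|]. apply Cmod_gt_0. intros K. apply (f_equal Re) in K. simpl in K. lra.
    + rewrite Rmult_comm. apply Rmult_le_compat_r; [lra|]. apply Cmod_le_sq; [lra|]. simpl.
      destruct Hsg as [->| ->]; nra.
  - intros z Oz. rewrite (representation m w f Fc Fs s R0 t0 eta tau n) by assumption.
    rewrite <- csum_plus. apply csum_ext. intros k Hk. ring.
Qed.
End Constants.

(** * From partial fractions to rational functions in lowest terms *)

Lemma synthetic_division (l : list C) (b : C) : exists q, (length q <= pred (length l))%nat /\
  forall z, poly_eval l z = (poly_eval l b + (z - b) * poly_eval q z)%C.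
Proof.
  induction l as [|a l [q [Hq E]]].
  - exists nil. split; [simpl; lia|]. intros z. simpl. ring.
  - destruct l as [|a' l].
    + exists nil. split; [simpl; lia|]. intros z. simpl. ring.
    + exists (poly_eval (a' :: l) b :: q). split; [simpl in *; lia|]. intros z.
      change (poly_eval (a :: a' :: l) z) with (a + z * poly_eval (a' :: l) z)%C.
      change (poly_eval (a :: a' :: l) b) with (a + b * poly_eval (a' :: l) b)%C.
      change (poly_eval (poly_eval (a' :: l) b :: q) z) with (poly_eval (a' :: l) b + z * poly_eval q z)%C.
      rewrite E. ring.
Qed.

Lemma polyfun_factor n g b : polyfun (S n) g -> g b = 0%C -> exists h, polyfun n h /\ forall z, g z = ((z - b) * h z)%C.
Proof.
  intros [l [Hl E]] Hb. destruct (synthetic_division l b) as [q [Hq F]].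
  exists (poly_eval q). split; [exists q; split; [lia|reflexivity]|].
  intros z. rewrite <- E, F, E, Hb. ring.
Qed.

Lemma root_prod_app L K z : root_prod (L ++ K) z = (root_prod L z * root_prod K z)%C.
Proof. induction L as [|a L IH]; simpl; [ring|]. rewrite IH. ring. Qed.

Lemma root_prod_zero L z : root_prod L z = 0%C <-> In z L.
Proof.
  induction L as [|a L IH]; simpl.
  - split; [|tauto]. intros H. injection H. intros; lra.
  - split.
    + intros H. destruct (classic (a = z)) as [E|N]; [now left|right]. apply IH. apply NNPP. intros K.
      apply (Cmult_neq_0 (z - a) (root_prod L z)); try assumption. apply Cminus_ne. auto.
    + intros [->|H]; [ring|]. rewrite (proj2 IH H). ring.
Qed.

Lemma root_prod_nonroot L : exists z, root_prod L z <> 0%C.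
Proof.
  assert (H : exists B, forall z, In z L -> Cmod z <= B).
  { induction L as [|a L [B HB]]; [exists 0; simpl; tauto|]. exists (Rmax (Cmod a) B).
    intros z [->|Hz]; [apply Rmax_l|]. eapply Rle_trans; [now apply HB|apply Rmax_r]. }
  destruct H as [B HB]. exists (RtoC (Rabs B + 1)). rewrite root_prod_zero. intros H. apply HB in H.
  rewrite Cmod_R in H. assert (0 <= Rabs B) by apply Rabs_pos. rewrite Rabs_right in H by lra.
  generalize (Rle_abs B). lra.
Qed.

Lemma root_prod_holo L : holo (fun _ => True) (root_prod L).
Proof.
  induction L as [|a L IH]; intros x _; simpl.
  - exists 0%C. apply cderiv_const.
  - destruct (IH x I) as [l Hl]. eexists. apply (cderiv_mult (fun z => (z - a)%C) (root_prod L)); [|exact Hl].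
    apply (cderiv_plus (fun z => z) (fun _ => (- a)%C)); [apply cderiv_id|apply cderiv_const].
Qed.

Lemma root_prod_simple L z : NoDup L -> In z L -> exists l : C, l <> 0%C /\ cderiv (root_prod L) z l.
Proof.
  intros HN Hz. destruct (in_split z L Hz) as [L1 [L2 ->]].
  apply NoDup_remove_2 in HN. set (Q := root_prod (L1 ++ L2)).
  exists (Q z). split; [unfold Q; now rewrite root_prod_zero|].
  assert (E : forall y, root_prod (L1 ++ z :: L2) y = ((y - z) * Q y)%C).
  { intros y. unfold Q. rewrite !root_prod_app. simpl. ring. }
  destruct (root_prod_holo (L1 ++ L2) z I) as [l Hl]. fold Q in Hl.
  intros e He. destruct (cderiv_cont _ _ _ Hl e He) as [d [Hd H]]. exists d. split; [assumption|].
  intros y Hy. specialize (H y Hy). rewrite !E.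
  replace ((y - z) * Q y - (z - z) * Q z - Q z * (y - z))%C with ((Q y - Q z) * (y - z))%C by ring.
  rewrite Cmod_mult. apply Rmult_le_compat_r; [apply Cmod_ge_0|lra].
Qed.

(** With distinct roots the denominator has simple zeros. *)
Lemma ratfun_coprime n (L : list C) g : NoDup L -> (length L <= n)%nat -> polyfun (S n) g ->
  (forall z, In z L -> g z <> 0%C) ->
  exists r, degree_le n r /\ (forall z, root_prod L z <> 0%C -> rat_eval r z = (g z / root_prod L z)%C) /\
    forall z, is_pole r z -> In z L /\ is_simple_pole r z.
Proof.
  intros HN HL Hg NZ. destruct (polyfun_root_prod L) as [dl [Dl Ed]]. destruct Hg as [l [Ll El]].
  assert (A1 : exists z, poly_eval dl z <> RtoC 0) by (destruct (root_prod_nonroot L) as [z Hz]; exists z; now rewrite Ed).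
  assert (A2 : forall z, poly_eval dl z = RtoC 0 -> poly_eval l z <> RtoC 0).
  { intros z. rewrite Ed, El, root_prod_zero. apply NZ. }
  exists (Ratfun l dl A1 A2). split; [|split].
  + split; simpl; lia.
  + intros z Hz. unfold rat_eval. simpl. now rewrite Ed, El.
  + intros z Hz. assert (Hz' := Hz). unfold is_pole in Hz'. simpl in Hz'. rewrite Ed, root_prod_zero in Hz'.
    split; [assumption|]. split; [assumption|]. destruct (root_prod_simple L z HN Hz') as [c [Hc Hcd]].
    exists c. split; [assumption|]. apply is_derive_C. simpl.
    apply (cderiv_local (root_prod L) _ _ _ 1); [lra| |assumption]. intros y _. symmetry. apply Ed.
Qed.

(** A root of the denominator at which the numerator vanishes is divided out of both. *)
Lemma ratfun_make n (L : list C) : forall g, NoDup L -> (length L <= n)%nat -> polyfun (S n) g ->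
  exists r, degree_le n r /\ (forall z, root_prod L z <> 0%C -> rat_eval r z = (g z / root_prod L z)%C) /\
    forall z, is_pole r z -> In z L /\ is_simple_pole r z.
Proof.
  remember (length L) as N eqn:EN. revert L EN. induction N as [N IH] using (well_founded_induction Nat.lt_wf_0); intros L EN g HN HL Hg.
  destruct (classic (exists b, In b L /\ g b = 0%C)) as [[b [Hb Z]]|NZ].
  - destruct (in_split b L Hb) as [L1 [L2 ->]].
    destruct (polyfun_factor n g b Hg Z) as [h [Hh Eh]].
    assert (HN' := NoDup_remove_1 _ _ _ HN).
    assert (LN : (length (L1 ++ L2) < N)%nat).
    { rewrite length_app in *. simpl in EN. lia. }
    destruct (IH _ LN (L1 ++ L2) eq_refl h HN' ltac:(lia) (polyfun_mono n (S n) h ltac:(lia) Hh)) as [r [R1 [R2 R3]]].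
    exists r. split; [assumption|]. split.
    + intros z Hz. rewrite root_prod_app in Hz. simpl in Hz.
      assert (Nz1 : root_prod (L1 ++ L2) z <> 0%C).
      { rewrite root_prod_app. intros K. apply Hz.
        replace (root_prod L1 z * ((z - b) * root_prod L2 z))%C with ((z - b) * (root_prod L1 z * root_prod L2 z))%C by ring. rewrite K. ring. }
      assert (Nz2 : (z - b)%C <> 0%C) by (intros K; apply Hz; rewrite K; ring).
      rewrite R2 by assumption. rewrite Eh. rewrite !root_prod_app in *. simpl.
      assert (Nz3 : root_prod L1 z <> 0%C) by (intros K; apply Hz; rewrite K; ring).
      assert (Nz4 : root_prod L2 z <> 0%C) by (intros K; apply Hz; rewrite K; ring).
      field. repeat split; assumption.
    + intros z Hz. destruct (R3 z Hz) as [R4 R5]. split; [|assumption].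
      apply in_app_or in R4. apply in_or_app. simpl. tauto.
  - apply ratfun_coprime; try assumption; [lia|]. intros z Hz K. apply NZ. now exists z.
Qed.

Lemma ratfun_zero n : exists r, degree_le n r /\ forall z, ~ is_pole r z.
Proof.
  destruct (ratfun_make n nil (fun _ => 0%C)) as [r [H1 [_ H3]]].
  - constructor. - simpl; lia. - apply polyfun_zero.
  - exists r. split; [assumption|]. intros z Hz. now destruct (H3 z Hz).
Qed.

(** * Assembling the approximants *)

Lemma eventually_unif m (Q : nat -> nat -> Prop) :
  (forall k, (k < m)%nat -> exists N, forall n, (N <= n)%nat -> Q k n) ->
  exists N, forall n, (N <= n)%nat -> forall k, (k < m)%nat -> Q k n.
Proof.
  induction m as [|m IH]; intros H; [exists 0%nat; intros; lia|].
  destruct IH as [N HN]; [intros; apply H; lia|]. destruct (H m) as [N' HN']; [lia|].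
  exists (Nat.max N N'). intros n Hn k Hk. destruct (Nat.eq_dec k m) as [->|]; [apply HN'; lia|apply HN; lia].
Qed.

Lemma LimInf_pos_bound (u : nat -> R) : Rbar_lt (Finite 0) (LimInf_seq u) ->
  exists g, 0 < g /\ exists N, forall n, (N <= n)%nat -> g <= u n.
Proof.
  intros H. destruct (ex_LimInf_seq u) as [l0 L]. rewrite (is_LimInf_seq_unique u l0 L) in H.
  destruct l0 as [l| |]; simpl in H, L.
  - destruct (L (mkposreal (l / 2) ltac:(lra))) as [_ [N HN]]. exists (l / 2). split; [lra|]. exists N. intros n Hn.
    specialize (HN n Hn). simpl in HN. lra.
  - destruct (L 1) as [N HN]. exists 1. split; [lra|]. exists N. intros n Hn. left. now apply HN.
  - contradiction.
Qed.

(** Geometric decay is far stronger than root-exponential decay; a crude comparison of [n/2]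
    with [sqrt n] is enough. *)
Lemma pow_half_bound q n : 0 < q < 1 -> (2 <= n)%nat -> q ^ (n / 2) <= exp (- (- ln q / 4) * sqrt (INR n)).
Proof.
  intros Hq Hn. assert (Lq : ln q < 0) by (rewrite <- ln_1; apply ln_increasing; lra).
  assert (Hn2 : 2 <= INR n) by (replace 2 with (INR 2) by (simpl; lra); now apply le_INR).
  set (s := sqrt (INR n)). assert (Hss : s * s = INR n) by (apply sqrt_sqrt; lra).
  assert (Hs0 : 0 <= s) by apply sqrt_pos.
  assert (Hs : 1 <= s) by nra.
  assert (HN2 : INR n - 1 <= 2 * INR (n / 2)).
  { assert (A := Nat.div_mod_eq n 2). assert (B := Nat.mod_upper_bound n 2 ltac:(lia)).
    assert (D : (n <= 2 * (n / 2) + 1)%nat) by lia. apply le_INR in D. rewrite plus_INR, mult_INR in D.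
    change (INR 1) with 1 in D. change (INR 2) with (1 + 1) in D. lra. }
  rewrite <- Rpower_pow by lra. unfold Rpower. apply exp_le.
  assert (s / 4 <= INR (n / 2)) by nra. nra.
Qed.

Fixpoint concat_below (bet : nat -> list C) (K : nat) : list C :=
  match K with 0%nat => nil | S K => concat_below bet K ++ bet K end.

Lemma concat_below_in bet K z : In z (concat_below bet K) -> exists k, (k < K)%nat /\ In z (bet k).
Proof.
  induction K as [|K IH]; simpl; [tauto|]. intros H. apply in_app_or in H. destruct H as [H|H].
  - destruct (IH H) as [k [Hk Hz]]. exists k. split; [lia|assumption].
  - exists K. split; [lia|assumption].
Qed.

Lemma concat_below_NoDup bet K : (forall k, (k < K)%nat -> NoDup (bet k)) ->
  (forall j k z, (j < K)%nat -> (k < K)%nat -> j <> k -> In z (bet j) -> ~ In z (bet k)) -> NoDup (concat_below bet K).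
Proof.
  induction K as [|K IH]; intros H1 H2; simpl; [constructor|]. apply NoDup_app.
  - apply IH; [intros; apply H1; lia|intros j k z Hj Hk; apply H2; lia].
  - apply H1. lia.
  - intros a Ha. destruct (concat_below_in _ _ _ Ha) as [j [Hj Hz]]. apply (H2 j K); try lia. assumption.
Qed.

Lemma concat_below_length bet (c : nat -> nat) K : (forall k, (k < K)%nat -> (2 * length (bet k) <= c k)%nat) ->
  (2 * length (concat_below bet K) <= list_sum (map c (seq 0 K)))%nat.
Proof.
  induction K as [|K IH]; intros H; [simpl; lia|]. rewrite seq_S, map_app, list_sum_app. simpl.
  rewrite length_app. assert (A := IH (fun k Hk => H k ltac:(lia))). assert (B := H K ltac:(lia)). lia.
Qed.

Fixpoint rsum (K : nat) (e : nat -> R) : R := match K with 0%nat => 0 | S K => rsum K e + e K end.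

(** Bringing the partial fractions of different corners over a common denominator keeps the
    numerator degree below the denominator degree. *)
Lemma concat_below_approx (Om : C -> Prop) (A : nat -> C -> C) (bet : nat -> list C) (e : nat -> R) K :
  (forall k, (k < K)%nat -> exists p, polyfun (length (bet k)) p /\ forall z, Om z -> 0 < Cmod (root_prod (bet k) z) /\
     Cmod (A k z - p z / root_prod (bet k) z) <= e k) ->
  exists g, polyfun (length (concat_below bet K)) g /\ forall z, Om z -> 0 < Cmod (root_prod (concat_below bet K) z) /\
     Cmod (csum K (fun k => A k z) - g z / root_prod (concat_below bet K) z) <= rsum K e.
Proof.
  induction K as [|K IH]; intros H.
  - exists (fun _ => 0%C). split; [apply polyfun_zero|]. intros z _. simpl. rewrite Cmod_1. split; [lra|].
    replace (0 - 0 / 1)%C with (RtoC 0) by field. rewrite Cmod_0. lra.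
  - destruct IH as [g [Hg E]]; [intros; apply H; lia|]. destruct (H K ltac:(lia)) as [p [Hp F]].
    exists (fun z => (root_prod (bet K) z * g z + root_prod (concat_below bet K) z * p z)%C). split.
    + simpl. rewrite length_app. apply polyfun_plus.
      * rewrite Nat.add_comm. now apply polyfun_root_prod_mult.
      * now apply polyfun_root_prod_mult.
    + intros z Hz. destruct (E z Hz) as [E1 E2]. destruct (F z Hz) as [F1 F2]. simpl. rewrite root_prod_app. split.
      * rewrite Cmod_mult. now apply Rmult_lt_0_compat.
      * apply Cmod_gt_0 in E1. apply Cmod_gt_0 in F1.
        replace (csum K (fun k => A k z) + A K z - (root_prod (bet K) z * g z + root_prod (concat_below bet K) z * p z) / (root_prod (concat_below bet K) z * root_prod (bet K) z))%C
         with ((csum K (fun k => A k z) - g z / root_prod (concat_below bet K) z) + (A K z - p z / root_prod (bet K) z))%C by (field; split; assumption).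
        eapply Rle_trans; [apply Cmod_triangle|]. lra.
Qed.

Lemma rsum_scal K e c : rsum K (fun k => e k * c) = rsum K e * c.
Proof. induction K as [|K IH]; simpl; [ring|]. rewrite IH. ring. Qed.

Lemma clustered_NoDup c d R0 sigma N : Cmod d = 1 -> 0 < R0 -> 0 < sigma ->
  NoDup (map (clustered_point c d R0 sigma N) (seq 0 (N / 2))).
Proof.
  intros Hd HR Hs. destruct N as [|N]; [constructor|].
  apply NoDup_map_NoDup_ForallPairs; [|apply seq_NoDup].
  intros i j _ _ E. unfold clustered_point in E.
  assert (Hq : 0 < sqrt (INR (S N))) by (apply sqrt_lt_R0, lt_0_INR; lia).
  assert (Nd : d <> 0%C) by (apply Cmod_gt_0; lra).
  set (x := R0 * exp (- sigma * INR i / sqrt (INR (S N)))) in *. set (y := R0 * exp (- sigma * INR j / sqrt (INR (S N)))) in *.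
  assert (Exy : RtoC x = RtoC y).
  { replace (RtoC x) with ((c + RtoC x * d - c) / d)%C by (field; assumption). rewrite E. field. assumption. }
  apply RtoC_inj in Exy. unfold x, y in Exy. apply Rmult_eq_reg_l in Exy; [|lra]. apply exp_inv in Exy.
  apply INR_eq. apply Rmult_eq_reg_l with (- sigma); [|lra].
  apply Rmult_eq_reg_r with (/ sqrt (INR (S N))); [exact Exy|]. apply Rgt_not_eq. now apply Rinv_0_lt_compat.
Qed.

Lemma clustered_dist c d R0 sigma N j : Cmod d = 1 -> 0 < R0 -> 0 < sigma -> (j < N)%nat ->
  Cmod (clustered_point c d R0 sigma N j - c) <= R0.
Proof.
  intros Hd HR Hs Hj. unfold clustered_point.
  assert (Hq : 0 < sqrt (INR N)) by (apply sqrt_lt_R0, lt_0_INR; lia).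
  replace (c + RtoC (R0 * exp (- sigma * INR j / sqrt (INR N))) * d - c)%C with (RtoC (R0 * exp (- sigma * INR j / sqrt (INR N))) * d)%C by ring.
  rewrite Cmod_mult, Cmod_R, Hd, Rmult_1_r, Rabs_right by (apply Rle_ge; apply Rmult_le_pos; [lra|left; apply exp_pos]).
  rewrite <- (Rmult_1_r R0) at 2. apply Rmult_le_compat_l; [lra|]. rewrite <- exp_0. apply exp_le.
  assert (0 <= sigma * INR j / sqrt (INR N)) by (apply Rdiv_le_0_compat; [apply Rmult_le_pos; [lra|apply pos_INR]|assumption]).
  unfold Rdiv in *. lra.
Qed.

Lemma sup_error_le Om f r b : (forall z, Om z -> Cmod (f z - rat_eval r z) <= b) -> Rbar_le (sup_error Om f r) (Finite b).
Proof.
  intros H. unfold sup_error, sup_norm. apply (proj2 (Lub_Rbar_correct _)).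
  intros x [z [Hz ->]]. simpl. now apply H.
Qed.

Section Final.
Variables (m : nat) (w : nat -> C) (f : C -> C) (delta : R).
Hypotheses (Hpoly : convex_polygon m w) (Hf : analytic_on (polygon_region m w) f)
  (Hsides : forall (k : nat) (p : C), (k < m)%nat -> open_side m w k p ->
     extends_near (polygon_region m w) f p)
  (Hdelta : 0 < delta)
  (Hcorners : forall k : nat, (k < m)%nat ->
     corner_continuation (polygon_region m w) f (w k) (exterior_bisector m w k) delta).
Notation Om := (polygon_region m w).
Notation d := (exterior_bisector m w).

Theorem clustered_approximation (sigma : R) (nk : nat -> nat -> nat) : 0 < sigma -> pole_counts m nk ->
     exists (scale : nat -> R) (r : nat -> ratfun) (c : R),
       0 < c /\
       (forall k : nat, (k < m)%nat -> 0 < scale k) /\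
       (forall n : nat, (1 <= n)%nat ->
          degree_le n (r n) /\
          forall z : C, is_pole (r n) z ->
            is_simple_pole (r n) z /\
            exists k j : nat, (k < m)%nat /\ (j < nk k n)%nat /\
              z = clustered_point (w k) (d k)
                    (scale k) sigma (nk k n) j) /\
       root_exponential c (fun n => sup_error Om f (r n)).
Proof.
  intros Hsig [Hsum Hlim].
  destruct (cauchy_representation m w f delta Hpoly Hf Hsides Hdelta Hcorners)
    as [R0 [W [G [Rest [HR [HW [Hdis [[Mr [q [HMr [Hq HRest]]]] [HG Hrep]]]]]]]]].
  (* Half of the admissible poles, which leaves degree n / 2 for the polynomial part. *)
  set (bet := fun n k => map (clustered_point (w k) (d k) R0 sigma (nk k n)) (seq 0 (nk k n / 2))).
  set (legs := fun k z => (cauchy_int z (w k) (leg_end m w R0 k 1) (G k) + (-(1)) * cauchy_int z (w k) (leg_end m w R0 k (-1)) (G k))%C).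
  set (rt := rate delta sigma). assert (Hrt : 0 < rt) by (now apply rate_pos).
  assert (Corner : forall k, (k < m)%nat -> exists K, 0 <= K /\ forall N, (6 <= N)%nat -> 8 * ln 2 / sigma <= sqrt (INR N) ->
    exists p, polyfun (N / 2) p /\ forall z, Om z -> 0 < Cmod (root_prod (map (clustered_point (w k) (d k) R0 sigma N) (seq 0 (N / 2))) z) /\
      Cmod (legs k z - p z / root_prod (map (clustered_point (w k) (d k) R0 sigma N) (seq 0 (N / 2))) z) <= K * exp (- rt * sqrt (INR N))).
  { intros k Hk. destruct (HG k 1 Hk (or_introl eq_refl)) as [Cp [Mp [HMp Bp]]].
    destruct (HG k (-1) Hk (or_intror eq_refl)) as [Cm [Mm [HMm Bm]]].
    assert (HO : forall z, Om z -> Re ((z - w k) * Cconj (d k)) < 0) by (intros z Oz; exact (ccoord_region m w Hpoly k z Hk Oz)).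
    assert (Hd := d_unit m w Hpoly k Hk).
    set (Kp := Cmod (leg_end m w R0 k 1 - w k) * Mp / R0 * (4/3) / (delta/2)).
    set (Km := Cmod (leg_end m w R0 k (-1) - w k) * Mm / R0 * (4/3) / (delta/2)).
    exists (Kp + Km). split.
    { assert (A : forall a b, 0 <= b -> 0 <= Cmod a * b / R0 * (4/3) / (delta/2)).
      { intros a b Hb. apply Rdiv_le_0_compat; [|lra]. apply Rmult_le_pos; [|lra]. apply Rdiv_le_0_compat; [|assumption].
        apply Rmult_le_pos; [apply Cmod_ge_0|assumption]. }
      unfold Kp, Km. assert (X := A (leg_end m w R0 k 1 - w k)%C Mp HMp). assert (Y := A (leg_end m w R0 k (-1) - w k)%C Mm HMm). lra. }
    intros N HN6 HNs.
    destruct (corner_approx Om (w k) (d k) R0 1 delta sigma (G k) Mp Hd HO HR ltac:(lra) Hdelta Hsig Cp HMp Bp N HN6 HNs) as [pp [Dp Ep]].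
    destruct (corner_approx Om (w k) (d k) R0 (-1) delta sigma (G k) Mm Hd HO HR ltac:(lra) Hdelta Hsig Cm HMm Bm N HN6 HNs) as [pm [Dm Em]].
    exists (fun z => (pp z + (-(1)) * pm z)%C). split; [apply polyfun_plus; [assumption|now apply polyfun_scal]|].
    intros z Oz. destruct (Ep z Oz) as [P1 P2]. destruct (Em z Oz) as [Q1 Q2]. split; [assumption|].
    set (D := root_prod (map (clustered_point (w k) (d k) R0 sigma N) (seq 0 (N / 2))) z) in *.
    assert (ND : D <> 0%C) by (now apply Cmod_gt_0).
    unfold legs.
    replace (cauchy_int z (w k) (leg_end m w R0 k 1) (G k) + -(1) * cauchy_int z (w k) (leg_end m w R0 k (-1)) (G k) - (pp z + -(1) * pm z) / D)%C
     with ((cauchy_int z (w k) (leg_end m w R0 k 1) (G k) - pp z / D) + - (cauchy_int z (w k) (leg_end m w R0 k (-1)) (G k) - pm z / D))%C by (field; assumption).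
    eapply Rle_trans; [apply Cmod_triangle|]. rewrite Cmod_opp, Rmult_plus_distr_r.
    apply Rplus_le_compat; assumption. }
  destruct (fin_choice m _ (inhabits 0) Corner) as [Kk HKk].
  destruct (unif_small m (fun k x => exists N, forall n, (N <= n)%nat -> x * INR n <= INR (nk k n))) as [gam [Hgam Hgam1]].
  { intros k Hk. destruct (LimInf_pos_bound _ (Hlim k Hk)) as [g [Hg0 [N HN]]].
    exists g. split; [assumption|]. intros x Hx. exists (S N). intros n Hn. specialize (HN n ltac:(lia)).
    assert (Hn0 : 0 < INR n) by (apply lt_0_INR; lia).
    apply Rmult_le_compat_r with (r := INR n) in HN; [|lra].
    replace (INR (nk k n) / INR n * INR n) with (INR (nk k n)) in HN by (field; lra). nra. }
  destruct (eventually_unif m (fun k n => gam * INR n <= INR (nk k n))) as [N1 HN1].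
  { exact Hgam1. }
  (* At each corner thr poles suffice for the two size conditions of the corner estimate. *)
  set (thr := 6 + (8 * ln 2 / sigma) * (8 * ln 2 / sigma)).
  destruct (nfloor_ex (thr / gam)) as [N2 [_ HN2]].
  { apply Rdiv_le_0_compat; [unfold thr; nra|assumption]. }
  set (Nn := Nat.max 2 (Nat.max N1 (S N2))).
  assert (Large : forall n k, (Nn <= n)%nat -> (k < m)%nat -> (6 <= nk k n)%nat /\ 8 * ln 2 / sigma <= sqrt (INR (nk k n)) /\ gam * INR n <= INR (nk k n)).
  { intros n k Hn Hk. assert (A := HN1 n ltac:(lia) k Hk).
    assert (B : thr <= INR (nk k n)).
    { assert (C0 : INR N2 + 1 <= INR n) by (rewrite <- S_INR; apply le_INR; lia).
      apply Rmult_lt_compat_r with (r := gam) in HN2; [|assumption].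
      replace (thr / gam * gam) with thr in HN2 by (field; lra). nra. }
    unfold thr in B. set (x := 8 * ln 2 / sigma) in *. split; [|split; [|assumption]].
    - apply INR_le. change (INR 6) with (1+1+1+1+1+1). nra.
    - assert (Hx : 0 <= x). { unfold x. apply Rdiv_le_0_compat; [|assumption]. assert (0 < ln 2) by (rewrite <- ln_1; apply ln_increasing; lra). lra. }
      rewrite <- (sqrt_square x Hx). apply sqrt_le_1_alt. lra. }
  (* The ratio q may be 0, but its logarithm enters the rate. *)
  set (q' := Rmax q (1/2)). assert (Hq' : 0 < q' < 1) by (unfold q', Rmax; destruct Rle_dec; lra).
  set (c := Rmin (rt * sqrt gam) (- ln q' / 4)).
  assert (Hlq : ln q' < 0) by (rewrite <- ln_1; apply ln_increasing; lra).
  assert (Hsg : 0 < sqrt gam) by (now apply sqrt_lt_R0).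
  assert (Hc : 0 < c) by (unfold c; apply Rmin_pos; [now apply Rmult_lt_0_compat|lra]).
  set (Mt := / Cmod W * (rsum m Kk + Mr)).
  assert (Ex : forall n, exists r, degree_le n r /\
     (forall z, is_pole r z -> is_simple_pole r z /\ exists k j, (k < m)%nat /\ (j < nk k n)%nat /\ z = clustered_point (w k) (d k) R0 sigma (nk k n) j) /\
     ((Nn <= n)%nat -> forall z, Om z -> Cmod (f z - rat_eval r z) <= Mt * exp (- c * sqrt (INR n)))).
  { intros n. destruct (Nat.le_gt_cases Nn n) as [Hn|Hn].
    (* For small n a function without poles will do, since the estimate is asymptotic. *)
    2:{ destruct (ratfun_zero n) as [r [H1 H2]]. exists r. split; [assumption|]. split; [intros z Hz; now elim (H2 z)|lia]. }
    assert (Hn2 : (2 <= n)%nat) by lia.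
    set (E := exp (- c * sqrt (INR n))). assert (HE : 0 < E) by apply exp_pos.
    assert (Bound : forall k, (k < m)%nat -> Kk k * exp (- rt * sqrt (INR (nk k n))) <= Kk k * E).
    { intros k Hk. apply Rmult_le_compat_l; [now apply HKk|]. apply exp_le.
      destruct (Large n k Hn Hk) as [_ [_ L]].
      assert (S1 : sqrt gam * sqrt (INR n) <= sqrt (INR (nk k n))).
      { rewrite <- sqrt_mult by (try lra; apply pos_INR). now apply sqrt_le_1_alt. }
      assert (c <= rt * sqrt gam) by apply Rmin_l. assert (0 <= sqrt (INR n)) by apply sqrt_pos.
      assert (c * sqrt (INR n) <= rt * sqrt gam * sqrt (INR n)) by (apply Rmult_le_compat_r; lra).
      assert (rt * (sqrt gam * sqrt (INR n)) <= rt * sqrt (INR (nk k n))) by (apply Rmult_le_compat_l; lra). lra. }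
    destruct (concat_below_approx Om legs (bet n) (fun k => Kk k * E) m) as [g [Hg Eg]].
    { intros k Hk. destruct (Large n k Hn Hk) as [L1 [L2 _]]. destruct (proj2 (HKk k Hk) (nk k n) L1 L2) as [p [Hp Ep]].
      exists p. split; [unfold bet; now rewrite length_map, length_seq|].
      intros z Oz. destruct (Ep z Oz) as [A B]. split; [exact A|]. eapply Rle_trans; [exact B|]. now apply Bound. }
    destruct (HRest (n / 2)%nat) as [p [Hp Ep]].
    set (L := concat_below (bet n) m) in *.
    assert (Len : (2 * length L <= n)%nat).
    { eapply Nat.le_trans; [|apply (Hsum n); lia]. apply concat_below_length. intros k Hk. unfold bet. rewrite length_map, length_seq.
      apply Nat.Div0.mul_div_le. }
    assert (ND : NoDup L).
    { apply concat_below_NoDup.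
      - intros k Hk. apply clustered_NoDup; auto. now apply d_unit.
      - intros j k z Hj Hk N Hzj Hzk. unfold bet in *. apply in_map_iff in Hzj. apply in_map_iff in Hzk.
        destruct Hzj as [a [Ea Ha]]. destruct Hzk as [b [Eb Hb]]. apply in_seq in Ha. apply in_seq in Hb.
        assert (A := clustered_dist (w j) (d j) R0 sigma (nk j n) a (d_unit m w Hpoly j Hj) HR Hsig).
        assert (B := clustered_dist (w k) (d k) R0 sigma (nk k n) b (d_unit m w Hpoly k Hk) HR Hsig).
        rewrite Ea in A. rewrite Eb in B.
        assert (Da := Nat.Div0.mul_div_le (nk j n) 2). assert (Db := Nat.Div0.mul_div_le (nk k n) 2).
        specialize (A ltac:(lia)). specialize (B ltac:(lia)). specialize (Hdis j k Hj Hk N).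
        assert (T := Cmod_tri3 (w j) z (w k)). rewrite (Cmod_minus_sym (w j) z) in T. lra. }
    (* The numerator over the common denominator L; its degree is below length L + n / 2 <= n. *)
    set (h := fun z => (/ W * (g z + root_prod L z * p z))%C).
    assert (Hh : polyfun (S n) h).
    { apply polyfun_scal. apply polyfun_plus.
      - apply (polyfun_mono (length L)); [lia|assumption].
      - apply (polyfun_mono (length L + n / 2)); [|now apply polyfun_root_prod_mult].
        assert (length L <= n / 2)%nat by (apply Nat.div_le_lower_bound; lia).
        assert (Da := Nat.Div0.mul_div_le n 2). lia. }
    destruct (ratfun_make n L h ND ltac:(lia) Hh) as [r [R1 [R2 R3]]].
    exists r. split; [assumption|]. split.
    - intros z Hz. destruct (R3 z Hz) as [Hin Hsp]. split; [assumption|].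
      destruct (concat_below_in _ _ _ Hin) as [k [Hk Hz']]. unfold bet in Hz'. apply in_map_iff in Hz'. destruct Hz' as [j [Ej Hj]].
      apply in_seq in Hj. exists k, j. split; [assumption|]. split; [|now symmetry].
      assert (Da := Nat.Div0.mul_div_le (nk k n) 2). lia.
    - intros _ z Oz. destruct (Eg z Oz) as [E1 E2]. apply Cmod_gt_0 in E1. rewrite R2 by assumption.
      assert (Ef : f z = (/ W * (csum m (fun k => legs k z) + Rest z))%C).
      { unfold legs. rewrite <- Hrep by assumption. field. assumption. }
      replace (f z - h z / root_prod L z)%C with (/ W * ((csum m (fun k => legs k z) - g z / root_prod L z) + (Rest z - p z)))%C
        by (rewrite Ef; unfold h; field; split; assumption).
      rewrite Cmod_mult, Cmod_inv by assumption. unfold Mt. rewrite Rmult_assoc.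
      apply Rmult_le_compat_l; [left; apply Rinv_0_lt_compat; now apply Cmod_gt_0|].
      eapply Rle_trans; [apply Cmod_triangle|]. rewrite Rmult_plus_distr_r. apply Rplus_le_compat.
      + eapply Rle_trans; [exact E2|]. rewrite rsum_scal. lra.
      + eapply Rle_trans; [apply Ep; assumption|]. apply Rmult_le_compat_l; [assumption|].
        apply Rle_trans with (q' ^ (n / 2)); [apply pow_incr; split; [lra|apply Rmax_l]|].
        eapply Rle_trans; [apply pow_half_bound; assumption|]. apply exp_le.
        assert (c <= - ln q' / 4) by apply Rmin_r. assert (0 <= sqrt (INR n)) by apply sqrt_pos. nra. }
  set (r := fun n => proj1_sig (constructive_indefinite_description _ (Ex n))).
  assert (Hr : forall n, degree_le n (r n) /\
     (forall z, is_pole (r n) z -> is_simple_pole (r n) z /\ exists k j, (k < m)%nat /\ (j < nk k n)%nat /\ z = clustered_point (w k) (d k) R0 sigma (nk k n) j) /\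
     ((Nn <= n)%nat -> forall z, Om z -> Cmod (f z - rat_eval (r n) z) <= Mt * exp (- c * sqrt (INR n)))).
  { intros n. exact (proj2_sig (constructive_indefinite_description _ (Ex n))). }
  exists (fun _ => R0), r, c. split; [assumption|]. split; [auto|]. split.
  - intros n _. destruct (Hr n) as [A [B _]]. split; assumption.
  - exists Mt, Nn. intros n Hn. apply sup_error_le. now apply Hr.
Qed.

Lemma equal_pole_counts : pole_counts m (fun _ n => (n / m)%nat).
Proof.
  assert (H3 := three_corners m w Hpoly). split.
  - intros n _. assert (E : forall K, list_sum (map (fun _ : nat => (n / m)%nat) (seq 0 K)) = (K * (n / m))%nat).
    { induction K as [|K IH]; [reflexivity|]. rewrite seq_S, map_app, list_sum_app, IH. simpl. lia. }
    rewrite E. apply Nat.Div0.mul_div_le.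
  - intros k _. assert (Hm : 0 < INR m) by (apply lt_0_INR; lia).
    apply Rbar_lt_le_trans with (LimInf_seq (fun _ => / (2 * INR m))).
    + rewrite LimInf_seq_const. simpl. apply Rinv_0_lt_compat. lra.
    + apply LimInf_le. exists (2 * m)%nat. intros n Hn.
      assert (Hn0 : 0 < INR n) by (apply lt_0_INR; lia).
      assert (A := Nat.div_mod_eq n m). assert (B := Nat.mod_upper_bound n m ltac:(lia)).
      assert (D : (n <= 2 * (m * (n / m)))%nat) by lia. apply le_INR in D. rewrite !mult_INR in D. change (INR 2) with (1 + 1) in D.
      apply Rmult_le_reg_r with (2 * INR m * INR n); [repeat apply Rmult_lt_0_compat; lra|].
      replace (/ (2 * INR m) * (2 * INR m * INR n)) with (INR n) by (field; lra).
      replace (INR (n / m) / INR n * (2 * INR m * INR n)) with (2 * (INR m * INR (n / m))) by (field; lra). lra.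
Qed.
End Final.

Theorem theorem2p3 (m : nat) (w : nat -> C) (f : C -> C) (delta : R)
  (Hpolygon : convex_polygon m w)
  (Hf : analytic_on (polygon_region m w) f)
  (Hsides : forall (k : nat) (p : C), (k < m)%nat -> open_side m w k p ->
     extends_near (polygon_region m w) f p)
  (Hdelta : 0 < delta)
  (Hcorners : forall k : nat, (k < m)%nat ->
     corner_continuation (polygon_region m w) f (w k) (exterior_bisector m w k) delta) :
  (exists (r : nat -> ratfun) (c : R),
     0 < c /\
     (forall n : nat, (1 <= n)%nat -> degree_le n (r n)) /\
     root_exponential c (fun n => sup_error (polygon_region m w) f (r n)))
  /\
  (forall (sigma : R) (nk : nat -> nat -> nat),
     0 < sigma -> pole_counts m nk ->
     exists (scale : nat -> R) (r : nat -> ratfun) (c : R),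
       0 < c /\
       (forall k : nat, (k < m)%nat -> 0 < scale k) /\
       (forall n : nat, (1 <= n)%nat ->
          degree_le n (r n) /\
          forall z : C, is_pole (r n) z ->
            is_simple_pole (r n) z /\
            exists k j : nat, (k < m)%nat /\ (j < nk k n)%nat /\
              z = clustered_point (w k) (exterior_bisector m w k)
                    (scale k) sigma (nk k n) j) /\
       root_exponential c (fun n => sup_error (polygon_region m w) f (r n))).
Proof.
  assert (H := clustered_approximation m w f delta Hpolygon Hf Hsides Hdelta Hcorners).
  split; [|exact H].
  destruct (H 1 _ Rlt_0_1 (equal_pole_counts m w Hpolygon)) as [scale [r [c [Hc [_ [Hr He]]]]]].
  exists r, c. split; [assumption|]. split; [|assumption]. intros n Hn. now apply Hr.
Qed.
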